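(* Let $\lambda$ be sampled from the Jack measure $M_V(\varepsilon_2,\varepsilon_1)$ with analytic symbol $v$. In the limit $\varepsilon_2\to0\leftarrow\varepsilon_1$ taken so that $\frac{\beta}{2}=\frac{-\varepsilon_2}{\varepsilon_1}>0$ is fixed, the joint moments of the linear statistics $\mathrm{ch}_l[f]$ of the random profile $f_\lambda(c\,|\,\varepsilon_2,\varepsilon_1)$ converge to those of a deterministic limit shape $f_{\star|v}$, a continuous profile independent of $\beta$: for all $n\ge1$ and $l_1,\dots,l_n\in\mathbb{N}$, $$\mathbb{E}\Big[\prod_{i=1}^n\mathrm{ch}_{l_i}[f_\lambda(\cdot\,|\,\varepsilon_2,\varepsilon_1)]\Big]\to\prod_{i=1}^n\mathrm{ch}_{l_i}[f_{\star|v}],$$ where $f_{\star|v}$ is characterized by $$2\pi\cdot\frac{1+f'_{\star|v}(c)}{2}=(v_*d\theta)\big((-\infty,c)\big)=\mathrm{Leb}\{\theta\in[0,2\pi):v(e^{\mathbf{i}\theta})<c\},$$ i.e. $\frac{1+f'_{\star|v}}{2}$ is the distribution function of the push-forward along $v:\mathbb{T}\to\mathbb{R}$ of the normalized uniform measure on the circle (and $f_{\star|v}(c)=|c|$ for $|c|$ large).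
   Context: Fix real $\varepsilon_2<0<\varepsilon_1$, $\beta=-2\varepsilon_2/\varepsilon_1$. $\mathcal{F}=\mathbb{C}[V_1,V_2,\dots]$ has the inner product ($\langle1,1\rangle=1$) in which multiplication by $V_k$ has adjoint $(-\varepsilon_1\varepsilon_2)k\,\partial/\partial V_k$; $P_\lambda(V|\varepsilon_2,\varepsilon_1)$ is the Jack symmetric function $P_\lambda$ with parameter $\alpha=\varepsilon_1/(-\varepsilon_2)$ in power sums $p_k=V_k/(-\varepsilon_2)$. Given fixed complex numbers $V_k$, $k\ge1$ (independent of $\varepsilon_1,\varepsilon_2$), the symbol $v(w)=\sum_{k\ge1}(\overline{V_k}w^{-k}+V_kw^k)$ is real on $\mathbb{T}=\{|w|=1\}$ and is assumed analytic in an open neighborhood of $\mathbb{T}$. The Jack measure $M_V(\varepsilon_2,\varepsilon_1)$ is $\mathrm{Prob}(\lambda)=\Pi^{-1}|P_\lambda(V)|^2/\langle P_\lambda,P_\lambda\rangle$, $\Pi=\exp\big(\sum_k\frac{|V_k|^2}{-\varepsilon_1\varepsilon_2k}\big)$. Profile: the box in row $i$, column $j$ of $\lambda$ is $\{(i-1+s)(\varepsilon_2,-\varepsilon_2)+(j-1+t)(\varepsilon_1,\varepsilon_1):s,t\in[0,1]\}\subset\mathbb{R}^2$, and $f_\lambda(c|\varepsilon_2,\varepsilon_1)$ is the piecewise-linear function whose graph is the upper boundary of the union of $\{y\ge|c|\}$ with these boxes. A continuous profile is a $1$-Lipschitz $f:\mathbb{R}\to\mathbb{R}_{\ge0}$ with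 $\int(f(c)-|c|)dc<\infty$. Linear statistics: $\mathrm{ch}_l[f]=\frac12\int_{-\infty}^\infty c^lf''(c)\,dc$ with $f''$ the distributional second derivative. *)

(* Defs.v *)
From HB Require Import structures.
From mathcomp Require Import all_boot all_order all_algebra.
From mathcomp Require Import all_classical all_reals all_analysis.
From mathcomp Require Import complex.

Set Implicit Arguments.
Unset Strict Implicit.
Unset Printing Implicit Defensive.

Import Order.TTheory GRing.Theory Num.Theory.
Import numFieldNormedType.Exports.
Local Open Scope classical_set_scope.
Local Open Scope ring_scope.

(* Partitions of n.  A partition of n is encoded (bijectively) by the  *)
(* nonincreasing n-tuple of its parts padded with zeros.               *)
Definition partn (n : nat) :=
  {t : n.-tuple 'I_n.+1 |
     sorted geq [seq val i | i <- tval t] &&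
     (sumn [seq val i | i <- tval t] == n)}.

Definition parts (n : nat) (la : partn n) : seq nat :=
  [seq k <- [seq val i | i <- tval (val la)] | (0 < k)%N].

Definition zee (mu : seq nat) : nat :=
  \prod_(1 <= k < (sumn mu).+1) (k ^ count_mem k mu * (count_mem k mu)`!).

(* Coefficient of the monomial x^la = x_1^{la_1} x_2^{la_2} ... in the
   power-sum symmetric function p_mu = prod_j (sum_i x_i^{mu_j}). *)
Definition pm_coef (mu la : seq nat) : nat :=
  #|[pred g : {ffun 'I_(size mu) -> 'I_(size la)} |
      [forall i : 'I_(size la),
         (\sum_(j : 'I_(size mu) | g j == i) nth 0 mu j)%N == nth 0 la i]]|.

Definition dominates (la nu : seq nat) : bool :=
  all (fun k => sumn (take k nu) <= sumn (take k la))%N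
      (iota 0 (maxn (size la) (size nu)).+1).

(* A family c (c la mu = coefficient of p_mu in P_la), la, mu |- n, is the
   family of Jack symmetric functions P_la with parameter al iff
   (i)  P_la = m_la + sum_{nu < la} u_{la nu} m_nu  (monomial expansion,
        read off through the coefficient of x^nu), and
   (ii) <P_la, P_la'>_al = 0 for la <> la', where
        <p_mu, p_nu>_al = delta_{mu nu} z_mu al^{l(mu)}.               *)
Definition jack_family (R : realType) (al : R) (n : nat)
    (c : {ffun partn n -> {ffun partn n -> R}}) : Prop :=
  [/\ forall la : partn n,
        \sum_(mu : partn n) c la mu * (pm_coef (parts mu) (parts la))%:R = 1,
      forall la nu : partn n, ~~ dominates (parts la) (parts nu) ->
        \sum_(mu : partn n) c la mu * (pm_coef (parts mu) (parts nu))%:R = 0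
    & forall la la' : partn n, la != la' ->
        \sum_(mu : partn n) c la mu * c la' mu * (zee (parts mu))%:R
                              * al ^+ size (parts mu) = 0].

(* The Jack coefficients (the unique family above, chosen by choice). *)
Definition jackc (R : realType) (al : R) (n : nat) :
    {ffun partn n -> {ffun partn n -> R}} :=
  xget [ffun _ => [ffun _ => 0]]
       [set c : {ffun partn n -> {ffun partn n -> R}} | jack_family al c].

(* <P_la, P_la>, which in the V-variables with the inner product of F
   equals the al-inner product with al = e1/(-e2). *)
Definition jack_norm (R : realType) (al : R) (n : nat) (la : partn n) : R :=
  \sum_(mu : partn n) (@jackc R al n la mu) ^+ 2 * (zee (parts mu))%:R
                        * al ^+ size (parts mu).

Definition jackV (R : realType) (e2 e1 : R) (V : nat -> R[i]) (n : nat)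
    (la : partn n) : R[i] :=
  \sum_(mu : partn n)
     ((@jackc R (e1 / (- e2)) n la mu)%:C)%C *
     \prod_(k <- parts mu) (V k / ((- e2)%:C)%C).

Definition sqmod (R : realType) (z : R[i]) : R := complex.Re z ^+ 2 + complex.Im z ^+ 2.

Definition PiV (R : realType) (e2 e1 : R) (V : nat -> R[i]) : R :=
  expR (limn (fun N => \sum_(1 <= k < N) sqmod (V k) / (- e1 * e2 * k%:R))).

Definition jack_prob (R : realType) (e2 e1 : R) (V : nat -> R[i]) (n : nat)
    (la : partn n) : R :=
  sqmod (jackV e2 e1 V la) / (PiV e2 e1 V * jack_norm (e1 / (- e2)) la).

(* Profile f_la(c | e2, e1): upper boundary of the union of the region
   below the graph of |c| with the boxes
   {(i+s)(e2,-e2) + (j+t)(e1,e1) : s,t in [0,1]}, row i+1, column j+1. *)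
Definition profile (R : realType) (e2 e1 : R) (n : nat) (la : partn n)
    (c : R) : R :=
  sup ([set `|c|] `|`
       [set y | exists (i j : nat) (s t : R),
          [/\ (i < size (parts la))%N, (j < nth 0 (parts la) i)%N,
              0 <= s <= 1, 0 <= t <= 1 &
              c = (i%:R + s) * e2 + (j%:R + t) * e1 /\
              y = - ((i%:R + s) * e2) + (j%:R + t) * e1]]).

Definition continuous_profile (R : realType) (f : R -> R) : Prop :=
  [/\ forall x y, `|f x - f y| <= `|x - y|,
      forall x, 0 <= f x &
      (@lebesgue_measure R).-integrable setT (fun c => (f c - `|c|)%:E)].

(* ch_l[f] = 1/2 int c^l f''(c) dc, f'' the distributional second
   derivative.  For f with f(c) = |c| outside a compact set, pairing f''
   = (f - |.|)'' + 2 delta_0 with c^l (cut off far away) and integrating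
   by parts twice gives
     ch_l[f] = 0^l + l(l-1)/2 * int c^(l-2) (f(c) - |c|) dc.           *)
Definition ch (R : realType) (l : nat) (f : R -> R) : R :=
  0 ^+ l + (l * l.-1)%:R / 2 *
    Rintegral (@lebesgue_measure R) setT (fun c => c ^+ (l - 2) * (f c - `|c|)).

Definition jack_moment (R : realType) (e2 e1 : R) (V : nat -> R[i])
    (s : seq nat) : R :=
  limn (fun N => \sum_(0 <= n < N)
     \sum_(la : partn n) jack_prob e2 e1 V la *
        \prod_(l <- s) ch l (profile e2 e1 la)).

(* The symbol v(e^{i theta}) = sum_{k>=1} (conj(V_k) e^{-ik theta}
   + V_k e^{ik theta}) = sum_{k>=1} 2 Re(V_k e^{ik theta}). *)
Definition symbol (R : realType) (V : nat -> R[i]) (th : R) : R :=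
  limn (fun N => \sum_(1 <= k < N)
     2 * (complex.Re (V k) * cos (k%:R * th) - complex.Im (V k) * sin (k%:R * th))).

(* Main.v *)
Require Import Defs.
From HB Require Import structures.
From mathcomp Require Import all_boot all_order all_algebra.
From mathcomp Require Import fingroup perm.
From mathcomp Require mpoly ssrcomplements boolp.
From mathcomp Require Import ring lra zify.

(** Write [b] for minus the parameter [e2]. On polynomials in the power sums act the operators
    [hamiltonian r], read off from the Nazarov-Sklyanin Lax operator, a Toeplitz operator whose
    symbol has the multiplications by [V_k] and their adjoints as coefficients. Substituting [n]
    variables turns them into sums of powers of Heckman-Dunkl operators ([to_x_hamiltonian]), which
    are triangular for the dominance order. Triangularity and self-adjointness make every Jack
    function an eigenvector ([ham_jackp]). The generating series [1 - sum_r eig r z^(r+2)] of the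
    eigenvalues is a product over the corners of the profile ([newton_eigser]), so Newton's
    identities translate eigenvalues into power sums of corners, and these are the statistics [ch l]
    of the profile ([ch_profile]). The eigenvalues separate partitions, which also yields the
    existence of the Jack family ([jack_exists]).

    The Jack measure is the squared expansion of a coherent state in the Jack basis, so the
    expectation of a product of eigenvalues is the expectation of a product of Hamiltonians in that
    state ([jack_moment_jets], [moment_series]). The coherent state is an eigenvector of the
    annihilation operators; after normal ordering the operators [V_k] become numbers, up to
    commutators of size [e1 * b] and the diagonal term of size [e1 - b]. Both vanish in the limit,
    with bounds geometric in the degree ([jh_good]), so limit and summation may be exchanged. What
    remains are scalars, hence the expectation of a product of eigenvalues tends to the product of
    classical values [cO r] ([jets_lim], [climit1]).

    The numbers [cO r] are built in the same way from the Toeplitz operator with the numerical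
    symbol [v]. A Wiener-Hopf factorization of [1 - z v] shows that [1 - sum_r cO r z^(r+2)] is the
    exponential of the circle average of [log (1 - z v)] ([newton_wh], [newton_symbol]). These are
    Newton's identities again, now with the averages of [v^l] in the place of the power sums of
    corners, so that joint moments of the [ch l] converge to products of averages of [v^l]
    ([climit_chpow]).

    The limit shape is the circle average of [|c - v|]. Half the second derivative of [|c - z|] is a
    unit mass at [z], so its [l]-th statistic is the average of [v^l] ([ch_lshape]); it equals [|c|]
    far out because [v] has mean zero, and its derivative is the distribution function of [v] up to
    an affine change ([lshape_derive]). *)

Module JackAlgebra.
Import mpoly ssrcomplements.
Import Order.TTheory GRing.Theory Num.Theory.
Set Implicit Arguments.
Unset Strict Implicit.
Unset Printing Implicit Defensive.
Local Open Scope ring_scope.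
Local Notation partn := Defs.partn.

(** * Divided differences of polynomials *)

Section DividedDifference.
Variables (F : fieldType) (N : nat).
Implicit Types (m : 'X_{1..N}) (q : {mpoly F[N]}) (i j : 'I_N).

Definition mnmswap i j m := [multinom m (tperm i j k) | k < N].

Definition mnmmove i j m t : 'X_{1..N} :=
  [multinom (if k == i then m i - t else if k == j then m j + t else m k)%N
   | k < N].

(** For [m j <= m i] this is the geometric quotient of ['X_i * ('X_[m] - 'X_[mnmswap i j m])] by
    ['X_i - 'X_j]. Truncated subtraction empties the sum when [m i <= m j], so at most one of the
    two terms of [ddiffX] is nonzero. *)
Definition rungs i j m : {mpoly F[N]} := \sum_(t < m i - m j) 'X_[mnmmove i j m t].

Definition ddiffX i j m : {mpoly F[N]} := rungs i j m - rungs i j (mnmswap i j m).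

(* [ddiff i j q] is [X_i / (X_i - X_j) * (q - s_ij q)]. *)
Definition ddiff i j q : {mpoly F[N]} := \sum_(m <- msupp q) q@_m *: ddiffX i j m.

Lemma mnmswap_l i j m : mnmswap i j m i = m j.
Proof. by rewrite mnmE tpermL. Qed.

Lemma mnmswap_r i j m : mnmswap i j m j = m i.
Proof. by rewrite mnmE tpermR. Qed.

Lemma mnmswapK i j : involutive (mnmswap i j).
Proof. by move=> m; apply/mnmP => k; rewrite !mnmE tpermK. Qed.

Lemma mnmswapC i j m : mnmswap i j m = mnmswap j i m.
Proof. by rewrite /mnmswap tpermC. Qed.

Lemma msymX_swap i j m : msym (tperm i j) 'X_[F, m] = 'X_[mnmswap i j m].
Proof.
by rewrite msymX tpermV.
Qed.

Lemma mcoeff_swap i j q m : (msym (tperm i j) q)@_m = q@_(mnmswap i j m).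
Proof. by rewrite mcoeff_sym. Qed.

Lemma rungsE i j m : i != j -> (m j <= m i)%N ->
  ('X_i - 'X_j) * rungs i j m = 'X_i * ('X_[m] - 'X_[mnmswap i j m]).
Proof.
move=> ij le.
have E0 : mnmmove i j m 0 = m.
  by apply/mnmP => k; rewrite mnmE subn0 addn0; do 2 case: eqP => [->|_] //.
have E1 : mnmmove i j m (m i - m j) = mnmswap i j m.
  apply/mnmP => k; rewrite !mnmE.
  case: eqP => [->|ki]; first by rewrite tpermL subKn.
  case: eqP => [->|kj]; first by rewrite tpermR subnKC.
  by rewrite tpermD // eq_sym; apply/eqP.
(* ['X_j] times rung [t] is ['X_i] times rung [t + 1], so the product telescopes. *)
pose f t := - ('X_i * 'X_[F, mnmmove i j m t]).
rewrite /rungs -(big_mkord predT (fun t => 'X_[mnmmove i j m t])) mulr_sumr.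
rewrite (telescope_sumr_eq f) //; first by rewrite /f E0 E1; ring.
move=> t /andP[_ tlt]; rewrite /f opprK mulrBl [RHS]addrC; congr (_ - _).
rewrite -!mpolyXD; congr 'X_[_]; apply/mnmP => k; rewrite !mnmDE !mnm1E !mnmE.
rewrite ![_ == k]eq_sym.
case: (eqVneq k i) => [->|ki]; first by rewrite (negbTE ij); lia.
by case: (eqVneq k j) => _; lia.
Qed.

Lemma ddiffXE i j m : i != j ->
  ('X_i - 'X_j) * ddiffX i j m = 'X_i * ('X_[m] - 'X_[mnmswap i j m]).
Proof.
move=> ij; rewrite /ddiffX mulrBr.
case: (leqP (m j) (m i)) => [le|/ltnW le].
  rewrite rungsE // [X in _ - _ * X]/rungs mnmswap_l mnmswap_r.
  have -> : (m j - m i = 0)%N by lia.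
  by rewrite big_ord0 mulr0 subr0.
rewrite [X in _ * X - _]/rungs; have -> : (m i - m j = 0)%N by lia.
rewrite big_ord0 rungsE ?mnmswap_l ?mnmswap_r // mnmswapK; ring.
Qed.

Lemma ddiffE i j q : i != j ->
  ('X_i - 'X_j) * ddiff i j q = 'X_i * (q - msym (tperm i j) q).
Proof.
move=> ij.
have -> : q - msym (tperm i j) q
    = \sum_(m <- msupp q) q@_m *: ('X_[m] - 'X_[mnmswap i j m]).
  rewrite {1 2}(mpolyE q) (raddf_sum (msym (tperm i j))) -sumrB.
  by apply: eq_bigr => m _; rewrite /= msymZ msymX_swap -scalerBr.
rewrite !mulr_sumr; apply: eq_bigr => m _.
by rewrite -!scalerAr ddiffXE.
Qed.

Lemma subXX_neq0 i j : i != j -> 'X_i - 'X_j != 0 :> {mpoly F[N]}.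
Proof.
move=> ij; apply/eqP => /(congr1 (mcoeff U_(i))).
rewrite mcoeffB !mcoeffXU eqxx mcoeff0 eq_sym (negbTE ij) subr0.
by move/eqP; rewrite oner_eq0.
Qed.

Lemma ddiff_unique i j q r : i != j ->
  ('X_i - 'X_j) * r = 'X_i * (q - msym (tperm i j) q) -> ddiff i j q = r.
Proof. by move=> ij e; apply: (mulfI (subXX_neq0 ij)); rewrite ddiffE. Qed.

Lemma ddiffD i j q r : i != j -> ddiff i j (q + r) = ddiff i j q + ddiff i j r.
Proof.
move=> ij; apply: ddiff_unique => //; rewrite mulrDr !ddiffE // msymD; ring.
Qed.

Lemma ddiffMsym i j g q : i != j -> msym (tperm i j) g = g ->
  ddiff i j (g * q) = g * ddiff i j q.
Proof.
move=> ij sg; apply: ddiff_unique => //; rewrite msymM sg mulrCA ddiffE //; ring.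
Qed.

Lemma ddiffXn i j k : i != j ->
  ddiff i j ('X_i ^+ k) = \sum_(a < k) 'X_i ^+ (k - a) * 'X_j ^+ a.
Proof.
move=> ij; apply: ddiff_unique => //.
have -> : msym (tperm i j) ('X_i ^+ k) = 'X_j ^+ k :> {mpoly F[N]}.
  rewrite rmorphXn /= msymX_swap; congr ('X_[_] ^+ _).
  by apply/mnmP => l; rewrite mnmE !mnm1E eq_sym (canF_eq (tpermK i j)) tpermL eq_sym.
rewrite subrXX mulrCA; congr (_ * _); rewrite mulr_sumr.
apply: eq_bigr => a _; rewrite mulrA -exprS; congr (_ ^+ _ * _); have := ltn_ord a; lia.
Qed.
End DividedDifference.

(** * The Lax operator in power sums and the Heckman-Dunkl operators *)

Section Lax.
Variables (F : fieldType) (e1 b : F) (n N : nat).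
Implicit Types (g : {mpoly F[n]}) (h : 'I_n -> {mpoly F[n]}).
Implicit Types (q : {mpoly F[N]}) (i j : 'I_N).

Definition psum k : {mpoly F[N]} := \sum_i 'X_i ^+ k.

Definition to_x g : {mpoly F[N]} :=
  mmap (@mpolyC N F) (fun k : 'I_n => psum k.+1) g.

(** The spectral variable [w] of a state is specialised to ['X_i]; this links one state in power
    sums to the nonsymmetric polynomials on which [dunkl i] acts. *)
Definition to_xi i h : {mpoly F[N]} := \sum_(m < n) 'X_i ^+ m.+1 * to_x (h m).

Definition dunkl i q : {mpoly F[N]} :=
  e1 *: ('X_i * q^`M(i)) + b *: \sum_(j | j != i) ddiff i j q.

(* Variable [k : 'I_n] of [{mpoly F[n]}] stands for the power sum [p_(k+1)],
   and component [m] of a state [h] for the coefficient of [w^(m+1)]. *)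
Definition annih (k : 'I_n) g : {mpoly F[n]} := (e1 * k.+1%:R) *: g^`M(k).
Definition creat (k : 'I_n) g : {mpoly F[n]} := b *: ('X_k * g).

Definition raise g : 'I_n -> {mpoly F[n]} := fun m => annih m g.
Definition lower h : {mpoly F[n]} := \sum_(m < n) creat m (h m).

(** The Lax matrix without its vacuum row and column: a Toeplitz operator on positive powers of [w]
    with operator coefficients, plus [(e1 - b)] times [w d/dw]. [raise] and [lower] are the removed
    column and row, so [hamiltonian r] collects the paths of length [r + 2] that return to the
    vacuum only at their end. *)
Definition lax h : 'I_n -> {mpoly F[n]} := fun m =>
  ((e1 - b) * m.+1%:R) *: h m
  + \sum_(k < n) \sum_(l < n | (k + l).+1 == m) annih k (h l)
  + \sum_(k < n) \sum_(l < n | (m + k).+1 == l) creat k (h l).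

Definition hamiltonian r g : {mpoly F[n]} := lower (iter r lax (raise g)).

(** Total weight [n], with [w] of weight one. This makes the cut at [n] components exact: a term of
    [w]-degree above [n] would need an annihilation exceeding the available weight. *)
Definition graded h := forall m : 'I_n, h m \is (n - m.+1).-homog for mnmwgt.

Lemma annih_homog k d g : g \is d.-homog for mnmwgt ->
  annih k g \is (d - k.+1).-homog for mnmwgt.
Proof.
move=> hg; apply: dhomogZ; apply/dhomogP => m.
rewrite mcoeff_msupp mcoeff_deriv => nz.
have /(dhomog_mf hg) : (m + U_(k))%MM \in msupp g.
  by rewrite mcoeff_msupp; apply: contraNneq nz => ->; rewrite mul0rn.
by rewrite /= mnmwgtD mnmwgt1 => <-; rewrite addnK.
Qed.

Lemma annih_homog0 (k : 'I_n) d g : g \is d.-homog for mnmwgt -> (d < k.+1)%N ->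
  g^`M(k) = 0.
Proof.
move=> hg lt; apply/mpolyP => m; rewrite mcoeff0 mcoeff_deriv.
rewrite (dhomog_nemf_coeff hg) ?mul0rn //= mnmwgtD mnmwgt1; lia.
Qed.

Lemma creat_homog k d g : g \is d.-homog for mnmwgt ->
  creat k g \is (k.+1 + d).-homog for mnmwgt.
Proof.
by move=> hg; apply: dhomogZ; apply: dhomogM => //; rewrite dhomogX /= mnmwgt1.
Qed.

Lemma raise_graded g : g \is n.-homog for mnmwgt -> graded (raise g).
Proof. by move=> hg m; apply: annih_homog. Qed.

Lemma lax_graded h : graded h -> graded (lax h).
Proof.
move=> hh m; apply: rpredD; first apply: rpredD.
- by apply: dhomogZ.
- apply: rpred_sum => k _; apply: rpred_sum => l /eqP e.
  by have := annih_homog k (hh l); rewrite -e -subnDA -addnS addSnnS addnC addnS.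
- apply: rpred_sum => k _; apply: rpred_sum => l /eqP e.
  have := creat_homog k (hh l); congr (_ \is ishomog1 _ _); have := ltn_ord l; lia.
Qed.

Lemma lower_homog h : graded h -> lower h \is n.-homog for mnmwgt.
Proof.
move=> hh; apply: rpred_sum => m _.
have := creat_homog m (hh m); congr (_ \is ishomog1 _ _); have := ltn_ord m; lia.
Qed.

Lemma hamiltonian_homog r g : g \is n.-homog for mnmwgt ->
  hamiltonian r g \is n.-homog for mnmwgt.
Proof.
move=> hg; apply: lower_homog; elim: r => [|r IH] /=; first exact: raise_graded.
exact: lax_graded.
Qed.

Lemma to_xXU k : to_x 'X_k = psum k.+1.
Proof. by rewrite /to_x mmapX mmap1U. Qed.


Lemma msym_X1 (s : 'S_N) i : msym s 'X_i = 'X_(s i) :> {mpoly F[N]}.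
Proof.
rewrite msymX; congr 'X_[_]; apply/mnmP => l; rewrite mnmE !mnm1E.
by rewrite eq_sym (can2_eq (permKV s) (permK s)) eq_sym.
Qed.

Lemma msym_psum (s : 'S_N) k : msym s (psum k) = psum k.
Proof.
rewrite /psum raddf_sum /= [RHS](reindex_inj (@perm_inj _ s)) /=.
by apply: eq_bigr => i _; rewrite rmorphXn /= msym_X1.
Qed.

Lemma to_xM : {morph to_x : g g' / g * g'}.
Proof. exact: rmorphM. Qed.

Lemma to_xD : {morph to_x : g g' / g + g'}.
Proof. exact: raddfD. Qed.

Lemma to_xB : {morph to_x : g g' / g - g'}.
Proof. exact: raddfB. Qed.

Lemma to_x0 : to_x 0 = 0.
Proof. exact: raddf0. Qed.

Lemma to_x1 : to_x 1 = 1.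
Proof. exact: rmorph1. Qed.

Lemma to_x_sum I (r : seq I) (P : pred I) (G : I -> {mpoly F[n]}) :
  to_x (\sum_(k <- r | P k) G k) = \sum_(k <- r | P k) to_x (G k).
Proof. exact: raddf_sum. Qed.

Lemma to_xZ c g : to_x (c *: g) = c *: to_x g.
Proof. by rewrite /to_x mmapZ mul_mpolyC. Qed.

Lemma to_x_mono (m : 'X_{1..n}) :
  to_x 'X_[m] = \prod_(k < n) psum k.+1 ^+ m k.
Proof. by rewrite /to_x mmapX. Qed.

Lemma msym_to_x (s : 'S_N) g : msym s (to_x g) = to_x g.
Proof.
rewrite (mpolyE g) to_x_sum raddf_sum /=; apply: eq_bigr => m _.
rewrite to_xZ msymZ to_x_mono rmorph_prod; congr (_ *: _).
by apply: eq_bigr => k _; rewrite rmorphXn /= msym_psum.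
Qed.

Lemma mderiv_psum i k : (psum k.+1)^`M(i) = k.+1%:R *: 'X_i ^+ k.
Proof.
rewrite /psum raddf_sum /= (bigD1 i) //= big1 ?addr0; last first.
  move=> j ji; rewrite mpolyXn mderivX mulmnE mnm1E (negbTE ji) mul0n.
  by rewrite scale0r.
rewrite !mpolyXn mderivX mulmnE mnm1E eqxx mul1n; congr (_ *: 'X_[_]).
by rewrite mulmSr addmK.
Qed.

(** Chain rule for the substitution of power sums. The polynomials obeying it include 1 and the
    variables and are stable under products, hence include all monomials. *)
Lemma mderiv_to_x i g :
  'X_i * (to_x g)^`M(i) = \sum_(k < n) k.+1%:R *: ('X_i ^+ k.+1 * to_x g^`M(k)).
Proof.
pose ok g := 'X_i * (to_x g)^`M(i)
  = \sum_(k < n) k.+1%:R *: ('X_i ^+ k.+1 * to_x g^`M(k)).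
have okM g1 g2 : ok g1 -> ok g2 -> ok (g1 * g2).
  rewrite /ok => e1' e2'; rewrite to_xM mderivM.
  have -> : 'X_i * ((to_x g1)^`M(i) * to_x g2 + to_x g1 * (to_x g2)^`M(i))
    = to_x g2 * ('X_i * (to_x g1)^`M(i)) + to_x g1 * ('X_i * (to_x g2)^`M(i)).
    by ring.
  rewrite e1' e2' !mulr_sumr -big_split /=; apply: eq_bigr => k _.
  rewrite mderivM -!scalerAr -scalerDr; congr (_ *: _).
  rewrite to_xD !to_xM; ring.
have ok1 : ok 1.
  rewrite /ok to_x1 -mpolyC1 mderivC mulr0 big1 // => k _.
  by rewrite -mpolyC1 mderivC to_x0 mulr0 scaler0.
have okU (k : 'I_n) : ok 'X_k.
  rewrite /ok to_xXU mderiv_psum (bigD1 k) //= big1 ?addr0.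
    rewrite -scalerAr -exprS; congr (_ *: _).
    by rewrite mderivX mnm1E eqxx scale1r -{1}[U_(k)%MM]add0m addmK mpolyX0 to_x1 mulr1.
  move=> l lk; rewrite mderivX mnm1E eq_sym (negbTE lk) scale0r to_x0.
  by rewrite mulr0 scaler0.
have okX (m : 'X_{1..n}) : ok 'X_[m].
  rewrite mpolyXE_id; elim/big_ind: _ => // k _; elim: (m k) => [|p IH].
    by rewrite expr0.
  by rewrite exprS; apply: okM.
rewrite (mpolyE g) to_x_sum raddf_sum /= mulr_sumr.
under [RHS]eq_bigr => k _ do
  rewrite [X in to_x X](raddf_sum (mderiv k)) to_x_sum mulr_sumr scaler_sumr.
rewrite exchange_big /=; apply: eq_bigr => m _.
rewrite to_xZ mderivZ -scalerAr okX scaler_sumr; apply: eq_bigr => k _.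
by rewrite /= mderivZ to_xZ -scalerAr !scalerA mulrC.
Qed.

Lemma ddiff_sum i j I (r : seq I) (G : I -> {mpoly F[N]}) : i != j ->
  ddiff i j (\sum_(k <- r) G k) = \sum_(k <- r) ddiff i j (G k).
Proof.
move=> ij; elim: r => [|k r IH]; last by rewrite !big_cons ddiffD // IH.
by rewrite !big_nil /ddiff msupp0 big_nil.
Qed.

Lemma dunkl_sum i I (r : seq I) (G : I -> {mpoly F[N]}) :
  dunkl i (\sum_(k <- r) G k) = \sum_(k <- r) dunkl i (G k).
Proof.
rewrite /dunkl raddf_sum /= mulr_sumr scaler_sumr big_split /=; congr (_ + _).
rewrite -scaler_sumr [in RHS]exchange_big /=; congr (_ *: _).
by apply: eq_bigr => j ij; rewrite ddiff_sum // eq_sym.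
Qed.

Lemma dunkl_to_x i g : dunkl i (to_x g) = to_xi i (raise g).
Proof.
rewrite /dunkl [X in _ + _ *: X]big1 => [|j ij]; last first.
  rewrite -[to_x g]mulr1 ddiffMsym ?msym_to_x // 1?eq_sym //.
  by rewrite -(expr0 'X_i) ddiffXn 1?eq_sym // big_ord0 mulr0.
rewrite scaler0 addr0 mderiv_to_x scaler_sumr; apply: eq_bigr => k _.
by rewrite /raise /annih to_xZ -scalerAr scalerA.
Qed.

(** Since [to_x g] is symmetric, the divided differences pass through it and act on the power of
    ['X_i] alone; the derivative obeys the Leibniz rule. *)
Lemma dunkl_Xto_x i m g :
  dunkl i ('X_i ^+ m * to_x g) =
    (e1 * m%:R) *: ('X_i ^+ m * to_x g)
    + e1 *: \sum_(k < n) k.+1%:R *: ('X_i ^+ (m + k).+1 * to_x g^`M(k))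
    + b *: (to_x g * \sum_(a < m) 'X_i ^+ (m - a) * (psum a - 'X_i ^+ a)).
Proof.
rewrite /dunkl; congr (_ + _ *: _); last first.
  under eq_bigr => j ij do rewrite [X in ddiff _ _ X]mulrC ddiffMsym
    ?msym_to_x ?ddiffXn 1?eq_sym //.
  rewrite -mulr_sumr exchange_big /=; congr (_ * _); apply: eq_bigr => a _.
  by rewrite -mulr_sumr /psum [X in _ = _ * (X - _)](bigD1 i) //= addrAC subrr add0r.
rewrite mderivM mulrDr scalerDr; congr (_ + _).
  rewrite -scalerA; congr (_ *: _); case: m => [|m].
    by rewrite expr0 -mpolyC1 mderivC mul0r mulr0 scale0r.
  rewrite mpolyXn mderivX mulmnE mnm1E eqxx mul1n -scalerAl -scalerAr.
  by rewrite mulmSr addmK mulrA -mpolyXD addmC.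
congr (_ *: _); rewrite mulrCA mderiv_to_x mulr_sumr; apply: eq_bigr => k _.
by rewrite -scalerAr mulrA -exprD addnS.
Qed.

(** The intertwining relation behind [to_x_hamiltonian]. Annihilators come from differentiating the
    coefficients of the state, creators from the power sums [psum a] with [a > 0] in the exchange
    sum, and the diagonal from [w d/dw] together with the excluded index [j = i]. *)
Lemma dunkl_to_xi i h : graded h ->
  dunkl i (to_xi i h) - (b * N%:R) *: to_xi i h = to_xi i (lax h).
Proof.
move=> hh; rewrite /to_xi dunkl_sum scaler_sumr -sumrB.
have -> : \sum_(m < n) 'X_i ^+ m.+1 * to_x (lax h m)
  = \sum_(m < n) (((e1 - b) * m.+1%:R) *: ('X_i ^+ m.+1 * to_x (h m))
     + e1 *: \sum_(k < n) k.+1%:R *: ('X_i ^+ (m.+1 + k).+1 * to_x (h m)^`M(k))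
     + b *: (to_x (h m) * \sum_(k < m) 'X_i ^+ (m - k) * psum k.+1)).
  under eq_bigr => m _ do rewrite /lax !to_xD !mulrDr to_xZ -scalerAr.
  rewrite big_split /= big_split /= [RHS]big_split /= [in RHS]big_split /=.
  congr (_ + _ + _).
  - under eq_bigr => m _.
      rewrite to_x_sum mulr_sumr.
      under eq_bigr => k _ do rewrite to_x_sum mulr_sumr big_mkcond /=.
      rewrite exchange_big /=; over.
    rewrite exchange_big /=; apply: eq_bigr => l _.
    rewrite exchange_big scaler_sumr /=; apply: eq_bigr => k _.
    rewrite -big_mkcond /=.
    under eq_bigr => m _ do rewrite /annih to_xZ -scalerAr.
    rewrite -scaler_sumr -scalerA; congr (_ *: (_ *: _)).
    rewrite -mulr_suml (eq_bigl (fun m : 'I_n => (m == (k + l).+1 :> nat)));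
      last by move=> m; rewrite eq_sym.
    rewrite (big_ord1_eq _ (fun m => 'X_i ^+ m.+1)).
    case: ltnP => [lt|ge]; first by rewrite addnC.
    rewrite (annih_homog0 (hh l)) ?to_x0 ?mulr0 //; have := ltn_ord l; lia.
  - under eq_bigr => m _.
      rewrite to_x_sum mulr_sumr.
      under eq_bigr => k _ do rewrite to_x_sum mulr_sumr big_mkcond /=.
      rewrite exchange_big /=; over.
    rewrite exchange_big /=; apply: eq_bigr => l _.
    rewrite exchange_big mulr_sumr scaler_sumr /=.
    rewrite (big_ord_widen n (fun k : nat =>
       b *: (to_x (h l) * ('X_i ^+ (l - k) * psum k.+1)))); last exact: ltnW.
    rewrite [RHS]big_mkcond /=; apply: eq_bigr => k _.
    rewrite -big_mkcond /= (eq_bigl (fun m : 'I_n => (k < l)%N &&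
      (m == l - k.+1 :> nat)%N)); last first.
      by move=> m /=; lia.
    case: ltnP => [lt|ge] /=; last by rewrite big_pred0.
    rewrite (big_ord1_eq _ (fun m => 'X_i ^+ m.+1 * to_x (creat k (h l)))).
    rewrite ifT; last by have := ltn_ord l; lia.
    rewrite /creat to_xZ -scalerAr to_xM to_xXU subnSK //; congr (_ *: _); ring.
apply: eq_bigr => m _; rewrite dunkl_Xto_x.
(* The power sum of exponent zero equals [N]; it is the contribution that the shift by [b * N]
   removes. *)
have -> : \sum_(a < m.+1) 'X_i ^+ (m.+1 - a) * (psum a - 'X_i ^+ a)
    = N%:R *: 'X_i ^+ m.+1 - m.+1%:R *: 'X_i ^+ m.+1
      + \sum_(k < m) 'X_i ^+ (m - k) * psum k.+1.
  under eq_bigr => a _.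
    rewrite mulrBr -exprD subnK; last exact: ltnW.
    over.
  rewrite sumrB sumr_const card_ord big_ord_recl /= subn0 /psum.
  have -> : \sum_(i0 < N) 'X_i0 ^+ 0 = N%:R :> {mpoly F[N]}.
    by rewrite sumr_const card_ord.
  by rewrite mulr_natr !scaler_nat addrAC; congr (_ + _); apply: eq_bigr.
by rewrite -!mul_mpolyC; ring.
Qed.

Lemma to_x_lower h : to_x (lower h) = b *: \sum_i to_xi i h.
Proof.
rewrite to_x_sum scaler_sumr; under [RHS]eq_bigr => i _ do rewrite scaler_sumr.
rewrite exchange_big; apply: eq_bigr => m _ /=.
by rewrite /creat to_xZ to_xM to_xXU /psum mulr_suml scaler_sumr.
Qed.

(* The Nazarov-Sklyanin Hamiltonians act on symmetric polynomials as sums of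
   powers of (shifted) Heckman-Dunkl operators. *)
Lemma to_x_hamiltonian r g : g \is n.-homog for mnmwgt ->
  to_x (hamiltonian r g) = b *: \sum_i
    iter r (fun q => dunkl i q - (b * N%:R) *: q) (dunkl i (to_x g)).
Proof.
move=> hg; rewrite to_x_lower; congr (_ *: _); apply: eq_bigr => i _.
rewrite dunkl_to_x.
have: graded (iter r lax (raise g)) /\ to_xi i (iter r lax (raise g)) =
  iter r (fun q => dunkl i q - (b * N%:R) *: q) (to_xi i (raise g)); last by case.
elim: r => [|r [IH1 IH2]] /=; first by split => //; apply: raise_graded.
by split; [apply: lax_graded | rewrite -IH2 dunkl_to_xi].
Qed.

End Lax.

(** * Dominance order and leading coefficients *)

Section Dominance.
Variables (F : fieldType) (N : nat).
Implicit Types (m : 'X_{1..N}) (q : {mpoly F[N]}) (i j : 'I_N) (la : seq nat).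

(* Dominance order [m^+ <= la], phrased without sorting [m]. *)
Definition domin la m := forall S : {set 'I_N},
  (\sum_(i in S) m i <= sumn (take #|S| la))%N.

Definition supp_le la q := forall m, q@_m != 0 -> domin la m.

Lemma domin_perm la (s : 'S_N) m : domin la m ->
  domin la [multinom m (s i) | i < N].
Proof.
move=> dm S; rewrite -(card_imset S (@perm_inj _ s)).
apply: leq_trans (dm _); rewrite big_imset /=; last by move=> x y _ _ /perm_inj.
by apply: leq_sum => i _; rewrite mnmE.
Qed.

Lemma domin_swap la i j m : domin la m -> domin la (mnmswap i j m).
Proof. exact: domin_perm. Qed.

Lemma mnmmove0 i j m : mnmmove i j m 0 = m.
Proof.
by apply/mnmP => k; rewrite mnmE subn0 addn0; do 2 case: eqP => [->|_] //.
Qed.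

(** Only for [j \in S] and [i \notin S] can the sum over [S] grow. There [S] is compared with
    [i |: S :\ j], which has the same size, and [m j + t <= m i]. *)
Lemma domin_move la i j m t : i != j -> (t <= m i - m j)%N -> domin la m ->
  domin la (mnmmove i j m t).
Proof.
move=> ij le dm; case: (leqP (m j) (m i)) => mji; last first.
  by move: le; rewrite (eqnP (ltnW mji)) leqn0 => /eqP ->; rewrite mnmmove0.
move=> S; have ji : (j == i) = false by rewrite eq_sym (negbTE ij).
have moveE k : mnmmove i j m t k =
    (if k == i then m i - t else if k == j then m j + t else m k)%N by rewrite mnmE.
have othE (A : {set 'I_N}) : i \notin A -> j \notin A ->
    (\sum_(k in A) mnmmove i j m t k = \sum_(k in A) m k)%N.
  move=> iA jA; apply: eq_bigr => k kA; rewrite moveE.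
  by case: eqP kA iA => [->|_] kA; [rewrite kA|case: eqP kA jA => // -> ->].
have iDj : i \in S :\ j = (i \in S) by rewrite !inE ij.
case: (boolP (j \in S)) => jS; case: (boolP (i \in S)) => iS.
- apply: leq_trans (dm S); rewrite (big_setD1 j) // (big_setD1 i) /= ?iDj //.
  rewrite [X in (_ <= X)%N](big_setD1 j) // [X in (_ <= _ + X)%N](big_setD1 i) /= ?iDj //.
  rewrite othE ?inE ?eqxx ?andbF //= !moveE ji !eqxx.
  by move: le mji; move: (\sum_(k in _) _)%N (m i) (m j) => x y z; lia.
- have -> : (#|S| = true + #|S :\ j|)%N by rewrite (cardsD1 j S) jS.
  have := dm (i |: S :\ j); rewrite cardsU1 iDj iS => le2; apply: leq_trans le2.
  rewrite (big_setD1 j) //= big_setU1 /= ?iDj //.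
  rewrite othE ?inE ?eqxx ?(negbTE iS) ?andbF //= moveE ji eqxx.
  by move: le mji; move: (\sum_(k in _) _)%N (m i) (m j) => x y z; lia.
- apply: leq_trans (dm S); rewrite (big_setD1 i) //= [X in (_ <= X)%N](big_setD1 i) //=.
  by rewrite othE ?inE ?eqxx ?(negbTE jS) ?andbF //= moveE eqxx leq_add2r leq_subr.
- by rewrite othE.
Qed.

Lemma sumn_take_top la v : sorted geq la -> v \in la ->
  sumn (take (count (fun x => v < x)%N la).+1 la)
    = (\sum_(x <- la | (v < x)%N) x + v)%N.
Proof.
elim: la => //= x la IH; rewrite inE => pth vin.
have srt := path_sorted pth.
rewrite big_cons /=; case: (ltnP v x) => vx.
  rewrite add1n /= IH ?addnA //.
  by move: vin; rewrite (ltn_eqF vx).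
have gx : all (geq x) la by apply: order_path_min pth; move=> a b c /= ? ?; lia.
have vE : v = x.
  move: vin; case: eqP => //= _ vla; apply/eqP; rewrite eqn_leq vx andbT.
  exact: (allP gx).
rewrite vE big1_seq; last first.
  by move=> y /andP[lt /(allP gx)] /=; rewrite leqNgt lt.
have /eqP -> : count (fun y => x < y)%N la == 0%N.
  rewrite -leqn0 leqNgt -has_count; apply/hasPn => y /(allP gx) /=; lia.
by rewrite add0n /= take0 addn0.
Qed.

(** A strictly interior rung lies strictly below [m], because its entries at [i] and [j] are both
    smaller than [m i]. *)
Lemma move_top la i j m t : i != j -> sorted geq la -> domin la m ->
  (0 < t < m i - m j)%N -> ~~ perm_eq (mnmmove i j m t) la.
Proof.
move=> ij srt dm /andP[t0 lt]; apply/negP => pe.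
set eta := mnmmove i j m t in pe.
have etaE k : eta k =
    (if k == i then m i - t else if k == j then m j + t else m k)%N by rewrite mnmE.
have eti : (eta i = m i - t)%N by rewrite etaE eqxx.
have etj : (eta j = m j + t)%N by rewrite etaE eq_sym (negbTE ij) eqxx.
pose v := maxn (eta i) (eta j).
have vin : v \in la.
  rewrite -(perm_mem pe) /v; case: (leqP (eta i) (eta j)) => _;
  by rewrite mnm_tnth mem_tnth.
(* [S] holds the positions above both moved entries. On [i |: S] the exponent [m] would exceed the
   sum of the [#|S| + 1] largest parts, which is the sum of [eta] over [S] plus [v]. *)
pose S := [set k | (v < eta k)%N].
have iS : i \notin S by rewrite inE /v; lia.
have jS : j \notin S by rewrite inE /v; lia.
have := dm (i |: S); rewrite cardsU1 iS big_setU1 //= add1n.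
have pb (G : nat -> nat) :
    (\sum_(x <- la | (v < x)%N) G x = \sum_(k in S) G (eta k))%N.
  rewrite -(perm_big _ pe) big_tuple; apply: eq_bigl => k.
  by rewrite inE -mnm_tnth.
have -> : #|S| = count (fun x => v < x)%N la.
  by rewrite -sum1_count pb sum1_card.
rewrite sumn_take_top // pb.
have -> : (\sum_(k in S) m k = \sum_(k in S) eta k)%N.
  apply: eq_bigr => k kS; rewrite etaE; case: eqP => [ki|_].
    by rewrite -ki kS in iS.
  by case: eqP => // kj; rewrite -kj kS in jS.
by rewrite addnC leq_add2l /v; lia.
Qed.

Lemma euler_coef i q m : ('X_i * q^`M(i))@_m = (m i)%:R * q@_m.
Proof.
have -> : 'X_i * q^`M(i) = \sum_(k <- msupp q) (q@_k * (k i)%:R) *: 'X_[k].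
  rewrite {1}(mpolyE q) raddf_sum /= mulr_sumr; apply: eq_bigr => k _.
  rewrite mderivZ mderivX -!scalerAr scalerA.
  case: (eqVneq (k i) 0%N) => [->|ki]; first by rewrite mulr0 !scale0r.
  by rewrite -mpolyXD addmC submK // lep1mP.
rewrite raddf_sum /= [in RHS](mpolyE q) [in RHS]raddf_sum mulr_sumr /=.
apply: eq_bigr => k _; rewrite !mcoeffZ mcoeffX.
by case: eqP => [->|_]; rewrite ?mulr0 // !mulr1 mulrC.
Qed.

Lemma ddiff_coef i j q m : (ddiff i j q)@_m =
  \sum_(k <- msupp q) q@_k * ((rungs F i j k)@_m - (rungs F i j (mnmswap i j k))@_m).
Proof.
by rewrite raddf_sum /=; apply: eq_bigr => k _; rewrite mcoeffZ mcoeffB.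
Qed.

Lemma rungs_coef i j k m : (rungs F i j k)@_m =
  \sum_(t < k i - k j) (mnmmove i j k t == m)%:R.
Proof. by rewrite raddf_sum /=; apply: eq_bigr => t _; rewrite mcoeffX. Qed.

Lemma rungs_supp la i j k : i != j -> domin la k -> supp_le la (rungs F i j k).
Proof.
move=> ij dk m; rewrite rungs_coef => nz.
have [t /eqP <-|none] := pickP (fun t : 'I_(k i - k j) => mnmmove i j k t == m).
  by apply: domin_move => //; apply: ltnW.
by rewrite big1 ?eqxx // in nz => t _; rewrite none.
Qed.

Lemma supp_leD la q q' : supp_le la q -> supp_le la q' -> supp_le la (q + q').
Proof.
move=> h h' m; rewrite mcoeffD; case: (eqVneq q@_m 0) => [->|/h //].
by rewrite add0r => /h'.
Qed.

Lemma supp_leZ la c q : supp_le la q -> supp_le la (c *: q).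
Proof. by move=> h m; rewrite mcoeffZ mulf_eq0 negb_or => /andP[_ /h]. Qed.

Lemma supp_le_sum la I (r : seq I) (P : pred I) (G : I -> {mpoly F[N]}) :
  (forall k, P k -> supp_le la (G k)) -> supp_le la (\sum_(k <- r | P k) G k).
Proof.
move=> h; elim/big_rec: _ => [m|k q Pk IH]; first by rewrite mcoeff0 eqxx.
by apply: supp_leD => //; apply: h.
Qed.

Lemma ddiff_supp la i j q : i != j -> supp_le la q -> supp_le la (ddiff i j q).
Proof.
move=> ij sq; rewrite /ddiff big_seq; apply: supp_le_sum => m.
rewrite mcoeff_msupp => /sq dm; apply: supp_leZ; apply: supp_leD.
  exact: rungs_supp.
by rewrite -scaleN1r; apply: supp_leZ; apply: rungs_supp => //; apply: domin_swap.
Qed.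

Lemma rungs_top la i j k (eta : 'X_{1..N}) : i != j -> sorted geq la -> domin la k ->
  perm_eq eta la -> (rungs F i j k)@_eta = ((k == eta) && (eta j < eta i)%N)%:R.
Proof.
move=> ij srt dk pe; rewrite rungs_coef.
case E : (k i - k j)%N => [|d].
  rewrite big_ord0; case: eqP => //= <-; rewrite ltnNge; case: leqP => //; lia.
rewrite big_ord_recl /= mnmmove0 big1 ?addr0 => [|t _].
  case: eqP => //= <-; have -> // : (k j < k i)%N by lia.
case: eqP => // me; have tb : (0 < bump 0 t < k i - k j)%N.
  by rewrite E; have := ltn_ord t; rewrite /bump; lia.
by have := move_top ij srt dk tb; rewrite me pe.
Qed.

(** By [move_top] no interior rung reaches a rearrangement of [la]; only the rung [t = 0] of a
    monomial or of its swap contributes. *)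
Lemma ddiff_top la i j q (eta : 'X_{1..N}) : i != j -> sorted geq la -> supp_le la q ->
  perm_eq eta la ->
  (ddiff i j q)@_eta = if (eta j < eta i)%N then q@_eta - q@_(mnmswap i j eta) else 0.
Proof.
move=> ij srt sq pe; rewrite ddiff_coef big_seq.
under eq_bigr => k.
  rewrite mcoeff_msupp => /sq dk; rewrite (rungs_top ij srt dk pe).
  rewrite (rungs_top ij srt (domin_swap i j dk) pe); over.
rewrite -big_seq; case: ltnP => _; last first.
  by rewrite big1 // => k _; rewrite !andbF subrr mulr0.
under eq_bigr => k _ do rewrite !andbT mulrBr.
rewrite sumrB -mcoeff_swap; congr (_ - _).
  rewrite [in RHS](mpolyE q) raddf_sum /=; apply: eq_bigr => k _.
  by rewrite mcoeffZ mcoeffX.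
rewrite [in RHS](mpolyE q) (raddf_sum (msym (tperm i j))) raddf_sum.
apply: eq_bigr => k _ /=.
by rewrite msymZ mcoeffZ msymX_swap mcoeffX.
Qed.

End Dominance.

(** * Action of the Hamiltonians on leading coefficients *)

Section Eigenvalues.
Variables (F : fieldType) (e1 b : F).

(** The factor by which the [r]-th iterate of the shifted operator, applied after [dunkl i],
    multiplies the coefficient of a rearrangement of [la] whose [i]-th exponent is [v]. The
    recursion is [dunkl_top] for coefficients of this form. *)
Fixpoint eigc (la : seq nat) (r v : nat) : F :=
  if r is r'.+1 then (e1 * v%:R - b * (size la)%:R) * eigc la r' v
    + b * \sum_(x <- la | (x < v)%N) (eigc la r' v - eigc la r' x)
  else e1 * v%:R.

Definition eig la r := b * \sum_(v <- la) eigc la r v.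

Variables (N : nat) (la : seq nat).
Hypotheses (srt : sorted geq la) (sz : size la = N).
Implicit Types (q : {mpoly F[N]}) (i j : 'I_N) (eta : 'X_{1..N}).

Lemma dunkl_supp i q : supp_le la q -> supp_le la (dunkl e1 b i q).
Proof.
move=> sq; apply: supp_leD; apply: supp_leZ.
  by move=> m; rewrite euler_coef mulf_eq0 negb_or => /andP[_ /sq].
by apply: supp_le_sum => j ji; apply: ddiff_supp; rewrite // eq_sym.
Qed.

Lemma dunkl_top i q eta : supp_le la q -> perm_eq eta la ->
  (dunkl e1 b i q)@_eta = e1 * (eta i)%:R * q@_eta
    + b * \sum_(j | (eta j < eta i)%N) (q@_eta - q@_(mnmswap i j eta)).
Proof.
move=> sq pe; rewrite mcoeffD !mcoeffZ euler_coef mulrA; congr (_ + _ * _).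
rewrite raddf_sum /= [RHS]big_mkcond [LHS]big_mkcond /=; apply: eq_bigr => j _.
case: eqP => [->|/eqP ji] /=; first by rewrite ltnn.
by rewrite (ddiff_top (la := la)) // eq_sym.
Qed.

Lemma perm_swap i j eta : perm_eq eta la -> perm_eq (mnmswap i j eta) la.
Proof.
move=> pe; rewrite -(permPr pe).
by apply/tuple_permP; exists (tperm i j); congr val.
Qed.

Lemma big_perm_eta (P : pred nat) (G : nat -> F) eta : perm_eq eta la ->
  \sum_(j | P (eta j)) G (eta j) = \sum_(x <- la | P x) G x.
Proof. by move=> pe; rewrite -(perm_big _ pe) big_tuple. Qed.

(** The iterates lose the symmetry of [q], but exchanging [eta i] and [eta j] changes only the
    factor [eigc], so the induction closes on products of [eigc] with a symmetric coefficient. *)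
Lemma iter_dunkl_top i r q : supp_le la q -> (forall s, msym s q = q) ->
  let q' := iter r (fun q => dunkl e1 b i q - (b * N%:R) *: q) (dunkl e1 b i q) in
  supp_le la q' /\
  forall eta, perm_eq eta la -> q'@_eta = eigc la r (eta i) * q@_eta.
Proof.
move=> sq symq; elim: r => [|r [IHs IHc]] /=.
  split=> [|eta pe]; first exact: dunkl_supp.
  rewrite (dunkl_top _ sq pe) big1 ?mulr0 ?addr0 // => j _.
  by rewrite -mcoeff_swap symq subrr.
split=> [|eta pe].
  apply: supp_leD; first exact: dunkl_supp.
  by rewrite -scaleNr; apply: supp_leZ.
rewrite mcoeffB mcoeffZ (dunkl_top _ IHs pe) IHc //.
rewrite (eq_bigr (fun j => (eigc la r (eta i) - eigc la r (eta j)) * q@_eta));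
  last first.
  move=> j _; rewrite (IHc _ (perm_swap i j pe)) mnmswap_l.
  by rewrite -(mcoeff_swap i j) symq -mulrBl.
rewrite -mulr_suml (big_perm_eta (fun x => x < eta i)%N
  (fun x => eigc la r (eta i) - eigc la r x) pe) sz.
ring.
Qed.

Lemma hamiltonian_top n r (g : {mpoly F[n]}) : g \is n.-homog for mnmwgt ->
  supp_le la (to_x N g) ->
  supp_le la (to_x N (hamiltonian e1 b r g)) /\
  forall eta, perm_eq eta la ->
    (to_x N (hamiltonian e1 b r g))@_eta = eig la r * (to_x N g)@_eta.
Proof.
move=> hg sg; rewrite to_x_hamiltonian //.
have H i := @iter_dunkl_top i r (to_x N g) sg (fun s => msym_to_x s g).
split=> [|eta pe].
  by apply: supp_leZ; apply: supp_le_sum => i _; case: (H i).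
rewrite mcoeffZ raddf_sum /= /eig -mulrA; congr (_ * _).
rewrite -(big_perm_eta predT (eigc la r) pe) mulr_suml; apply: eq_bigr => i _.
by case: (H i) => _ ->.
Qed.

End Eigenvalues.

(** * The Jack inner product on power sums and self-adjointness *)

Section InnerProduct.
Variables (F : numFieldType) (e1 b : F) (n : nat).
Hypotheses (e1_neq0 : e1 != 0) (b_neq0 : b != 0).
Implicit Types (g : {mpoly F[n]}) (h : 'I_n -> {mpoly F[n]}) (m : 'X_{1..n}).

(** The squared norm [z_mu * al^(l(mu))] with [al = e1 / b], in terms of the multiplicities of [mu];
    see [mnorm_pexp]. *)
Definition mnorm m : F :=
  \prod_(k < n) ((e1 / b * k.+1%:R) ^+ m k * (m k)`!%:R).

Definition ip g g' : F := \sum_(m <- msupp g) g@_m * g'@_m * mnorm m.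

Lemma mnorm_neq0 m : mnorm m != 0.
Proof.
apply/prodf_neq0 => k _; rewrite mulf_neq0 ?expf_neq0 ?mulf_neq0 ?invr_eq0 //.
  by rewrite pnatr_eq0.
by rewrite pnatr_eq0 -lt0n fact_gt0.
Qed.

Lemma mnormU m k : mnorm (m + U_(k)) = mnorm m * (e1 / b * k.+1%:R * (m k).+1%:R).
Proof.
rewrite /mnorm (bigD1 k) //= [in RHS](bigD1 k) //=.
rewrite mnmDE mnm1E eqxx addn1 exprS factS natrM.
rewrite (eq_bigr (fun l : 'I_n => (e1 / b * l.+1%:R) ^+ m l * (m l)`!%:R)).
  by ring.
by move=> l lk; rewrite mnmDE mnm1E eq_sym (negbTE lk) addn0.
Qed.

Lemma ipE k g g' : (msize g <= k)%N ->
  ip g g' = \sum_(m : 'X_{1..n < k}) g@_m * g'@_m * mnorm m.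
Proof.
move=> sz; rewrite /ip; pose I : subFinType _ := 'X_{1..n < k}.
rewrite (big_mksub I) ?msupp_uniq //=; last first.
  by move=> m /msize_mdeg_lt /leq_trans; apply.
rewrite big_rmcond //= => m.
by move/memN_msupp_eq0 => ->; rewrite !mul0r.
Qed.

Lemma ipC g g' : ip g g' = ip g' g.
Proof.
rewrite (@ipE (maxn (msize g) (msize g'))) ?leq_maxl //.
rewrite (@ipE (maxn (msize g) (msize g'))) ?leq_maxr //.
by apply: eq_bigr => m _; rewrite [g@_m * _]mulrC.
Qed.

Lemma ipX m g : ip 'X_[m] g = g@_m * mnorm m.
Proof. by rewrite /ip msuppX big_seq1 mcoeffX eqxx mul1r. Qed.

Lemma ipDr g g1 g2 : ip g (g1 + g2) = ip g g1 + ip g g2.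
Proof.
rewrite /ip -big_split /=; apply: eq_bigr => m _; rewrite mcoeffD; ring.
Qed.

Lemma ipZr c g g' : ip g (c *: g') = c * ip g g'.
Proof.
rewrite /ip mulr_sumr; apply: eq_bigr => m _; rewrite mcoeffZ; ring.
Qed.

Lemma ip_sumr I (r : seq I) (P : pred I) (G : I -> {mpoly F[n]}) g :
  ip g (\sum_(k <- r | P k) G k) = \sum_(k <- r | P k) ip g (G k).
Proof.
apply: (big_morph _ (ipDr g)); rewrite /ip big1 // => m _.
by rewrite mcoeff0 mulr0 mul0r.
Qed.

Lemma ipZl c g g' : ip (c *: g) g' = c * ip g g'.
Proof. by rewrite ipC ipZr ipC. Qed.

Lemma ipDl g g1 g2 : ip (g1 + g2) g = ip g1 g + ip g2 g.
Proof. by rewrite ipC ipDr ![ip g _]ipC. Qed.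

Lemma ip_suml I (r : seq I) (P : pred I) (G : I -> {mpoly F[n]}) g :
  ip (\sum_(k <- r | P k) G k) g = \sum_(k <- r | P k) ip (G k) g.
Proof. by rewrite ipC ip_sumr; apply: eq_bigr => k _; rewrite ipC. Qed.

Lemma ip_creat k g g' : ip (creat b k g) g' = ip g (annih e1 k g').
Proof.
rewrite /creat /annih ipZl ipZr.
have -> : 'X_k * g = \sum_(m <- msupp g) g@_m *: 'X_[m + U_(k)].
  rewrite {1}(mpolyE g) mulr_sumr; apply: eq_bigr => m _.
  by rewrite -scalerAr -mpolyXD addmC.
have -> : ip g g'^`M(k) = \sum_(m <- msupp g) g@_m * ip 'X_[m] g'^`M(k).
  by rewrite {1}(mpolyE g) ip_suml; apply: eq_bigr => m _; rewrite ipZl.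
rewrite ip_suml !mulr_sumr; apply: eq_bigr => m _.
rewrite ipZl !ipX mcoeff_deriv mnormU -mulr_natr.
by field.
Qed.

Lemma ip_annih k g g' : ip (annih e1 k g) g' = ip g (creat b k g').
Proof. by rewrite ipC -ip_creat ipC. Qed.

Definition vip h h' := \sum_(m < n) ip (h m) (h' m).

Lemma vip_raise g h : vip (raise e1 g) h = ip g (lower b h).
Proof. by rewrite /lower ip_sumr; apply: eq_bigr => m _; rewrite ip_annih. Qed.

(** [E1] says that the annihilation and creation triangles of [lax] are transposes of each other;
    the diagonal is scalar. *)
Lemma vip_lax h h' : vip (lax e1 b h) h' = vip h (lax e1 b h').
Proof.
have E1 h1 h2 : \sum_(m < n) ip (\sum_(k < n) \sum_(l < n | (k + l).+1 == m)
    annih e1 k (h1 l)) (h2 m) =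
    \sum_(m < n) ip (h1 m) (\sum_(k < n) \sum_(l < n | (m + k).+1 == l)
    creat b k (h2 l)).
  under eq_bigr => m _.
    rewrite ip_suml; under eq_bigr => k _ do rewrite ip_suml big_mkcond /=.
    rewrite exchange_big /=; over.
  rewrite exchange_big /=; apply: eq_bigr => l _.
  rewrite exchange_big /= ip_sumr; apply: eq_bigr => k _.
  rewrite -big_mkcond ip_sumr; apply: eq_big => m; first by rewrite addnC.
  by rewrite ip_annih.
rewrite /vip /lax; under eq_bigr => m _ do rewrite !ipDl ipZl.
under [RHS]eq_bigr => m _ do rewrite !ipDr ipZr.
rewrite 2!big_split 2!big_split /= -!addrA; congr (_ + _); rewrite addrC E1.
congr (_ + _).
under eq_bigr => m _ do rewrite ipC.
under [RHS]eq_bigr => m _ do rewrite ipC.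
by rewrite E1.
Qed.

(** The Hamiltonian is a self-adjoint operator [lax] to the power [r], sandwiched between [raise]
    and its adjoint [lower]. *)
Lemma ip_hamiltonian r g g' :
  ip (hamiltonian e1 b r g) g' = ip g (hamiltonian e1 b r g').
Proof.
rewrite /hamiltonian -vip_raise ipC -vip_raise.
have vipC h h' : vip h h' = vip h' h by apply: eq_bigr => m _; rewrite ipC.
rewrite [RHS]vipC; move: (raise e1 g) (raise e1 g') => h h'.
elim: r h h' => [|r IH] h h' //=.
by rewrite -vip_lax IH -iterSr.
Qed.

End InnerProduct.

(** * Partitions of n and the dominance order *)

Section Partitions.
Variable n : nat.
Implicit Types (la mu nu : partn n).

(** The zeros are kept so that a partition of [n] is an exponent in exactly [n] variables and all
    partitions of [n] have equally many rows. *)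
Definition pad la : seq nat := [seq val i | i <- tval (val la)].

Lemma partsE la : parts la = [seq k <- pad la | (0 < k)%N].
Proof. by []. Qed.

Lemma pad_sorted la : sorted geq (pad la).
Proof. by have /andP[] := valP la. Qed.

Lemma pad_sumn la : sumn (pad la) = n.
Proof. by have /andP[_ /eqP] := valP la. Qed.

Lemma size_pad la : size (pad la) = n.
Proof. by rewrite size_map size_tuple. Qed.

Lemma pad_inj : injective pad.
Proof. by move=> la mu /(inj_map val_inj) e; apply/val_inj/val_inj. Qed.

Lemma pad_surj s : sorted geq s -> size s = n -> sumn s = n ->
  exists la, pad la = s.
Proof.
move=> srt sz sm.
have le x : x \in s -> (x < n.+1)%N.
  by rewrite ltnS -[X in (_ <= X)%N]sm => /perm_to_rem/perm_sumn ->; rewrite leq_addr.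
have szt : size (map (@inord n) s) == n by rewrite size_map sz.
have e : [seq val i | i <- tval (Tuple szt)] = s.
  by rewrite -map_comp map_id_in // => x /le xn /=; rewrite inordK.
have P : sorted geq [seq val i | i <- tval (Tuple szt)] &&
    (sumn [seq val i | i <- tval (Tuple szt)] == n) by rewrite e srt sm eqxx.
by exists (Sub (Tuple szt) P : partn n).
Qed.

Lemma filter_pos_nth s : sorted geq s ->
  forall i, nth 0%N [seq k <- s | (0 < k)%N] i = nth 0%N s i.
Proof.
elim: s => //= x s IH pth [|i]; case: ltnP => x0 //=.
- have /all_filterP : all (pred1 0%N) s.
    have gx : all (geq x) s by apply: order_path_min pth; move=> a b c /= ? ?; lia.
    by apply/allP => y /(allP gx) /=; lia.
  move=> <-; rewrite -filter_predI (eq_filter (a2 := pred0)) ?filter_pred0 //=; first lia.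
  by case.
- by rewrite IH // (path_sorted pth).
- have gx : all (geq x) s by apply: order_path_min pth; move=> a b c /= ? ?; lia.
  have : all (fun k => ~~ (0 < k)%N) s.
    by apply/allP => y /(allP gx) /=; lia.
  move=> /[dup] h; rewrite -(@eq_all _ (predC (fun k => 0 < k)%N)) // all_predC.
  rewrite has_filter negbK => /eqP ->; rewrite nth_nil.
  case: (ltnP i (size s)) => is_; last by rewrite nth_default.
  by have := all_nthP 0%N h i is_; case: (nth _ _ _).
Qed.

Lemma nth_parts la i : nth 0%N (parts la) i = nth 0%N (pad la) i.
Proof. by rewrite partsE filter_pos_nth ?pad_sorted. Qed.

Lemma sumn_take_nth k s : sumn (take k s) = (\sum_(i < k) nth 0 s i)%N.
Proof.
elim: k s => [|k IH] [|x s]; rewrite ?take0 ?big_ord0 //=.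
  by rewrite big1 // => i _; rewrite nth_nil.
by rewrite big_ord_recl IH.
Qed.

Lemma sumn_take_parts la k : sumn (take k (parts la)) = sumn (take k (pad la)).
Proof. by rewrite !sumn_take_nth; apply: eq_bigr => i _; rewrite nth_parts. Qed.

Lemma size_parts la : (size (parts la) <= n)%N.
Proof. by rewrite partsE size_filter -[X in (_ <= X)%N](size_pad la) count_size. Qed.

Lemma sumn_parts la : sumn (parts la) = n.
Proof.
rewrite -(take_oversize (size_parts la)) sumn_take_parts.
by rewrite take_oversize ?pad_sumn ?size_pad.
Qed.

Lemma parts_pos la x : x \in parts la -> (0 < x <= n)%N.
Proof.
rewrite partsE mem_filter => /andP[-> /=].
by rewrite -[X in (_ <= X)%N](pad_sumn la) => /perm_to_rem/perm_sumn ->; rewrite leq_addr.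
Qed.

Lemma dominatesP la nu : reflect
  (forall k, sumn (take k (pad nu)) <= sumn (take k (pad la)))%N
  (dominates (parts la) (parts nu)).
Proof.
apply: (iffP allP) => [h k|h k _]; last by rewrite !sumn_take_parts.
rewrite -!sumn_take_parts.
case: (leqP k (maxn (size (parts la)) (size (parts nu)))) => le.
  by apply: h; rewrite mem_iota /= add0n ltnS.
by rewrite !take_oversize ?sumn_parts //; move: le; rewrite gtn_max => /andP[? ?]; lia.
Qed.

Definition expo la : 'X_{1..n} := [multinom nth 0%N (pad la) i | i < n].

Lemma expoE la : expo la = pad la :> seq nat.
Proof.
apply: (@eq_from_nth _ 0%N) => [|i]; first by rewrite size_tuple size_pad.
rewrite size_tuple => lt.
by rewrite -(mnm_nth 0%N (expo la) (Ordinal lt)) mnmE.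
Qed.

(** The positions of [S] outside the first [#|S|] are exchanged for the missing ones among the first
    [#|S|]; the entry at [#|S| - 1] separates the values of the two groups. *)
Lemma subset_sum_sorted s (S : {set 'I_n}) : sorted geq s -> size s = n ->
  (\sum_(i in S) nth 0 s i <= sumn (take #|S| s))%N.
Proof.
move=> srt sz; case: (posnP #|S|) => [/eqP|Spos].
  by rewrite cards_eq0 => /eqP ->; rewrite big_set0.
have mono i j : (i <= j)%N -> (j < n)%N -> (nth 0 s j <= nth 0 s i)%N.
  move=> ij jn; have tr : transitive geq by move=> x y z /= ? ?; lia.
  by apply: (sorted_leq_nth tr leqnn _ srt) => //; rewrite inE sz //; lia.
have Sn : (#|S| <= n)%N by rewrite -[X in (_ <= X)%N]card_ord max_card.
pose A := [set i : 'I_n | (i < #|S|)%N].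
have sumA G : (\sum_(i in A) G (val i) = \sum_(i < #|S|) G i)%N.
  rewrite (big_ord_widen n G) //; apply: eq_bigl => i; by rewrite inE.
have cA : #|A| = #|S| by rewrite -sum1_card (sumA (fun=> 1%N)) sum1_card card_ord.
rewrite sumn_take_nth -(sumA (nth 0%N s)).
rewrite (big_setID A) /= [X in (_ <= X)%N](big_setID S) /= setIC leq_add2l.
have cE : #|S :\: A| = #|A :\: S|.
  by apply/eqP; rewrite -(eqn_add2l #|S :&: A|) cardsID setIC cardsID cA.
pose v := nth 0%N s #|S|.-1.
apply: (@leq_trans (\sum_(i in S :\: A) v)).
  apply: leq_sum => i; rewrite !inE -leqNgt => /andP[le _].
  by apply: mono => //; lia.
rewrite sum_nat_const cE -sum_nat_const; apply: leq_sum => i.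
rewrite !inE => /andP[_ lt]; apply: mono; lia.
Qed.

Lemma domin_expo la nu :
  domin (pad la) (expo nu) <-> dominates (parts la) (parts nu).
Proof.
have E (S : {set 'I_n}) : (\sum_(i in S) expo nu i = \sum_(i in S) nth 0 (pad nu) i)%N.
  by apply: eq_bigr => i _; rewrite mnmE.
split=> [dm|/dominatesP h S]; last first.
  rewrite E; apply: leq_trans (h _).
  by apply: subset_sum_sorted; rewrite ?pad_sorted ?size_pad.
apply/dominatesP => k.
wlog kn : k / (k <= n)%N => [H|].
  case: (leqP k n) => [/H //|/ltnW kn].
  by rewrite !take_oversize ?size_pad // !pad_sumn.
have := dm [set i : 'I_n | (i < k)%N]; rewrite E.
have sumA G : (\sum_(i in [set i : 'I_n | (i < k)%N]) G (val i) = \sum_(i < k) G i)%N.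
  rewrite (big_ord_widen n G) //; apply: eq_bigl => i; by rewrite inE.
by rewrite -[#|_|]sum1_card (sumA (fun=> 1%N)) sum1_card card_ord
   (sumA (nth 0%N (pad nu))) -sumn_take_nth.
Qed.

Lemma dominates_refl la : dominates (parts la) (parts la).
Proof. exact/dominatesP. Qed.

Lemma dominates_trans mu la nu : dominates (parts la) (parts mu) ->
  dominates (parts mu) (parts nu) -> dominates (parts la) (parts nu).
Proof. by move=> /dominatesP h /dominatesP h'; apply/dominatesP => k; apply: leq_trans (h k). Qed.

Lemma dominates_anti la nu : dominates (parts la) (parts nu) ->
  dominates (parts nu) (parts la) -> la = nu.
Proof.
move=> /dominatesP h /dominatesP h'; apply: pad_inj.
have e k : sumn (take k (pad la)) = sumn (take k (pad nu)).
  by apply/eqP; rewrite eqn_leq h h'.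
apply: (@eq_from_nth _ 0%N) => [|i _]; first by rewrite !size_pad.
by have := e i.+1; rewrite !sumn_take_nth !big_ord_recr /= -!sumn_take_nth e => /addnI.
Qed.

(* A linear extension of the dominance order. *)
Definition prank la := (\sum_(k < n.+1) sumn (take k (pad la)))%N.

Lemma prank_le la nu : dominates (parts la) (parts nu) -> (prank nu <= prank la)%N.
Proof. by move=> /dominatesP h; apply: leq_sum => k _. Qed.

Lemma prank_lt la nu : dominates (parts la) (parts nu) -> la != nu ->
  (prank nu < prank la)%N.
Proof.
move=> d ne; rewrite ltn_neqAle prank_le // andbT; apply: contra ne => /eqP e.
apply/eqP/dominates_anti => //; apply/dominatesP => k.
have /dominatesP h := d.
wlog kn : k / (k <= n)%N => [H|].
  case: (leqP k n) => [/H //|/ltnW kn].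
  by rewrite !take_oversize ?size_pad // !pad_sumn.
have kn1 : (k < n.+1)%N by [].
move: e; rewrite /prank (bigD1 (Ordinal kn1)) //= [RHS](bigD1 (Ordinal kn1)) //= => e.
have : (\sum_(i < n.+1 | i != Ordinal kn1) sumn (take i (pad nu))
  <= \sum_(i < n.+1 | i != Ordinal kn1) sumn (take i (pad la)))%N by apply: leq_sum => i _.
by rewrite -(leq_add2l (sumn (take k (pad nu)))) e leq_add2r.
Qed.

End Partitions.

(** * Products of power sums indexed by partitions *)

Section PowerSumBasis.
Variable n : nat.
Implicit Types (la mu nu : partn n).

Definition pexp la : 'X_{1..n} := [multinom count_mem k.+1 (parts la) | k < n].

Lemma big_count (R : Type) (idx : R) (op : Monoid.com_law idx) (G : nat -> R) s :
  (forall x, x \in s -> (0 < x <= n)%N) ->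
  \big[op/idx]_(k < n) iterop (count_mem k.+1 s) op (G k.+1) idx
  = \big[op/idx]_(x <- s) G x.
Proof.
elim: s => [|x s IH] hs; first by rewrite big_nil big1.
rewrite big_cons -IH => [|y ys]; last by apply: hs; rewrite inE ys orbT.
have /andP[x0 xn] : (0 < x <= n)%N by apply: hs; rewrite inE eqxx.
case: x x0 xn hs => // x _ xn hs.
rewrite (bigD1 (Ordinal xn)) //= [in RHS](bigD1 (Ordinal xn)) //= eqxx add1n.
rewrite !Monoid.iteropE iterS -Monoid.mulmA; congr (op _ (op _ _)).
apply: eq_bigr => k kx; have -> // : (x.+1 == k.+1) = false.
by rewrite eqSS; apply/negbTE; apply: contraNneq kx => e; apply/eqP/val_inj.
Qed.

Lemma prod_count (R : comPzRingType) (G : nat -> R) s :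
  (forall x, x \in s -> (0 < x <= n)%N) ->
  \prod_(k < n) G k.+1 ^+ count_mem k.+1 s = \prod_(x <- s) G x.
Proof. exact: big_count. Qed.

Lemma sum_count (G : nat -> nat) s : (forall x, x \in s -> (0 < x <= n)%N) ->
  (\sum_(k < n) count_mem k.+1 s * G k.+1 = \sum_(x <- s) G x)%N.
Proof.
move=> hs; rewrite -(@big_count _ _ _ G) //; apply: eq_bigr => k _.
by rewrite Monoid.iteropE mulnC iter_addn_0.
Qed.

Lemma mnmwgt_pexp la : mnmwgt (pexp la) = n.
Proof.
rewrite -[RHS](sumn_parts la) sumnE -(@sum_count id); last exact: parts_pos.
by apply: eq_bigr => k _; rewrite mnmE.
Qed.

Lemma parts_inj : injective (@parts n).
Proof.
move=> la mu e; apply: pad_inj; apply: (@eq_from_nth _ 0%N) => [|i _].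
  by rewrite !size_pad.
by rewrite -!nth_parts e.
Qed.

Lemma parts_sorted la : sorted geq (parts la).
Proof.
apply: sorted_filter; last exact: pad_sorted.
by move=> x y z /= ? ?; lia.
Qed.

Lemma pexp_inj : injective pexp.
Proof.
move=> la mu e; apply: parts_inj.
apply: (@sorted_eq _ geq).
- by move=> x y z /= ? ?; lia.
- by move=> x y /=; lia.
- exact: parts_sorted.
- exact: parts_sorted.
apply/seq.permP => P; rewrite -!sum1_count big_mkcond [RHS]big_mkcond /=.
rewrite -(@sum_count (fun x => P x : nat) (parts la)); last exact: parts_pos.
rewrite -(@sum_count (fun x => P x : nat) (parts mu)); last exact: parts_pos.
by apply: eq_bigr => k _; have := congr1 (fun m : 'X_{1..n} => m k) e; rewrite !mnmE => ->.
Qed.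

Lemma pexp_surj (m : 'X_{1..n}) : mnmwgt m = n -> exists la, pexp la = m.
Proof.
move=> wm; pose s0 := flatten [seq nseq (m k) k.+1 | k <- enum 'I_n].
have s0P x : x \in s0 -> (0 < x)%N.
  by case/flatten_mapP => k _; rewrite mem_nseq => /andP[_ /eqP ->].
have sum0 : sumn s0 = n.
  rewrite -[RHS]wm sumn_flatten sumnE 2!big_map.
  rewrite big_enum /=.
  by apply: eq_bigr => k _; rewrite sumn_nseq mulnC.
have size0 : (size s0 <= n)%N.
  rewrite -[X in (_ <= X)%N]sum0 sumnE -sum1_size.
  by rewrite big_seq [X in (_ <= X)%N]big_seq; apply: leq_sum => x /s0P.
have tr : transitive geq by move=> x y z /= ? ?; lia.
pose s := sort geq (s0 ++ nseq (n - size s0) 0%N).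
have srt : sorted geq s by apply: sort_sorted => x y /=; apply: leq_total.
have szs : size s = n by rewrite size_sort size_cat size_nseq subnKC.
have sms : sumn s = n.
  rewrite (perm_sumn (s2 := s0 ++ nseq (n - size s0) 0%N)).
    by rewrite sumn_cat sum0 sumn_nseq mul0n addn0.
  by rewrite perm_sort.
have [la e] := pad_surj srt szs sms; exists la; apply/mnmP => k.
rewrite mnmE partsE e count_filter (eq_count (a2 := pred1 k.+1)); last first.
  by case=> [|x] /=; rewrite ?andbT.
have /seq.permP -> : perm_eq s (s0 ++ nseq (n - size s0) 0%N) by rewrite perm_sort.
rewrite count_cat count_nseq mul0n addn0 count_flatten sumnE 2!big_map.
rewrite big_enum /= (bigD1 k) //= big1 => [|l lk].
  by rewrite count_nseq /= eqxx mul1n addn0.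
by rewrite count_nseq /= eqSS (inj_eq val_inj) (negbTE lk).
Qed.

Lemma mnorm_pexp (F : numFieldType) (e1 b : F) la :
  mnorm e1 b (pexp la) = (zee (parts la))%:R * (e1 / b) ^+ size (parts la).
Proof.
rewrite /zee sumn_parts big_add1 /= big_mkord natr_prod.
have -> : (e1 / b) ^+ size (parts la) =
    \prod_(k < n) (e1 / b) ^+ count_mem k.+1 (parts la).
  rewrite (@prod_count _ (fun=> e1 / b)); last exact: parts_pos.
  by rewrite big_const_seq count_predT iter_mulr_1.
rewrite -big_split /=; apply: eq_bigr => k _.
by rewrite mnmE exprMn natrM natrX [X in X * _]mulrC -!mulrA [_ ^+ _ * _`!%:R]mulrC.
Qed.

Lemma meval_pexp (F : comNzRingType) (V : nat -> F) la :
  meval (fun k : 'I_n => V k.+1) 'X_[pexp la] = \prod_(x <- parts la) V x.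
Proof.
rewrite mevalX -prod_count; last exact: parts_pos.
by apply: eq_bigr => k _; rewrite mnmE.
Qed.

Lemma to_x_pexp (F : fieldType) la :
  to_x n ('X_[F, pexp la]) = \prod_(x <- parts la) psum F n x.
Proof.
rewrite to_x_mono -prod_count; last exact: parts_pos.
by apply: eq_bigr => k _; rewrite mnmE.
Qed.

Lemma pm_coef_to_x (F : fieldType) mu nu :
  (to_x n ('X_[F, pexp mu]))@_(expo nu) = (pm_coef (parts mu) (parts nu))%:R.
Proof.
rewrite to_x_pexp; set s := parts mu; set t := parts nu.
have tn : (size t <= n)%N := size_parts nu.
rewrite (big_nth 0%N) big_mkord bigA_distr_bigA raddf_sum /=.
pose A := [pred f : {ffun 'I_(size s) -> 'I_n} |
  [forall i, (\sum_(j | f j == i) nth 0 s j)%N == nth 0%N t i]].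
transitivity (\sum_(f in A) 1 : F).
  rewrite [RHS]big_mkcond /=; apply: eq_bigr => f _.
  rewrite mprodXnE mcoeffX; case: eqP => [e|ne].
    rewrite ifT //; apply/forallP => i; move/mnmP/(_ i): e.
    rewrite mnm_sumE mnmE -nth_parts => <-; rewrite big_mkcond; apply/eqP.
    by apply: eq_bigr => j _; rewrite mulmnE mnm1E; case: eqP; rewrite ?mul1n.
  rewrite ifF //; apply/negP => /forallP h; case: ne; apply/mnmP => i.
  rewrite mnm_sumE mnmE -nth_parts -(eqP (h i)) [RHS]big_mkcond.
  by apply: eq_bigr => j _; rewrite mulmnE mnm1E; case: eqP; rewrite ?mul1n.
rewrite sumr_const /pm_coef; congr (_%:R).
(* [pm_coef] counts maps to the nonzero rows of [nu], the expansion counts maps to all [n]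
   variables. A positive part cannot land on a variable of exponent zero, so both counts agree. *)
pose w (f : {ffun 'I_(size s) -> 'I_(size t)}) : {ffun 'I_(size s) -> 'I_n} :=
  [ffun j => widen_ord tn (f j)].
have winj : injective w.
  move=> f g e; apply/ffunP => j; have := congr1 (fun h : {ffun _ -> _} => h j) e.
  by rewrite !ffunE => /(congr1 val) /= /val_inj.
rewrite -[RHS](card_image winj); apply: eq_card => f.
apply/idP/imageP => [/forallP Af|[g gA ->]]; last first.
  apply/forallP => i; rewrite inE in gA; move/forallP: gA => gA.
  case: (ltnP i (size t)) => it.
    rewrite -(eqP (gA (Ordinal it))) /=; apply/eqP; apply: eq_bigl => j.
    by rewrite ffunE -!val_eqE.
  rewrite nth_default // big_pred0 // => j; rewrite ffunE -val_eqE /=.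
  by apply/negbTE; rewrite neq_ltn (leq_trans (ltn_ord _) it).
have fj j : (f j < size t)%N.
  rewrite ltnNge; apply/negP => le; have := Af (f j).
  rewrite [X in _ == X]nth_default // (bigD1 j) //= addn_eq0 => /andP[/eqP z _].
  have /parts_pos : nth 0%N s j \in parts mu by rewrite mem_nth.
  by rewrite z.
exists [ffun j => Ordinal (fj j)].
  rewrite inE; apply/forallP => i; rewrite -(eqP (Af (widen_ord tn i))) /=.
  by apply/eqP; apply: eq_bigl => j; rewrite ffunE -!val_eqE.
by apply/ffunP => j; rewrite !ffunE; apply: val_inj.
Qed.

End PowerSumBasis.

(** * Newton's identities for formal products *)

Section Newton.
Variables (F : comNzRingType).
Implicit Types (Q E p : nat -> F).

Definition nresid Q p l : F := l%:R * Q l + \sum_(j < l) p j.+1 * Q (l - j.+1)%N.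

(* Newton's identities between [sum_l Q_l z^l = prod (1 - x z)^(+-1)] and the
   signed power sums [p_j] of its roots. *)
Definition newton Q p := forall l, nresid Q p l = 0.

(** The coefficients of [(1 - x z) Q(z)]. *)
Definition mulX1 (x : F) Q l := Q l - (if l is l'.+1 then x * Q l' else 0).

Lemma nresid_mulX1 x Q p l :
  nresid (mulX1 x Q) (fun j => p j + x ^+ j) l
  = nresid Q p l - (if l is l'.+1 then x * nresid Q p l' else 0).
Proof.
case: l => [|l]; first by rewrite /nresid !mul0r !big_ord0 !addr0 subr0.
rewrite /nresid /mulX1.
have -> : \sum_(j < l.+1) (p j.+1 + x ^+ j.+1) *
   (Q (l.+1 - j.+1)%N - (if (l.+1 - j.+1)%N is k.+1 then x * Q k else 0))
  = \sum_(j < l.+1) p j.+1 * Q (l.+1 - j.+1)%N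
    - x * \sum_(j < l) p j.+1 * Q (l - j.+1)%N + x * Q l.
  have tele : \sum_(j < l.+1) x ^+ j.+1 *
      (Q (l.+1 - j.+1)%N - (if (l.+1 - j.+1)%N is k.+1 then x * Q k else 0)) = x * Q l.
    pose f j := - (x ^+ j.+1 * (if (l.+1 - j)%N is k.+1 then Q k else 0)).
    rewrite -(big_mkord predT (fun j => x ^+ j.+1 * (Q (l.+1 - j.+1)%N -
      (if (l.+1 - j.+1)%N is k.+1 then x * Q k else 0)))).
    rewrite (telescope_sumr_eq f) //.
      by rewrite /f subnn mulr0 oppr0 sub0r opprK subn0 expr1.
    move=> j /andP[_ jl]; rewrite /f -(subnSK jl) opprK.
    case: (l.+1 - j.+1)%N => [|k]; first by rewrite subr0 mulr0 oppr0 add0r.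
    by rewrite [x ^+ j.+2]exprSr; ring.
  under eq_bigr => j _ do rewrite mulrDl.
  rewrite big_split /= tele; congr (_ + _).
  under eq_bigr => j _ do rewrite mulrBr.
  rewrite sumrB; congr (_ - _); rewrite big_ord_recr /= subnn mulr0 addr0.
  rewrite mulr_sumr; apply: eq_bigr => j _.
  by rewrite subSS -[(l - j)%N](@subnSK j l) //; ring.
by rewrite -natr1; ring.
Qed.

Lemma eq_newton Q Q' p p' : Q =1 Q' -> p =1 p' -> newton Q p -> newton Q' p'.
Proof.
move=> eQ ep h l; rewrite -[RHS](h l) /nresid eQ; congr (_ + _).
by apply: eq_bigr => j _; rewrite eQ ep.
Qed.

Lemma newton_mul x Q p : newton Q p -> newton (mulX1 x Q) (fun j => p j + x ^+ j).
Proof. by move=> h l; rewrite nresid_mulX1 !h; case: l => [|l]; rewrite ?h ?mulr0 subr0. Qed.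

(** The residual of [Q] is zero at 0 and is multiplied by [y] at each step, so no series has to be
    inverted. *)
Lemma newton_div y Q p : newton (mulX1 y Q) p -> newton Q (fun j => p j - y ^+ j).
Proof.
move=> h; have e l : nresid Q (fun j => p j - y ^+ j) l
    = if l is l'.+1 then y * nresid Q (fun j => p j - y ^+ j) l' else 0.
  apply/eqP; rewrite -subr_eq0 -nresid_mulX1 -[X in _ == X](h l); apply/eqP.
  by rewrite /nresid; congr (_ + _); apply: eq_bigr => j _; rewrite subrK.
by elim=> [|l IH]; rewrite e // IH mulr0.
Qed.

End Newton.

(** * Eigenvalue series and corners of the profile *)

Section EigenvalueNewton.
Variables (F : fieldType) (e1 b : F) (la : seq nat).
Hypothesis srt : sorted geq la.
Let N := size la.

(** Abscissas of the two corners at the end of row [i]: up to pairs that cancel, the [rowx] are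
    local minima of the profile and the [rowy] local maxima. *)
Definition rowx i : F := e1 * (nth 0%N la i)%:R - b * i%:R.
Definition rowy i : F := e1 * (nth 0%N la i)%:R - b * i.+1%:R.

(** Power sum of the minima minus power sum of the maxima; [- (b * N)] is the minimum at the left
    end of the [N] rows. *)
Definition chpow (j : nat) : F :=
  (- (b * N%:R)) ^+ j + \sum_(i < N) (rowx i ^+ j - rowy i ^+ j).

(** A power series attached to the rows from [i] on. At [i = 0] it is [1 - sum_r eig r z^(r+2)];
    dropping the upper rows allows an induction one row at a time. *)
Definition eigser i l : F :=
  match l with
  | 0%N => 1
  | 1%N => b * i%:R
  | k.+2 => - (b * \sum_(x <- drop i la) eigc e1 b la k x)
  end.

Let geq_trans : transitive geq.
Proof. by move=> x y z /= ? ?; lia. Qed.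

(** Since [la] is sorted, the sum over parts smaller than [v] may run over all rows below [i]: parts
    equal to [v] contribute zero. *)
Lemma eigcS i k : (i < N)%N ->
  eigc e1 b la k.+1 (nth 0%N la i) = rowy i * eigc e1 b la k (nth 0%N la i)
    - b * \sum_(x <- drop i.+1 la) eigc e1 b la k x.
Proof.
move=> iN /=; set v := nth 0%N la i; set c := eigc e1 b la k.
have drle x : x \in drop i.+1 la -> (x <= v)%N.
  case/(nthP 0%N) => j; rewrite size_drop -/N => lt <-; rewrite nth_drop.
  by apply: (sorted_leq_nth geq_trans leqnn _ srt); rewrite ?inE -/N; lia.
have tkge x : x \in take i.+1 la -> (v <= x)%N.
  case/(nthP 0%N) => j; rewrite size_take -/N => lt <-; rewrite nth_take; last first.
    by move: lt; case: ifP; lia.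
  apply: (sorted_leq_nth geq_trans leqnn _ srt); rewrite ?inE -/N //;
  by move: lt; case: ifP; lia.
have -> : \sum_(x <- la | (x < v)%N) (c v - c x) = \sum_(x <- drop i.+1 la) (c v - c x).
  rewrite -{1}(cat_take_drop i.+1 la) big_cat /= big1_seq ?add0r; last first.
    by move=> x /andP[lt /tkge]; rewrite leqNgt lt.
  rewrite big_mkcond big_seq [RHS]big_seq; apply: eq_bigr => x /drle.
  by rewrite leq_eqVlt => /predU1P[->|->] //; rewrite ltnn subrr.
rewrite sumrB big_const_seq count_predT iter_addr_0 size_drop -/N /rowy -/v.
rewrite -[c v *+ _]mulr_natr natrB //; ring.
Qed.

Definition quoser i l : F :=
  if l is k.+1 then eigc e1 b la k (nth 0%N la i) else 1.

Lemma eigserS_quo i : (i < N)%N -> eigser i.+1 =1 mulX1 (rowy i) (quoser i).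
Proof.
move=> iN [|[|k]]; rewrite /mulX1 /=; first by rewrite subr0.
  by rewrite /rowy; ring.
by rewrite -[_ + b * _]/(eigc e1 b la k.+1 _) eigcS //; ring.
Qed.

Lemma eigser_quo i : (i < N)%N -> eigser i =1 mulX1 (rowx i) (quoser i).
Proof.
move=> iN [|[|k]]; rewrite /mulX1 /=; first by rewrite subr0.
  by rewrite /rowx; ring.
rewrite -[_ + b * _]/(eigc e1 b la k.+1 _) eigcS // (drop_nth 0%N iN) big_cons.
by rewrite /rowx /rowy -natr1; ring.
Qed.

(** [eigser i] arises from [eigser i.+1] by dividing by [1 - rowy i z] and multiplying by
    [1 - rowx i z]; [quoser i] is the quotient in between. Below the last row the series is
    [1 + b N z]. *)
Lemma newton_eigser : newton (eigser 0) chpow.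
Proof.
suff H k : (k <= N)%N -> newton (eigser (N - k))
    (fun j => (- (b * N%:R)) ^+ j + \sum_(N - k <= i < N) (rowx i ^+ j - rowy i ^+ j)).
  have := H N (leqnn _); rewrite subnn; apply: eq_newton => // j.
  by rewrite /chpow big_mkord.
elim: k => [_|k IH kN].
  rewrite subn0; pose Q (l : nat) : F := (l == 0%N)%:R.
  have nQ : newton Q (fun=> 0).
    move=> l; rewrite /nresid big1 => [|j _]; last by rewrite mul0r.
    by case: l => [|l]; rewrite addr0 ?mul0r // /Q mulr0.
  apply: eq_newton (newton_mul (- (b * N%:R)) nQ) => [[|[|l]]|j].
  - by rewrite /mulX1 /Q subr0.
  - by rewrite /mulX1 /Q /= mulr1 opprK add0r.
  - by rewrite /mulX1 /Q /= mulr0 drop_oversize ?big_nil ?mulr0 ?oppr0 ?addr0.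
  - by rewrite add0r big_geq ?addr0.
have iN : (N - k.+1 < N)%N by lia.
have e : (N - k = (N - k.+1).+1)%N by lia.
have := IH (ltnW kN); rewrite e => /(eq_newton (eigserS_quo iN) (fun=> erefl _)).
move/newton_div/(newton_mul (rowx (N - k.+1))).
apply: eq_newton => [l|j]; first by rewrite eigser_quo.
rewrite [in RHS]big_ltn //; ring.
Qed.

Lemma eigser0S r : eigser 0 r.+2 = - eig e1 b la r.
Proof. by rewrite /eig /= drop0. Qed.

End EigenvalueNewton.

(** * The eigenvalues separate partitions *)

Section Separation.
Variables (F : realFieldType) (e1 b : F) (n : nat).
Hypotheses (e1_gt0 : 0 < e1) (b_gt0 : 0 < b).
Implicit Types (la mu : partn n).

(** The eigenvalue series starts with 1, so each Newton identity determines the highest power sum in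
    it from the lower ones and the eigenvalues. *)
Lemma eig_chpow la mu : (forall r, eig e1 b (pad la) r = eig e1 b (pad mu) r) ->
  chpow e1 b (pad la) =1 chpow e1 b (pad mu).
Proof.
move=> eqr.
have eqE : eigser e1 b (pad la) 0 =1 eigser e1 b (pad mu) 0.
  by case=> [|[|r]] //; rewrite !eigser0S eqr.
elim/ltn_ind=> -[_|l IH].
  rewrite /chpow !size_pad; congr (_ + _); rewrite !big1 // => i _;
  by rewrite !expr0 subrr.
have := newton_eigser e1 b (pad_sorted la) l.+1.
rewrite -(newton_eigser e1 b (pad_sorted mu) l.+1) /nresid eqE => /addrI.
rewrite !big_ord_recr /= subnn /= !mulr1.
rewrite (eq_bigr (fun j : 'I_l => chpow e1 b (pad mu) j.+1
   * eigser e1 b (pad mu) 0 (l.+1 - j.+1))) => [/addrI //|j _].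
by rewrite IH ?eqE // ltnS.
Qed.

(** At the first row where the partitions differ, the longer row has a corner to the right of all
    other corners from that row on, while the rows above cancel. A polynomial vanishing at the other
    corners but not at this one tells the power sums apart. *)
Lemma eig_eq la mu : (forall r, eig e1 b (pad la) r = eig e1 b (pad mu) r) ->
  la = mu.
Proof.
move=> /eig_chpow; wlog: la mu / exists2 i, (i < n)%N &
    (forall j, (j < i)%N -> nth 0%N (pad la) j = nth 0%N (pad mu) j) /\
    (nth 0%N (pad mu) i < nth 0%N (pad la) i)%N => [H eqch|].
  apply/eqP/negPn/negP => ne.
  have [i0 ni0] : exists i, nth 0%N (pad la) i != nth 0%N (pad mu) i.
    have [/existsP[i ni]|/existsPn h] := boolP [exists i : 'I_n,
        nth 0%N (pad la) i != nth 0%N (pad mu) i]; first by exists i.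
    case/eqP: ne; apply: pad_inj; apply: (@eq_from_nth _ 0%N) => [|i].
      by rewrite !size_pad.
    by rewrite size_pad => lt; apply/eqP; have := h (Ordinal lt); rewrite negbK.
  have [i ni imin] := ex_minnP (ex_intro (fun i => nth 0%N (pad la) i != nth 0%N (pad mu) i) i0 ni0).
  have iltn : (i < n)%N.
    by rewrite ltnNge; apply: contraNN ni => le; rewrite !nth_default ?size_pad.
  have eqj j : (j < i)%N -> nth 0%N (pad la) j = nth 0%N (pad mu) j.
    by move=> ji; apply/eqP; apply: contraTT ji => /imin; rewrite -leqNgt.
  move: ni; rewrite neq_ltn => /orP[lt|lt].
    case/eqP: ne; apply/esym; apply: H => //; exists i => //; split=> // j /eqj //.
  by case/eqP: ne; apply: H => //; exists i.
case=> i iltn [eqj lt] eqch; exfalso.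
pose x0 := rowx e1 b (pad la) i.
(* All corners of both partitions from row [i] on, except [x0]; each lies strictly to the left of
   [x0]. *)
pose zs := [seq rowy e1 b (pad la) j | j <- iota i (n - i)] ++
  [seq rowx e1 b (pad la) j | j <- iota i.+1 (n - i.+1)] ++
  [seq rowx e1 b (pad mu) j | j <- iota i (n - i)] ++
  [seq rowy e1 b (pad mu) j | j <- iota i (n - i)].
pose q := \prod_(z <- zs) ('X - z%:P).
have lex k l k' l' : (k <= k')%N -> (l' <= l)%N -> ((k < k') || (l' < l))%N ->
    e1 * k%:R - b * l%:R < e1 * k'%:R - b * l'%:R.
  move=> kk ll /orP[kk'|ll'].
    by apply: ltr_leB; rewrite ?ltr_pM2l ?ler_pM2l ?ltr_nat ?ler_nat.
  by apply: ler_ltB; rewrite ?ltr_pM2l ?ler_pM2l ?ltr_nat ?ler_nat.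
have mono (nu : partn n) j k : (j <= k)%N -> (k < n)%N -> (nth 0 (pad nu) k <= nth 0 (pad nu) j)%N.
  move=> jk kn; have tr : transitive geq by move=> x y z /= ? ?; lia.
  by apply: (sorted_leq_nth tr leqnn _ (pad_sorted nu)) => //; rewrite inE size_pad; lia.
have zlt z : z \in zs -> z < x0.
  rewrite !mem_cat => /or4P[] /mapP[j]; rewrite mem_iota => /andP[ij jn] ->;
  apply: lex; rewrite ?ltnS //; try lia.
  - by apply: mono => //; lia.
  - by apply: mono => //; lia.
  - by apply: leq_trans (ltnW lt); apply: mono => //; lia.
  - by rewrite (leq_ltn_trans _ lt) //; apply: mono => //; lia.
  - by apply: leq_trans (ltnW lt); apply: mono => //; lia.
have q0 z : z \in zs -> q.[z] = 0 by move=> zz; apply/rootP; rewrite root_prod_XsubC.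
have qx0 : q.[x0] != 0.
  rewrite -[_ == 0]/(root q x0) root_prod_XsubC.
  by apply/negP => /zlt; rewrite ltxx.
have evq (nu : partn n) (p : {poly F}) :
   p.[- (b * n%:R)] + \sum_(j < n) (p.[rowx e1 b (pad nu) j] - p.[rowy e1 b (pad nu) j])
     = \sum_(k < size p) p`_k * chpow e1 b (pad nu) k.
  rewrite horner_coef; under [RHS]eq_bigr => k _ do rewrite /chpow size_pad mulrDr.
  rewrite [RHS]big_split /=; congr (_ + _).
  under [RHS]eq_bigr => k _ do rewrite mulr_sumr.
  rewrite exchange_big /=; apply: eq_bigr => j _.
  rewrite !horner_coef -sumrB; apply: eq_bigr => k _.
  by rewrite mulrBr.
have := evq la q; have -> : \sum_(k < size q) q`_k * chpow e1 b (pad la) k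
   = \sum_(k < size q) q`_k * chpow e1 b (pad mu) k.
  by apply: eq_bigr => k _; rewrite eqch.
rewrite -evq => /addrI /eqP; rewrite -subr_eq0 -sumrB.
rewrite (bigD1 (Ordinal iltn)) //= big1 ?addr0 => [|j ji].
  have ini : i \in iota i (n - i) by rewrite mem_iota; lia.
  rewrite (q0 (rowy e1 b (pad la) i)) ?(q0 (rowy e1 b (pad mu) i)).
  - rewrite (q0 (rowx e1 b (pad mu) i)) ?subr0 ?(negbTE qx0) //.
    by rewrite !mem_cat map_f ?orbT.
  - by rewrite !mem_cat [X in _ || (_ || (_ || X))]map_f ?orbT.
  - by rewrite !mem_cat map_f.
case: (ltngtP j i) => [lt'|gt'|/eqP e]; last by rewrite -[i]/(val (Ordinal iltn)) val_eqE (negbTE ji) in e.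
  by rewrite /rowx /rowy eqj // subrr.
have jin : (j : nat) \in iota i (n - i) by rewrite mem_iota; have := ltn_ord j; lia.
rewrite !q0 ?subrr // !mem_cat ?[_ \in [seq rowy _ _ (pad la) _ | _ <- _]]map_f //=;
  rewrite ?[_ \in [seq rowx _ _ (pad mu) _ | _ <- _]]map_f ?orbT //.
- by rewrite [X in _ || (_ || (_ || X))]map_f ?orbT.
- rewrite [X in _ || (X || _)]map_f ?orbT // mem_iota; have := ltn_ord j; lia.
Qed.

End Separation.

(** * Symmetric functions of weight n *)

Section WeightSpace.
Variables (F : fieldType) (n : nat).
Implicit Types (la mu nu : partn n) (g : {mpoly F[n]}).

Local Notation whom g := (g \is n.-homog for mnmwgt).
Local Notation xcoef g nu := ((to_x n g)@_(expo nu)).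

Lemma pexp_homog mu : whom ('X_[F, pexp mu]).
Proof. by rewrite dhomogX /= mnmwgt_pexp. Qed.

Lemma homogE g : whom g -> g = \sum_mu g@_(pexp mu) *: 'X_[pexp mu].
Proof.
move=> hg; apply/mpolyP => m; rewrite raddf_sum /=.
under eq_bigr => mu _ do rewrite mcoeffZ mcoeffX.
case: (eqVneq (mnmwgt m) n) => [/pexp_surj[la <-]|ne].
  rewrite (bigD1 la) //= eqxx mulr1 big1 ?addr0 // => mu ne.
  by rewrite (inj_eq (@pexp_inj n)) (negbTE ne) mulr0.
rewrite (dhomog_nemf_coeff hg) // big1 // => mu _.
case: eqP => [e|_]; rewrite ?mulr0 //.
by rewrite -e mnmwgt_pexp eqxx in ne.
Qed.

Lemma to_x_homog g : whom g -> to_x n g \is n.-homog.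
Proof.
move=> hg; rewrite (homogE hg) to_x_sum; apply: rpred_sum => mu _.
rewrite to_xZ; apply: dhomogZ; rewrite to_x_pexp.
suff : \prod_(x <- parts mu) psum F n x \is (sumn (parts mu)).-homog.
  by rewrite sumn_parts.
rewrite sumnE; elim/big_rec2: _ => [|x d q _ IH]; first exact: dhomog1.
apply: dhomogM => //; apply: rpred_sum => i _.
by rewrite mpolyXn dhomogX /= mdegMn mdeg1 mul1n.
Qed.

Lemma sort_expo (m : 'X_{1..n}) : mdeg m = n -> exists nu (s : 'S_n),
  m = [multinom expo nu (s i) | i < n].
Proof.
move=> dm.
have pm : perm_eq (sort geq m) m by rewrite perm_sort.
have srt : sorted geq (sort geq m) by apply: sort_sorted => x y /=; apply: leq_total.
have szs : size (sort geq m) = n by rewrite size_sort size_tuple.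
have sms : sumn (sort geq m) = n by rewrite (perm_sumn pm) sumnE -[RHS]dm.
have [nu e] := pad_surj srt szs sms; exists nu.
have : perm_eq m (expo nu) by rewrite expoE e perm_sym.
case/tuple_permP => s es; exists s; apply/mnmP => i; rewrite mnmE.
by rewrite (mnm_nth 0%N) es -tnth_nth tnth_mktuple mnm_tnth.
Qed.

Lemma supp_leP la g : whom g ->
  (forall nu, ~~ dominates (parts la) (parts nu) -> xcoef g nu = 0) ->
  supp_le (pad la) (to_x n g).
Proof.
move=> hg h m nz.
have /sort_expo[nu [s ms]] : mdeg m = n.
  by apply: (dhomog_mf (to_x_homog hg)); rewrite mcoeff_msupp.
rewrite ms; apply: domin_perm; apply/domin_expo; apply: contraR nz => /h e.
by rewrite ms -mcoeff_sym msym_to_x e.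
Qed.

Lemma supp_le_coef la g nu : supp_le (pad la) (to_x n g) -> xcoef g nu != 0 ->
  dominates (parts la) (parts nu).
Proof. by move=> h /h /domin_expo. Qed.

(** If [x^nu] occurs in [p_mu], then [nu] arises by merging parts of [mu], and the first [k] parts
    of [mu] land in at most [k] rows of [nu]. *)
Lemma pm_coef_dominates mu nu : pm_coef (parts mu) (parts nu) != 0%N ->
  dominates (parts nu) (parts mu).
Proof.
rewrite -lt0n => /card_gt0P[f]; rewrite inE => /forallP hf; apply/dominatesP => k.
rewrite -!sumn_take_parts.
set s := parts mu in f hf *; set t := parts nu in f hf *.
wlog ks : k / (k <= size s)%N => [H|].
  case: (leqP k (size s)) => [/H //|/ltnW ks].
  rewrite take_oversize // /s sumn_parts -[X in (X <= _)%N](sumn_parts mu).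
  rewrite -[X in (sumn X <= _)%N](take_oversize (leqnn (size s))).
  apply: leq_trans (H _ (leqnn _)) _; rewrite !sumn_take_nth.
  by rewrite -(subnK ks) addnC big_split_ord /= leq_addr.
pose S := [set f j | j : 'I_(size s) & (j < k)%N].
have cS : (#|S| <= k)%N.
  apply: leq_trans (leq_imset_card _ _) _; rewrite -sum1_card.
  rewrite -[X in (_ <= X)%N](card_ord k) -sum1_card (big_ord_widen _ (fun=> 1%N) ks).
  by rewrite leq_eqVlt; apply/orP; left; apply/eqP; apply: eq_bigl => j; rewrite inE.
have tn : (size t <= n)%N := size_parts nu.
have -> : sumn (take k s) = (\sum_(j : 'I_(size s) | (j < k)%N) nth 0 s j)%N.
  by rewrite sumn_take_nth (big_ord_widen _ (nth 0%N s) ks).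
apply: (@leq_trans (\sum_(i in S) nth 0 t i)%N).
  under [X in (_ <= X)%N]eq_bigr => i _ do rewrite -(eqP (hf i)) big_mkcond /=.
  rewrite exchange_big /= big_mkcond /=; apply: leq_sum => j _.
  case: ifP => // jk; rewrite (bigD1 (f j)) /=; first by rewrite eqxx leq_addr.
  by apply/imsetP; exists j => //; rewrite inE.
apply: (@leq_trans (sumn (take #|S| (pad nu)))); last first.
  rewrite -sumn_take_parts !sumn_take_nth -/t.
  by rewrite -(subnKC cS) big_split_ord /= leq_addr.
pose S' := [set widen_ord tn i | i in S].
have winj : injective (widen_ord tn) by move=> i j /(congr1 val) /= /val_inj.
rewrite -(card_imset S winj) -/S'.
apply: leq_trans (subset_sum_sorted S' (pad_sorted nu) (size_pad nu)).
rewrite /S' [X in (_ <= X)%N]big_imset /=; last exact: in2W winj.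
by apply: leq_sum => i _; rewrite -nth_parts.
Qed.

Lemma pm_coef_diag mu : pm_coef (parts mu) (parts mu) != 0%N.
Proof.
rewrite -lt0n; apply/card_gt0P; exists [ffun j => j]; rewrite inE.
apply/forallP => i; rewrite (big_pred1 i) // => j /=.
by rewrite ffunE.
Qed.

Lemma xcoef_sum (c : partn n -> F) nu :
  xcoef (\sum_mu c mu *: 'X_[pexp mu]) nu
  = \sum_mu c mu * (pm_coef (parts mu) (parts nu))%:R.
Proof.
rewrite to_x_sum raddf_sum /=; apply: eq_bigr => mu _.
by rewrite to_xZ mcoeffZ pm_coef_to_x.
Qed.

Hypothesis char0 : forall k, k != 0%N -> k%:R != 0 :> F.

(** The expansion of power sums in monomials is triangular for dominance with nonzero diagonal, so
    the coefficients vanish one after the other along [prank]. *)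
Lemma to_x_inj g : whom g -> (forall nu, xcoef g nu = 0) -> g = 0.
Proof.
move=> hg h0; rewrite (homogE hg); apply: big1 => la _.
suff -> : g@_(pexp la) = 0 by rewrite scale0r.
have [k] := ubnP (prank la); elim: k la => // k IH la; rewrite ltnS => lek.
have := h0 la; rewrite {1}(homogE hg) xcoef_sum (bigD1 la) //= big1 ?addr0.
  by move/eqP; rewrite mulf_eq0 (negbTE (char0 (pm_coef_diag la))) orbF => /eqP.
move=> mu ne; case: (eqVneq (pm_coef (parts mu) (parts la)) 0%N) => [->|nz].
  by rewrite mulr0.
rewrite IH ?mul0r //; apply: leq_trans lek; apply: prank_lt; last by rewrite eq_sym.
exact: pm_coef_dominates.
Qed.

(** The square matrix of the [pm_coef] is injective by [to_x_inj]; the rows of its inverse give the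
    monomial symmetric functions in terms of power sums. *)
Lemma monomial_sym la : exists2 g : {mpoly F[n]}, whom g & forall nu, xcoef g nu = (la == nu)%:R.
Proof.
pose I := #|{: partn n}|.
pose M : 'M[F]_I := \matrix_(i, j) (pm_coef (parts (enum_val i)) (parts (enum_val j)))%:R.
have Mu : M \in unitmx.
  rewrite -row_free_unit; apply: inj_row_free => v vM.
  pose c mu := v 0 (enum_rank mu).
  have hz : \sum_mu c mu *: 'X_[pexp mu] = 0 :> {mpoly F[n]}.
    apply: to_x_inj => [|nu].
      by apply: rpred_sum => mu _; apply: dhomogZ; apply: pexp_homog.
    rewrite xcoef_sum (reindex_onto (@enum_val _ {: partn n}) enum_rank) /=; last first.
      by move=> mu _; rewrite enum_rankK.
    have := congr1 (fun A : 'rV_I => A 0 (enum_rank nu)) vM; rewrite !mxE => e.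
    rewrite -[RHS]e; apply: eq_big => [i|i _]; first by rewrite enum_valK eqxx.
    by rewrite mxE enum_rankK /c enum_valK.
  apply/rowP => i; rewrite mxE.
  have := congr1 (mcoeff (pexp (enum_val i))) hz; rewrite mcoeff0 raddf_sum /=.
  rewrite (bigD1 (enum_val i)) //= mcoeffZ mcoeffX eqxx mulr1 big1 ?addr0.
    by rewrite /c enum_valK.
  move=> mu ne; rewrite mcoeffZ mcoeffX (inj_eq (@pexp_inj n)) (negbTE ne).
  by rewrite mulr0.
exists (\sum_mu invmx M (enum_rank la) (enum_rank mu) *: 'X_[pexp mu]).
  by apply: rpred_sum => mu _; apply: dhomogZ; apply: pexp_homog.
move=> nu; rewrite xcoef_sum.
have := congr1 (fun A : 'M_I => A (enum_rank la) (enum_rank nu)) (mulVmx Mu).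
rewrite !mxE (inj_eq enum_rank_inj) => <-.
rewrite (reindex_onto (@enum_val _ {: partn n}) enum_rank) /=; last first.
  by move=> mu _; rewrite enum_rankK.
apply: eq_big => [i|i _]; first by rewrite enum_valK eqxx.
by rewrite mxE enum_rankK enum_valK.
Qed.

End WeightSpace.

(** * Jack functions are eigenvectors of the Hamiltonians *)

Section JackEigenvectors.
Variables (F : numFieldType) (e1 b : F) (n : nat).
Hypotheses (e1_neq0 : e1 != 0) (b_neq0 : b != 0).
Implicit Types (la mu nu : partn n) (g : {mpoly F[n]}).

Local Notation whom g := (g \is n.-homog for mnmwgt).
Local Notation xcoef g nu := ((to_x n g)@_(expo nu)).
Local Notation ham := (hamiltonian e1 b).

Lemma num_char0 k : k != 0%N -> k%:R != 0 :> F.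
Proof. by rewrite pnatr_eq0. Qed.

(** Elimination from the top of the order: the coefficients of highest [prank] are removed by
    subtracting multiples of the [P la] of that rank. *)
Lemma unitriangular_span (P : partn n -> {mpoly F[n]}) :
  (forall la, whom (P la)) -> (forall la, xcoef (P la) la = 1) ->
  (forall la, supp_le (pad la) (to_x n (P la))) ->
  forall g, whom g -> exists d, g = \sum_la d la *: P la.
Proof.
move=> hP P1 Ps.
suff H k g : whom g -> (forall nu, (k <= prank nu)%N -> xcoef g nu = 0) ->
    exists d, g = \sum_la d la *: P la.
  move=> g hg; apply: (H (\max_(nu : partn n) prank nu).+1) => // nu.
  move=> lt; have := @leq_bigmax {: partn n} (@prank n) nu; by rewrite leqNgt lt.
elim: k g => [|k IH] g hg h.
  exists (fun=> 0); rewrite (to_x_inj num_char0 hg) => [|nu]; last exact: h.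
  by rewrite big1 // => la _; rewrite scale0r.
pose g' := g - \sum_(la | prank la == k) xcoef g la *: P la.
have [||d e] := IH g'.
- by apply: rpredB => //; apply: rpred_sum => la _; apply: dhomogZ.
- move=> nu kn; rewrite /g' to_xB mcoeffB.
  have zer la : prank la == k -> la != nu ->
      (to_x n (xcoef g la *: P la))@_(expo nu) = 0.
    move=> /eqP lak ne; rewrite to_xZ mcoeffZ.
    case: (eqVneq (xcoef (P la) nu) 0) => [->|nz]; first by rewrite mulr0.
    have /prank_lt/(_ ne) := supp_le_coef (Ps la) nz.
    by rewrite lak ltnNge kn.
  rewrite to_x_sum [X in _ - X](raddf_sum (mcoeff (expo nu))) /=; case: (eqVneq (prank nu) k) => [e|ne].
    rewrite (bigD1 nu) /=; last by rewrite e.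
    rewrite [X in _ - (_ + X)]big1 ?addr0; last by move=> la /andP[lak lan]; exact: zer.
    by rewrite to_xZ mcoeffZ P1 mulr1 subrr.
  rewrite big1 => [|la lak]; last first.
    by apply: zer => //; apply: contraNneq ne => <-.
  by rewrite subr0 h // ltn_neqAle eq_sym ne.
exists (fun la => d la + (if prank la == k then xcoef g la else 0)).
under eq_bigr => la _ do rewrite scalerDl.
rewrite big_split /= -e /g'; apply/eqP; rewrite -addrA eq_sym addrC -subr_eq0 addrK.
rewrite addrC subr_eq0 [X in _ == X]big_mkcond; apply/eqP; apply: eq_bigr => la _.
by case: ifP; rewrite ?scale0r.
Qed.

Lemma ham_homog r g : whom g -> whom (ham r g).
Proof. exact: hamiltonian_homog. Qed.

Lemma ham_top la r g : whom g -> supp_le (pad la) (to_x n g) ->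
  supp_le (pad la) (to_x n (ham r g)) /\
  xcoef (ham r g) la = eig e1 b (pad la) r * xcoef g la.
Proof.
move=> hg sg.
have [s c] := hamiltonian_top e1 b (pad_sorted la) (size_pad la) r hg sg.
by split=> //; apply: c; rewrite expoE.
Qed.

Variable c : partn n -> partn n -> F.
Definition jackp la : {mpoly F[n]} := \sum_mu c la mu *: 'X_[pexp mu].

Lemma ip_jackp la la' : ip e1 b (jackp la) (jackp la') =
  \sum_mu c la mu * c la' mu * (zee (parts mu))%:R * (e1 / b) ^+ size (parts mu).
Proof.
rewrite ip_suml; apply: eq_bigr => mu _; rewrite ipZl ipX /jackp raddf_sum /=.
rewrite (bigD1 mu) //= mcoeffZ mcoeffX eqxx mulr1 big1 ?addr0.
  by rewrite mnorm_pexp !mulrA.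
move=> nu ne; rewrite mcoeffZ mcoeffX (inj_eq (@pexp_inj n)) (negbTE ne).
by rewrite mulr0.
Qed.

Lemma jackp_homog la : whom (jackp la).
Proof. by apply: rpred_sum => mu _; apply: dhomogZ; apply: pexp_homog. Qed.

Hypothesis J1 : forall la, \sum_mu c la mu * (pm_coef (parts mu) (parts la))%:R = 1.
Hypothesis J2 : forall la nu, ~~ dominates (parts la) (parts nu) ->
  \sum_mu c la mu * (pm_coef (parts mu) (parts nu))%:R = 0.
Hypothesis J3 : forall la la', la != la' -> ip e1 b (jackp la) (jackp la') = 0.
Hypothesis J4 : forall la, ip e1 b (jackp la) (jackp la) != 0.

Lemma jackp_supp la : supp_le (pad la) (to_x n (jackp la)).
Proof. by apply: supp_leP => [|nu /J2 e]; [exact: jackp_homog|rewrite xcoef_sum]. Qed.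

Lemma jackp_lead la : xcoef (jackp la) la = 1.
Proof. by rewrite xcoef_sum J1. Qed.

Lemma jackp_expand g : whom g ->
  g = \sum_la (ip e1 b g (jackp la) / ip e1 b (jackp la) (jackp la)) *: jackp la.
Proof.
move=> hg; have [d e] := unitriangular_span jackp_homog jackp_lead (@jackp_supp) hg.
rewrite {1}e; apply: eq_bigr => la _; congr (_ *: _).
rewrite e ip_suml (bigD1 la) //= ipZl big1 ?addr0 ?mulfK // => mu ne.
by rewrite ipZl J3 ?mulr0.
Qed.

(* Triangularity in the dominance order and self-adjointness leave only the
   diagonal entries. *)
Lemma ham_jackp r la : ham r (jackp la) = eig e1 b (pad la) r *: jackp la.
Proof.
pose a la nu := ip e1 b (ham r (jackp la)) (jackp nu).
have asym nu la' : a la' nu = a nu la' by rewrite /a ip_hamiltonian // ipC.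
have adom la' nu : a la' nu != 0 -> dominates (parts la') (parts nu).
  move=> nz; apply/negPn/negP => nd.
  have : exists nu, (a la' nu != 0) && ~~ dominates (parts la') (parts nu).
    by exists nu; rewrite nz nd.
  move=> /existsP /existsP[k0 k0P].
  (* A violating index of maximal [prank]. No other term of the Jack expansion contributes to its
     coefficient, which triangularity says is zero. *)
  pose k := [arg max_(k > k0 | (a la' k != 0) && ~~ dominates (parts la') (parts k)) prank k].
  have [ak dk kmax] : [/\ a la' k != 0, ~~ dominates (parts la') (parts k) &
     forall k', a la' k' != 0 -> ~~ dominates (parts la') (parts k') -> (prank k' <= prank k)%N].
    rewrite /k; case: arg_maxnP => // k1 /andP[k1a k1d] k1m; split=> // k' k'a k'd.
    by apply: k1m; rewrite k'a k'd.
  have [sl _] := ham_top r (jackp_homog la') (@jackp_supp la').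
  have z : xcoef (ham r (jackp la')) k = 0.
    by apply/eqP; apply: contraR dk => /(supp_le_coef sl).
  move: z; rewrite {1}(jackp_expand (ham_homog r (jackp_homog la'))) to_x_sum raddf_sum /=.
  rewrite (bigD1 k) //= to_xZ mcoeffZ jackp_lead mulr1 big1 ?addr0.
    by move/eqP; rewrite mulf_eq0 invr_eq0 (negbTE (J4 k)) orbF; apply/negP.
  move=> k' ne; rewrite to_xZ mcoeffZ.
  case: (eqVneq (xcoef (jackp k') k) 0) => [->|nz']; first by rewrite mulr0.
  have dk' := supp_le_coef (@jackp_supp k') nz'.
  case: (eqVneq (a la' k') 0) => [e|nza]; first by rewrite -/(a _ _) e !mul0r.
  have dl' : ~~ dominates (parts la') (parts k').
    by apply: contraNN dk => h; apply: (@dominates_trans n k').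
  by have := kmax k' nza dl'; rewrite leqNgt (prank_lt dk' ne).
have [_ lead] := ham_top r (jackp_homog la) (@jackp_supp la).
have E := jackp_expand (ham_homog r (jackp_homog la)).
rewrite (bigD1 la) //= big1 ?addr0 in E; last first.
  move=> nu ne; rewrite -/(a _ _); case: (eqVneq (a la nu) 0) => [->|nz].
    by rewrite mul0r scale0r.
  case/eqP: ne; apply: dominates_anti; last exact: adom.
  by apply: adom; rewrite asym.
rewrite E; congr (_ *: _); move: lead; rewrite {1}E to_xZ mcoeffZ jackp_lead.
by rewrite !mulr1.
Qed.

End JackEigenvectors.

(** * Linearity of the Hamiltonians *)

Section HamiltonianLinear.
Variables (F : fieldType) (e1 b : F) (n : nat).
Implicit Types (g : {mpoly F[n]}).

Local Notation ham := (hamiltonian e1 b).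

Lemma annih_lin k c g g' : annih e1 k (c *: g + g') = c *: annih e1 k g + annih e1 k g'.
Proof. by rewrite /annih mderivD mderivZ scalerDr !scalerA mulrC. Qed.

Lemma creat_lin k c g g' : creat b k (c *: g + g') = c *: creat b k g + creat b k g'.
Proof. by rewrite /creat mulrDr scalerDr -scalerAr !scalerA mulrC. Qed.

Lemma lax_lin c (h h' : 'I_n -> {mpoly F[n]}) :
  lax e1 b (fun m => c *: h m + h' m) = fun m => c *: lax e1 b h m + lax e1 b h' m.
Proof.
apply: boolp.funext => m; rewrite /lax.
have -> : \sum_(k < n) \sum_(l < n | (k + l).+1 == m) annih e1 k (c *: h l + h' l)
  = c *: (\sum_(k < n) \sum_(l < n | (k + l).+1 == m) annih e1 k (h l))
    + \sum_(k < n) \sum_(l < n | (k + l).+1 == m) annih e1 k (h' l).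
  rewrite scaler_sumr -big_split /=; apply: eq_bigr => k _.
  rewrite scaler_sumr -big_split /=; apply: eq_bigr => l _; exact: annih_lin.
have -> : \sum_(k < n) \sum_(l < n | (m + k).+1 == l) creat b k (c *: h l + h' l)
  = c *: (\sum_(k < n) \sum_(l < n | (m + k).+1 == l) creat b k (h l))
    + \sum_(k < n) \sum_(l < n | (m + k).+1 == l) creat b k (h' l).
  rewrite scaler_sumr -big_split /=; apply: eq_bigr => k _.
  rewrite scaler_sumr -big_split /=; apply: eq_bigr => l _; exact: creat_lin.
by rewrite !scalerDr !scalerA [c * _]mulrC [X in X + _ = _]addrACA [LHS]addrACA.
Qed.

Lemma ham_lin r c g g' : ham r (c *: g + g') = c *: ham r g + ham r g'.
Proof.
rewrite /hamiltonian.
have -> : iter r (@lax F e1 b n) (raise e1 (c *: g + g')) = fun m =>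
    c *: iter r (@lax F e1 b n) (raise e1 g) m + iter r (@lax F e1 b n) (raise e1 g') m.
  elim: r => [|r IH] /=; last by rewrite IH lax_lin.
  by apply: boolp.funext => m; apply: annih_lin.
rewrite /lower scaler_sumr -big_split /=; apply: eq_bigr => m _.
exact: creat_lin.
Qed.

End HamiltonianLinear.

(** * Existence of the Jack family *)

Section JackExistence.
Variables (F : realFieldType) (e1 b : F) (n : nat).
Hypotheses (e1_gt0 : 0 < e1) (b_gt0 : 0 < b).
Implicit Types (la mu nu : partn n) (g : {mpoly F[n]}).

Local Notation whom g := (g \is n.-homog for mnmwgt).
Local Notation xcoef g nu := ((to_x n g)@_(expo nu)).
Local Notation ham := (hamiltonian e1 b).
Local Notation eig la r := (eig e1 b (pad la) r).

Lemma nonroot_exists (p : {poly F}) : p != 0 -> exists t, p.[t] != 0.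
Proof.
move=> p0; pose rs := [seq k%:R : F | k <- iota 0 (size p)].
have urs : uniq rs.
  rewrite map_inj_uniq ?iota_uniq // => i j /eqP.
  by rewrite eqr_nat => /eqP.
have [/hasP[t _ tn]|/hasPn h] := boolP (has (fun t => p.[t] != 0) rs).
  by exists t.
have all_r : all (root p) rs.
  by apply/allP => t /h; rewrite negbK.
by have := max_poly_roots p0 all_r urs; rewrite size_map size_iota ltnn.
Qed.

(** For distinct partitions the polynomials in [t] with the eigenvalues as coefficients differ by
    [eig_eq]; any [t] that is not a root of the product of all differences serves. *)
Lemma generic_combination : exists K (t : F), forall la mu, la != mu ->
  \sum_(r < K) t ^+ r * eig la r != \sum_(r < K) t ^+ r * eig mu r.
Proof.
have sep (x : partn n * partn n) : exists r, (x.1 != x.2) ==> (eig x.1 r != eig x.2 r).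
  apply: boolp.contrapT => h; apply: h.
  case: (eqVneq x.1 x.2) => [_|ne]; first by exists 0%N.
  apply: boolp.contrapT => h; case/eqP: ne; apply: (eig_eq e1_gt0 b_gt0) => r.
  by apply: boolp.contrapT => ne; apply: h; exists r; apply/eqP.
pose K := (\max_(x : partn n * partn n) xchoose (sep x)).+1.
pose p la : {poly F} := \poly_(r < K) eig la r.
have p_inj la mu : la != mu -> p la - p mu != 0.
  move=> ne; rewrite subr_eq0; apply/negP => /eqP /polyP e.
  have /implyP/(_ ne) /= := xchooseP (sep (la, mu)); set r := xchoose _.
  have rK : (r < K)%N.
    exact: (@leq_bigmax _ (fun x => xchoose (sep x)) (la, mu)).
  by have := e r; rewrite !coef_poly rK => ->; rewrite eqxx.
pose q := \prod_(x : partn n * partn n | x.1 != x.2) (p x.1 - p x.2).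
have q0 : q != 0 by apply/prodf_neq0 => x /p_inj.
have [t qt] := nonroot_exists q0; exists K, t => la mu ne.
have pt nu : (p nu).[t] = \sum_(r < K) t ^+ r * eig nu r.
  by rewrite horner_poly; apply: eq_bigr => r _; rewrite mulrC.
rewrite -!pt -subr_eq0 -hornerN -hornerD; apply: contraNneq qt => e.
by rewrite /q (bigD1 (la, mu)) //= hornerM e mul0r.
Qed.

Section Theta.
Variables (K : nat) (t : F).

Definition theta g := \sum_(r < K) t ^+ r *: ham r g.
Definition thev la := \sum_(r < K) t ^+ r * eig la r.

Lemma theta_lin c g g' : theta (c *: g + g') = c *: theta g + theta g'.
Proof.
rewrite /theta scaler_sumr -big_split /=; apply: eq_bigr => r _.
by rewrite ham_lin scalerDr !scalerA mulrC.
Qed.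

Lemma thetaZ c g : theta (c *: g) = c *: theta g.
Proof.
have /eqP := theta_lin 1 0 0; rewrite scale1r addr0 scale1r.
rewrite -[X in X == _]addr0 (inj_eq (addrI _)) eq_sym => /eqP t0.
by rewrite -[c *: g]addr0 theta_lin t0 addr0.
Qed.

Lemma theta_homog g : whom g -> whom (theta g).
Proof. by move=> hg; apply: rpred_sum => r _; apply: dhomogZ; apply: hamiltonian_homog. Qed.

Lemma theta_top la g : whom g -> supp_le (pad la) (to_x n g) ->
  supp_le (pad la) (to_x n (theta g)) /\ xcoef (theta g) la = thev la * xcoef g la.
Proof.
move=> hg sg; rewrite /theta to_x_sum; split.
  apply: supp_le_sum => r _; rewrite to_xZ; apply: supp_leZ.
  by case: (ham_top e1 b r hg sg).
rewrite (raddf_sum (mcoeff (expo la))) /= mulr_suml; apply: eq_bigr => r _.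
by rewrite to_xZ mcoeffZ; case: (ham_top e1 b r hg sg) => _ ->; rewrite mulrA.
Qed.

Lemma ip_theta g g' : ip e1 b (theta g) g' = ip e1 b g (theta g').
Proof.
rewrite ip_suml ip_sumr; apply: eq_bigr => r _.
by rewrite ipZl ipZr ip_hamiltonian // gt_eqF.
Qed.

Definition tdiff nu g := theta g - thev nu *: g.

Lemma tdiff_lin nu c g g' : tdiff nu (c *: g + g') = c *: tdiff nu g + tdiff nu g'.
Proof.
rewrite /tdiff theta_lin !scalerDr scalerN !scalerA [thev nu * c]mulrC opprD.
by rewrite addrACA.
Qed.

Lemma tdiffC nu mu g : tdiff nu (tdiff mu g) = tdiff mu (tdiff nu g).
Proof.
have tB c g1 g2 : theta (g1 - c *: g2) = theta g1 - c *: theta g2.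
  by rewrite addrC -scaleNr theta_lin scaleNr addrC.
rewrite /tdiff !tB; move: (theta (theta g)) (theta g) => g2 g1.
by rewrite -!mul_mpolyC; ring.
Qed.

Lemma foldr_tdiff_rem la g l : la \in l ->
  foldr tdiff g l = foldr tdiff (tdiff la g) (rem la l).
Proof.
elim: l => //= x l IH; rewrite inE => h; case: (eqVneq x la) h => [->|ne] h.
  by elim: l {IH h} => //= y l IH; rewrite tdiffC IH.
by rewrite /= IH //; case/predU1P: h ne => // ->; rewrite eqxx.
Qed.

Lemma tdiff_homog nu g : whom g -> whom (tdiff nu g).
Proof. by move=> hg; apply: rpredB; [apply: theta_homog | apply: dhomogZ]. Qed.

Lemma tdiff_top la nu g : whom g -> supp_le (pad la) (to_x n g) ->
  supp_le (pad la) (to_x n (tdiff nu g)) /\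
  xcoef (tdiff nu g) la = (thev la - thev nu) * xcoef g la.
Proof.
move=> hg sg; have [s c] := theta_top hg sg.
rewrite /tdiff to_xB to_xZ mcoeffB mcoeffZ c mulrBl; split=> //.
by rewrite -scaleNr; apply: supp_leD => //; apply: supp_leZ.
Qed.

Lemma foldr_tdiff_lin I (r : seq I) (P : pred I) (d : I -> F) G l :
  foldr tdiff (\sum_(k <- r | P k) d k *: G k) l
  = \sum_(k <- r | P k) d k *: foldr tdiff (G k) l.
Proof.
have t0 nu : tdiff nu 0 = 0.
  have /eqP := tdiff_lin nu 1 0 0; rewrite scale1r addr0 scale1r.
  by rewrite -[X in X == _]addr0 (inj_eq (addrI _)) eq_sym => /eqP.
elim: l => //= nu l ->; elim/big_rec2: _ => // k g g' _ <-.
exact: tdiff_lin.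
Qed.

Lemma foldr_tdiff_homog g l : whom g -> whom (foldr tdiff g l).
Proof. by move=> hg; elim: l => //= nu l IH; apply: tdiff_homog. Qed.

Lemma foldr_tdiff_top la g l : whom g -> supp_le (pad la) (to_x n g) ->
  supp_le (pad la) (to_x n (foldr tdiff g l)) /\
  xcoef (foldr tdiff g l) la = (\prod_(nu <- l) (thev la - thev nu)) * xcoef g la.
Proof.
move=> hg sg; elim: l => [|nu l [IHs IHc]] /=; first by rewrite big_nil mul1r.
have [s c] := tdiff_top nu (foldr_tdiff_homog l hg) IHs.
by split=> //; rewrite c IHc big_cons mulrA.
Qed.

(* Cayley-Hamilton for the triangular operator [theta]. *)
Lemma foldr_tdiff_kill la g l : whom g -> supp_le (pad la) (to_x n g) ->
  (forall nu, dominates (parts la) (parts nu) -> nu \in l) -> foldr tdiff g l = 0.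
Proof.
have [k] := ubnP (prank la); elim: k la g l => // k IH la g l.
rewrite ltnS => lek hg sg hl.
have lal : la \in l by apply: hl; apply: dominates_refl.
rewrite (foldr_tdiff_rem _ lal).
have [s c] := tdiff_top la hg sg.
have [m hm mc] : exists2 m : partn n -> {mpoly F[n]}, (forall nu, whom (m nu)) &
    forall nu nu', xcoef (m nu) nu' = (nu == nu')%:R.
  have h nu := @monomial_sym F n (@num_char0 F) nu.
  have /boolp.choice[m mP] : forall nu, exists g, whom g /\
    forall nu', xcoef g nu' = (nu == nu')%:R by move=> nu; have [g' ? ?] := h nu; exists g'.
  by exists m => nu; case: (mP nu).
have -> : tdiff la g = \sum_nu xcoef (tdiff la g) nu *: m nu.
  apply/eqP; rewrite -subr_eq0; apply/eqP; apply: to_x_inj => [||nu].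
  - exact: num_char0.
  - apply: rpredB; first exact: tdiff_homog.
    by apply: rpred_sum => nu _; apply: dhomogZ.
  rewrite to_xB mcoeffB to_x_sum [X in _ - X](raddf_sum (mcoeff (expo nu))) /=.
  rewrite (bigD1 nu) //= to_xZ mcoeffZ mc eqxx mulr1 big1 ?addr0 ?subrr // => nu' ne.
  by rewrite to_xZ mcoeffZ mc (negbTE ne) mulr0.
rewrite foldr_tdiff_lin big1 // => nu _.
case: (eqVneq (xcoef (tdiff la g) nu) 0) => [->|nz]; first by rewrite scale0r.
have dnu := supp_le_coef s nz.
have ne : la != nu.
  by apply: contraNneq nz => <-; rewrite c subrr mul0r.
rewrite (IH nu) ?scaler0 //.
- by apply: leq_trans lek; apply: prank_lt.
- by apply: supp_leP => // nu' nd; rewrite mc; case: eqP nd => // ->; rewrite dominates_refl.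
- move=> nu' dn'; have dln := dominates_trans dnu dn'.
  apply: (rem_mem _ (hl _ dln)).
  apply: contraTneq (prank_lt dnu ne) => e; rewrite -leqNgt; apply: prank_le.
  by rewrite -e.
Qed.

End Theta.

(** [jackc] is chosen by [xget] with default zero, so a family has to be exhibited. The product of
    the [theta - thev nu] over [nu != la], applied to the monomial function of [la], is an
    eigenvector of [theta] with nonzero leading coefficient. Orthogonality holds because [theta] is
    self-adjoint with distinct eigenvalues. *)
Lemma jack_exists : exists c : partn n -> partn n -> F,
  [/\ forall la, \sum_mu c la mu * (pm_coef (parts mu) (parts la))%:R = 1,
      forall la nu, ~~ dominates (parts la) (parts nu) ->
        \sum_mu c la mu * (pm_coef (parts mu) (parts nu))%:R = 0
    & forall la la', la != la' ->
        \sum_mu c la mu * c la' mu * (zee (parts mu))%:R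
          * (e1 / b) ^+ size (parts mu) = 0].
Proof.
have [K [t sep]] := generic_combination.
have H la : exists P : {mpoly F[n]}, [/\ whom P, supp_le (pad la) (to_x n P),
    xcoef P la = 1 & theta K t P = thev K t la *: P].
  have [m hm mc] := @monomial_sym F n (@num_char0 F) la.
  have sm : supp_le (pad la) (to_x n m).
    by apply: supp_leP => // nu nd; rewrite mc; case: eqP nd => // ->; rewrite dominates_refl.
  pose l := rem la (enum {: partn n}).
  have [s c] := foldr_tdiff_top K t l hm sm.
  have c0 : xcoef (foldr (tdiff K t) m l) la != 0.
    rewrite c mc eqxx mulr1 prodf_seq_neq0; apply/allP => nu.
    rewrite mem_rem_uniq ?enum_uniq // inE => /andP[ne _] /=.
    by rewrite subr_eq0 sep // eq_sym.
  have kill : tdiff K t la (foldr (tdiff K t) m l) = 0.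
    apply: (@foldr_tdiff_kill K t la m (la :: l)) => // nu _.
    rewrite inE mem_rem_uniq ?enum_uniq // inE mem_enum andbT.
    by case: eqP.
  exists ((xcoef (foldr (tdiff K t) m l) la)^-1 *: foldr (tdiff K t) m l); split.
  - by apply: dhomogZ; apply: foldr_tdiff_homog.
  - by rewrite to_xZ; apply: supp_leZ.
  - by rewrite to_xZ mcoeffZ mulVf.
  - rewrite thetaZ; move/eqP: kill; rewrite subr_eq0 => /eqP ->.
    by rewrite !scalerA mulrC.
have [P PP] := boolp.choice H.
pose c la mu := (P la)@_(pexp mu).
have PE la : P la = jackp c la by apply: homogE; case: (PP la).
exists c; split=> [la|la nu nd|la la' ne].
- by rewrite -xcoef_sum -/(jackp c la) -PE; case: (PP la).
- rewrite -xcoef_sum -/(jackp c la) -PE; case: (PP la) => _ s _ _.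
  by apply/eqP; apply: contraR nd => /(supp_le_coef s).
- rewrite -ip_jackp -!PE.
  case: (PP la) (PP la') => _ _ _ ev [_ _ _ ev'].
  have := ip_theta K t (P la) (P la'); rewrite ev ev' ipZl ipZr => /eqP.
  rewrite -subr_eq0 -mulrBl mulf_eq0 subr_eq0 (negbTE (sep _ _ ne)) /= => /eqP.
  by [].
Qed.

End JackExistence.

(** * The coherent state and its jets *)

Section CoherentState.
Variables (F : numFieldType) (e1 b : F) (n : nat).
Hypotheses (e1_neq0 : e1 != 0) (b_neq0 : b != 0).
Variables (Vx Vy kap : nat -> F).
Hypothesis kap0 : kap 0%N = 1.
Hypothesis kapS : forall j, j.+1%:R * kap j.+1 =
  (e1 * b)^-1 * \sum_(k < j.+1) Vx k.+1 * Vy k.+1 * kap (j - k)%N.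
Implicit Types (g : {mpoly F[n]}) (s : seq nat) (m : 'X_{1..n}).

Definition pev (V : nat -> F) g := meval (fun k : 'I_n => V k.+1 / b) g.

(** The division by [mnorm] is what makes [coh n] represent evaluation at [Vy], see [ip_coh]. *)
Definition kcoef m : F := (\prod_(k < n) (Vy k.+1 / b) ^+ m k) / mnorm e1 b m.

(* The weight-[j] component of the coherent state [exp (sum_k Vy_k W_k / (hbar k))]. *)
Definition coh j : {mpoly F[n]} :=
  \sum_(m : 'X_{1..n < j.+1}) (if mnmwgt m == j then kcoef m else 0) *: 'X_[m].

Lemma coh_coef j m : (coh j)@_m = if mnmwgt m == j then kcoef m else 0.
Proof.
case: (ltnP (mdeg m) j.+1) => [lt|ge].
  by rewrite /coh (mcoeff_mpoly (fun m => if mnmwgt m == j then kcoef m else 0)).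
rewrite ifF; last by have := leq_mdeg_mnmwgt m; lia.
rewrite raddf_sum big1 //= => m' _; rewrite mcoeffZ mcoeffX.
case: (eqVneq (bmnm m') m) => [e|_]; rewrite ?mulr0 //.
by have := bmdeg m'; rewrite e ltnNge ge.
Qed.

Lemma coh_homog j : coh j \is j.-homog for mnmwgt.
Proof.
apply/dhomogP => m; rewrite mcoeff_msupp coh_coef.
by case: (eqVneq (mnmwgt m) j) => [<- //|_]; rewrite eqxx.
Qed.

(** An exponential of a linear form is an eigenvector of every partial derivative; on weight
    components the eigenvalue relation lowers the weight. *)
Lemma annih_coh (k : 'I_n) j : annih e1 k (coh j) =
  if (k < j)%N then Vy k.+1 *: coh (j - k.+1) else 0.
Proof.
have E : forall m, kcoef (m + U_(k)) * (e1 * k.+1%:R * (m k).+1%:R) = Vy k.+1 * kcoef m.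
  move=> m; rewrite /kcoef mnormU (bigD1 k) //= mnmDE mnm1E eqxx addn1 exprS.
  rewrite (eq_bigr (fun l : 'I_n => (Vy l.+1 / b) ^+ m l)) => [|l lk]; last first.
    by rewrite mnmDE mnm1E eq_sym (negbTE lk) addn0.
  rewrite [in RHS](bigD1 k) //=.
  have n0 : mnorm e1 b m != 0 by apply: mnorm_neq0.
  field.
  by rewrite n0 e1_neq0 b_neq0 !(addrC 1) !natr1 !pnatr_eq0.
apply/mpolyP => m; rewrite /annih mcoeffZ mcoeff_deriv coh_coef /= mnmwgtD mnmwgt1.
case: ltnP => [kj|jk]; last first.
  by rewrite mcoeff0 ifF ?mul0rn ?mulr0 //; lia.
rewrite mcoeffZ coh_coef.
have -> : (mnmwgt m == j - k.+1)%N = (mnmwgt m + k.+1 == j)%N by lia.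
case: ifP => _.
  by rewrite -E -mulr_natr; ring.
by rewrite mul0rn !mulr0.
Qed.

Lemma euler_weight j g : g \is j.-homog for mnmwgt ->
  \sum_(k < n) k.+1%:R *: ('X_k * g^`M(k)) = j%:R *: g.
Proof.
move=> hg; apply/mpolyP => m; rewrite raddf_sum /= mcoeffZ.
under eq_bigr => k _ do rewrite mcoeffZ euler_coef mulrA -natrM.
rewrite -mulr_suml -natr_sum.
case: (eqVneq (mnmwgt m) j) => [<-|ne]; last first.
  by rewrite (dhomog_nemf_coeff hg) ?mulr0.
by congr (_%:R * _); apply: eq_bigr => k _; rewrite mulnC.
Qed.

(** Euler's identity and [annih_coh] give the recursion [kapS]. Thus [kap j] is the coefficient of
    [t^j] in the exponential of the sum of [Vx_k Vy_k t^k / (e1 b k)]. *)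
Lemma pev_coh j : (j <= n)%N -> pev Vx (coh j) = kap j.
Proof.
elim/ltn_ind: j => -[_ _|j IH jn].
  have -> : coh 0 = 1.
    apply/mpolyP => m; rewrite coh_coef mcoeff1.
    case: (eqVneq m 0%MM) => [->|ne]; first last.
      by rewrite ifF //; have := leq_mdeg_mnmwgt m; move: ne; rewrite -mdeg_eq0; lia.
    rewrite mnmwgt0 eqxx /kcoef /mnorm !big1 ?divr1 // => k _; rewrite mnm0E ?expr0 //.
    by rewrite mul1r fact0.
  by rewrite /pev meval1 kap0.
apply: (@mulfI _ j.+1%:R); first by rewrite pnatr_eq0.
rewrite kapS /pev -mevalZ -(euler_weight (coh_homog j.+1)) raddf_sum /=.
have E (k : 'I_n) : meval (fun k : 'I_n => Vx k.+1 / b) (k.+1%:R *: ('X_k * (coh j.+1)^`M(k)))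
    = if (k < j.+1)%N then (e1 * b)^-1 * (Vx k.+1 * Vy k.+1 * kap (j - k)%N) else 0.
  rewrite mevalZ mevalM mevalXU; have := annih_coh k j.+1; rewrite /annih.
  move/(congr1 (fun g => pev Vx g)); rewrite /pev mevalZ subSS.
  have ek : e1 * k.+1%:R != 0 by rewrite mulf_neq0 ?pnatr_eq0.
  move=> e; have -> : meval (fun k : 'I_n => Vx k.+1 / b) (coh j.+1)^`M(k) = (e1 * k.+1%:R)^-1 *
    meval (fun k0 : 'I_n => Vx k0.+1 / b) (if (k < j.+1)%N then Vy k.+1 *: coh (j - k) else 0).
    by rewrite -e mulKf.
  case: ltnP => kj; last by rewrite meval0 !mulr0.
  rewrite mevalZ -/(pev Vx (coh (j - k))) IH; [|lia|lia].
  by field; rewrite e1_neq0 b_neq0 !(addrC 1) !natr1 !pnatr_eq0.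
under eq_bigr => k _ do rewrite E.
rewrite -big_mkcond mulr_sumr.
by rewrite (big_ord_widen n (fun k => (e1 * b)^-1 * (Vx k.+1 * Vy k.+1 * kap (j - k)%N)) jn).
Qed.

Lemma ip_coh g : g \is n.-homog for mnmwgt -> ip e1 b (coh n) g = pev Vy g.
Proof.
move=> hg; rewrite ipC {1}(mpolyE g) ip_suml /pev mevalE big_seq [RHS]big_seq.
apply: eq_bigr => m ms; rewrite ipZl ipX coh_coef (dhomog_mf hg ms) eqxx.
by rewrite /kcoef divfK ?mnorm_neq0.
Qed.

(** Natural indices, with the zero operator out of range, let the same lists of annihilators be used
    for every [n]. *)
Definition annihn k g := \sum_(k' < n | k' == k :> nat) annih e1 k' g.

Lemma annihnE (k : 'I_n) g : annihn k g = annih e1 k g.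
Proof. by rewrite /annihn (big_pred1 k). Qed.

Lemma annihn0 k g : (n <= k)%N -> annihn k g = 0.
Proof.
by move=> nk; rewrite /annihn big_pred0 // => k'; have := ltn_ord k'; lia.
Qed.

Lemma annihn_lin k c g g' : annihn k (c *: g + g') = c *: annihn k g + annihn k g'.
Proof.
rewrite /annihn scaler_sumr -big_split /=; apply: eq_bigr => k' _.
exact: annih_lin.
Qed.

Lemma annihn_coh k j : (j <= n)%N -> annihn k (coh j) =
  if (k < j)%N then Vy k.+1 *: coh (j - k.+1) else 0.
Proof.
move=> jn; case: (ltnP k n) => kn.
  by rewrite -[k]/(val (Ordinal kn)) annihnE annih_coh.
by rewrite annihn0 // ifF //; lia.
Qed.

Fixpoint annihs s g := if s is k :: s' then annihs s' (annihn k g) else g.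

Lemma annihs_lin s c g g' : annihs s (c *: g + g') = c *: annihs s g + annihs s g'.
Proof. by elim: s g g' => //= k s IH g g'; rewrite annihn_lin IH. Qed.

Lemma annihs0 s : annihs s 0 = 0.
Proof.
have /eqP := annihs_lin s 1 0 0; rewrite scale1r addr0 scale1r.
by rewrite -[X in X == _]addr0 (inj_eq (addrI _)) eq_sym => /eqP.
Qed.

Lemma annihsD s g g' : annihs s (g + g') = annihs s g + annihs s g'.
Proof. by rewrite -[g]scale1r annihs_lin !scale1r. Qed.

Lemma annihsZ s c g : annihs s (c *: g) = c *: annihs s g.
Proof. by rewrite -[c *: g]addr0 annihs_lin annihs0 addr0. Qed.

Lemma annihs_sum s I (r : seq I) (P : pred I) (G : I -> {mpoly F[n]}) :
  annihs s (\sum_(k <- r | P k) G k) = \sum_(k <- r | P k) annihs s (G k).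
Proof. exact: (big_morph _ (annihsD s) (annihs0 s)). Qed.

Definition wt s := sumn (map S s).
Definition delete (i : nat) s := take i s ++ drop i.+1 s.

Lemma annihn_creat k (a : 'I_n) g : annihn k (creat b a g) =
  creat b a (annihn k g) + ((k == a)%:R * (e1 * b * a.+1%:R)) *: g.
Proof.
case: (ltnP k n) => [kn|nk]; last first.
  have -> : (k == a) = false by have := ltn_ord a; lia.
  by rewrite !annihn0 // /creat mulr0 scaler0 mul0r scale0r addr0.
rewrite -[k]/(val (Ordinal kn)); move: (Ordinal kn) => k'.
rewrite !annihnE /annih /creat mderivZ mderivM mderivX mnm1E val_eqE eq_sym.
case: eqP => [->|_].
  rewrite -{1}[U_(a)%MM]add0m addmK mpolyX0 scale1r mul1r [true%:R * _]mul1r.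
  by rewrite -!mul_mpolyC; ring.
by rewrite scale0r !mul0r scale0r addr0 add0r -!mul_mpolyC; ring.
Qed.

(** The creator is moved to the left through the annihilators; each annihilator of the same index is
    contracted with it once. *)
Lemma annihs_creat s (a : 'I_n) g : annihs s (creat b a g) =
  creat b a (annihs s g) + \sum_(i < size s)
    ((nth 0%N s i == a)%:R * (e1 * b * a.+1%:R)) *: annihs (delete i s) g.
Proof.
elim: s g => [|k s IH] g /=; first by rewrite big_ord0 addr0.
have d0 : delete 0 (k :: s) = s by rewrite /delete /= drop0.
rewrite annihn_creat annihsD IH annihsZ big_ord_recl d0 -addrA; congr (_ + _).
by rewrite addrC.
Qed.

Lemma annihs_coh s j : (j <= n)%N -> annihs s (coh j) =
  if (wt s <= j)%N then (\prod_(k <- s) Vy k.+1) *: coh (j - wt s) else 0.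
Proof.
elim: s j => [|k s IH] j jn /=; first by rewrite big_nil scale1r subn0.
rewrite annihn_coh // -[wt (k :: s)]/(k.+1 + wt s)%N big_cons.
case: ltnP => kj; last by rewrite annihs0 ifF //; lia.
rewrite annihsZ IH; last by lia.
rewrite leq_subRL // -subnDA; case: ifP => _; last by rewrite scaler0.
by rewrite scalerA.
Qed.

End CoherentState.

(* Bookkeeping of normal ordering: for a state [h] produced from the coherent
   state, [J m s d] is the coefficient of [kap (n - d)] in the evaluation of
   [annihs s (h m)].  It does not depend on [n]. *)
Section Jets.
Variables (F : comNzRingType) (Vx Vy : nat -> F) (dl hb : F).
Definition sjet := seq nat -> nat -> F.
Definition vjet := nat -> seq nat -> nat -> F.
Implicit Types (g : sjet) (h : vjet).

Definition jinit : sjet := fun s d => (d == wt s)%:R * \prod_(k <- s) Vy k.+1.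

(** Mirrors [annihs_creat]: the first term evaluates the creator at [Vx], the others are the
    contractions. *)
Definition jcreat a g : sjet := fun s d => Vx a.+1 * g s d
  + \sum_(i < size s) ((nth 0%N s i == a)%:R * (hb * a.+1%:R)) * g (delete i s) d.

Definition jraise g : vjet := fun m s d => g (m :: s) d.

Definition jlax h : vjet := fun m s d => (dl * m.+1%:R) * h m s d
  + \sum_(k < m) h (m - k.+1)%N (val k :: s) d
  + \sum_(a < d) jcreat a (h (m + a).+1) s d.

Definition jlower h : sjet := fun s d => \sum_(m < d) jcreat m (h m) s d.

Definition jham r g : sjet := jlower (iter r jlax (jraise g)).

(** The annihilators [s] lower the weight by [wt s], so the defect [d] is at least [wt s]. This
    makes the sums up to [d] in [jlax] and [jlower] complete. *)
Definition ssupp g := forall s d, (d < wt s)%N -> g s d = 0.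
Definition vsupp h := forall m s d, (d < wt s + m.+1)%N -> h m s d = 0.

Lemma wt_delete s i : (i < size s)%N -> (wt (delete i s) + (nth 0 s i).+1 = wt s)%N.
Proof.
move=> lt; rewrite -{3}(cat_take_drop i s) (drop_nth 0%N lt) /wt /delete.
by rewrite !map_cat !sumn_cat /=; lia.
Qed.

Lemma jinit_supp : ssupp jinit.
Proof. by move=> s d lt; rewrite /jinit ltn_eqF ?mul0r. Qed.

Lemma jraise_supp g : ssupp g -> vsupp (jraise g).
Proof. by move=> hg m s d lt; apply: hg; rewrite /wt /= -/(wt s); lia. Qed.

Lemma jcreat_supp h m a s d : vsupp h -> (d < wt s + m.+1)%N ->
  jcreat a (h (m + a).+1) s d = 0.
Proof.
move=> hh lt; rewrite /jcreat hh ?mulr0 ?add0r; last by lia.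
rewrite big1 // => i _; case: eqP => [e|_]; rewrite ?mul0r //.
by rewrite hh ?mulr0 //; have := wt_delete (ltn_ord i); rewrite e; lia.
Qed.

Lemma jlax_supp h : vsupp h -> vsupp (jlax h).
Proof.
move=> hh m s d lt; rewrite /jlax hh // mulr0 add0r.
rewrite !big1 ?addr0 // => [a _|k _]; first exact: jcreat_supp.
by rewrite hh // /wt /= -/(wt s); have := ltn_ord k; lia.
Qed.

Lemma jlower_supp h : vsupp h -> ssupp (jlower h).
Proof.
move=> hh s d lt; rewrite /jlower big1 // => m _.
rewrite /jcreat hh ?mulr0 ?add0r; last by lia.
rewrite big1 // => i _; case: eqP => [e|_]; rewrite ?mul0r //.
by rewrite hh ?mulr0 //; have := wt_delete (ltn_ord i); rewrite e; lia.
Qed.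

Lemma iter_jlax_supp r g : ssupp g -> vsupp (iter r jlax (jraise g)).
Proof. by move=> hg; elim: r => [|r IH] /=; [apply: jraise_supp|apply: jlax_supp]. Qed.

Lemma jham_supp r g : ssupp g -> ssupp (jham r g).
Proof. by move=> hg; apply: jlower_supp; apply: iter_jlax_supp. Qed.

End Jets.

(** * Moments of the eigenvalues in terms of jets *)

Section JetsRepresent.
Variables (F : numFieldType) (e1 b : F) (n : nat).
Hypotheses (e1_neq0 : e1 != 0) (b_neq0 : b != 0).
Variables (Vx Vy kap : nat -> F).
Hypothesis kap0 : kap 0%N = 1.
Hypothesis kapS : forall j, j.+1%:R * kap j.+1 =
  (e1 * b)^-1 * \sum_(k < j.+1) Vx k.+1 * Vy k.+1 * kap (j - k)%N.
Implicit Types (g : {mpoly F[n]}) (s : seq nat) (la mu nu : partn n).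

Local Notation ev := (pev b Vx).
Local Notation JC := (@jcreat F Vx (e1 * b)).
Local Notation JX := (@jlax F Vx (e1 - b) (e1 * b)).
Local Notation JL := (@jlower F Vx (e1 * b)).
Local Notation JH := (@jham F Vx (e1 - b) (e1 * b)).

Definition kser (u : nat -> F) := \sum_(d < n.+1) u d * kap (n - d)%N.

Definition srep g (J : sjet F) := forall s, ev (annihs e1 s g) = kser (J s).
Definition vrep (h : 'I_n -> {mpoly F[n]}) (J : vjet F) :=
  forall (m : 'I_n) s, ev (annihs e1 s (h m)) = kser (J m s).

Lemma evD g g' : ev (g + g') = ev g + ev g'.
Proof. exact: mevalD. Qed.
Lemma evZ c g : ev (c *: g) = c * ev g.
Proof. exact: mevalZ. Qed.
Lemma ev_sum I (r : seq I) (P : pred I) (G : I -> {mpoly F[n]}) :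
  ev (\sum_(k <- r | P k) G k) = \sum_(k <- r | P k) ev (G k).
Proof. exact: raddf_sum. Qed.
Lemma ev_creat a g : ev (creat b a g) = Vx a.+1 * ev g.
Proof. by rewrite evZ /pev mevalM mevalXU mulrA [b * _]mulrC divfK. Qed.

Lemma kserD u v : kser (fun d => u d + v d) = kser u + kser v.
Proof. by rewrite -big_split; apply: eq_bigr => d _; rewrite mulrDl. Qed.
Lemma kserZ c u : kser (fun d => c * u d) = c * kser u.
Proof. by rewrite mulr_sumr; apply: eq_bigr => d _; rewrite mulrA. Qed.
Lemma kser_sum I (r : seq I) (P : pred I) (G : I -> nat -> F) :
  kser (fun d => \sum_(k <- r | P k) G k d) = \sum_(k <- r | P k) kser (G k).
Proof.
rewrite /kser; under eq_bigr => d _ do rewrite mulr_suml.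
by rewrite exchange_big.
Qed.
Lemma eq_kser u v : (forall d, (d <= n)%N -> u d = v d) -> kser u = kser v.
Proof. by move=> e; apply: eq_bigr => d _; rewrite e // -ltnS. Qed.

Lemma srep_init : srep (@coh F e1 b n Vy n) (jinit Vy).
Proof.
move=> s; rewrite annihs_coh // /kser /jinit; case: leqP => [le|lt].
  rewrite evZ (pev_coh e1_neq0 b_neq0 kap0 kapS) ?leq_subr // (bigD1 (inord (wt s))) //= inordK // eqxx mul1r.
  rewrite [X in _ + X]big1 ?addr0 // => d ne; have -> : (d == wt s :> nat) = false.
    by apply: contraNF ne => /eqP e; apply/eqP/val_inj; rewrite /= inordK.
  by rewrite !mul0r.
rewrite [ev 0]meval0 big1 // => d _.
by rewrite ltn_eqF ?mul0r // (leq_ltn_trans _ lt) // -ltnS.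
Qed.

Lemma srep_creat (a : 'I_n) g J : srep g J -> srep (creat b a g) (JC a J).
Proof.
move=> h s; rewrite (annihs_creat e1_neq0 b_neq0) evD ev_creat h ev_sum -kserZ.
under eq_bigr => i _ do rewrite evZ h -kserZ.
by rewrite -kser_sum -kserD.
Qed.

Lemma srep_sum I (r : seq I) (P : pred I) G (J : I -> sjet F) :
  (forall k, P k -> srep (G k) (J k)) ->
  srep (\sum_(k <- r | P k) G k) (fun s d => \sum_(k <- r | P k) J k s d).
Proof.
by move=> h s; rewrite annihs_sum ev_sum kser_sum; apply: eq_bigr => k /h.
Qed.

Lemma vrep_raise g J : srep g J -> vrep (raise e1 g) (jraise J).
Proof. by move=> h m s; rewrite -(h (val m :: s)) /= annihnE. Qed.

Lemma srep_annih (k : 'I_n) g J : srep g J -> srep (annih e1 k g) (fun s => J (val k :: s)).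
Proof. by move=> h s; rewrite -(h (val k :: s)) /= annihnE. Qed.

(** The operator sums stop at [n], the jet sums at [d]; the support condition makes the terms in
    between vanish. *)
Lemma vrep_lax h J : vsupp J -> vrep h J -> vrep (lax e1 b h) (JX J).
Proof.
move=> sJ hJ m s; rewrite /lax !annihsD !evD annihsZ evZ hJ -kserZ.
have -> : ev (annihs e1 s (\sum_(k < n) \sum_(l < n | (k + l).+1 == m) annih e1 k (h l)))
   = kser (fun d => \sum_(k < m) J (m - k.+1)%N (val k :: s) d).
  rewrite (@srep_sum _ _ _ _ (fun (k : 'I_n) s d => \sum_(l < n | (k + l).+1 == m) J l (val k :: s) d)).
    apply: eq_kser => d _; rewrite (big_ord_widen n (fun k => J (m - k.+1)%N (k :: s) d)); last exact: ltnW.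
    rewrite [RHS]big_mkcond /=; apply: eq_bigr => k _.
    rewrite (eq_bigl (fun l : 'I_n => (k < m)%N && (l == m - k.+1 :> nat)%N)); last first.
      by move=> l /=; lia.
    case: ltnP => km /=; last by rewrite big_pred0.
    rewrite (big_ord1_eq _ (fun l => J l (val k :: s) d)) ifT //.
    by have := ltn_ord m; lia.
  move=> k _; apply: srep_sum => l _; exact: srep_annih.
have -> : ev (annihs e1 s (\sum_(k < n) \sum_(l < n | (m + k).+1 == l) creat b k (h l)))
   = kser (fun d => \sum_(a < d) JC a (J (m + a).+1) s d).
  rewrite (@srep_sum _ _ _ _ (fun (k : 'I_n) s d => \sum_(l < n | (m + k).+1 == l) JC k (J l) s d)).
    apply: eq_kser => d dn.
    rewrite (big_ord_widen n (fun a => JC a (J (m + a).+1) s d)) //.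
    rewrite [RHS]big_mkcond /=; apply: eq_bigr => a _.
    rewrite (eq_bigl (fun l : 'I_n => (l == (m + a).+1 :> nat)%N)); last first.
      by move=> l; rewrite eq_sym.
    rewrite (big_ord1_eq _ (fun l => JC a (J l) s d)).
    have z : (d < (m + a).+2)%N -> JC a (J (m + a).+1) s d = 0.
      move=> lt; rewrite /jcreat sJ ?mulr0 ?add0r; last by lia.
      by rewrite big1 // => i _; rewrite sJ ?mulr0 //; lia.
    case: ltnP => [lt1|ge1]; case: ltnP => [lt2|ge2] //; [|by rewrite z //; lia].
    by apply: z; lia.
  move=> k _; apply: srep_sum => l _; apply: srep_creat => s'; exact: hJ.
by rewrite -!kserD.
Qed.

Lemma srep_lower h J : vsupp J -> vrep h J -> srep (lower b h) (JL J).
Proof.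
move=> sJ hJ s.
rewrite (@srep_sum _ _ _ _ (fun (m : 'I_n) => JC m (J m))) => [|m _]; last first.
  by apply: srep_creat => s'; apply: hJ.
apply: eq_kser => d dn.
rewrite /jlower [RHS](big_ord_widen n (fun m => JC m (J m) s d)) //.
rewrite [RHS]big_mkcond /=.
apply: eq_bigr => m _; case: ltnP => // dm.
rewrite /jcreat sJ ?mulr0 ?add0r; last by lia.
by rewrite big1 // => i _; rewrite sJ ?mulr0 //; lia.
Qed.

Lemma srep_ham r g J : ssupp J -> srep g J ->
  srep (hamiltonian e1 b r g) (JH r J).
Proof.
move=> sJ hg; apply: srep_lower; first exact: iter_jlax_supp.
elim: r => [|r IH] /=; first exact: vrep_raise.
by apply: vrep_lax => //; apply: iter_jlax_supp.
Qed.

Definition jhams rs := foldr JH (jinit Vy) rs.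

Lemma jhams_supp rs : ssupp (jhams rs).
Proof. by elim: rs => [|r rs IH] /=; [apply: jinit_supp|apply: jham_supp]. Qed.

Lemma srep_hams rs :
  srep (foldr (@hamiltonian F e1 b n) (@coh F e1 b n Vy n) rs) (jhams rs).
Proof.
elim: rs => [|r rs IH] /=; first exact: srep_init.
by apply: srep_ham => //; apply: jhams_supp.
Qed.

Variable c : partn n -> partn n -> F.
Hypothesis J1 : forall la, \sum_mu c la mu * (pm_coef (parts mu) (parts la))%:R = 1.
Hypothesis J2 : forall la nu, ~~ dominates (parts la) (parts nu) ->
  \sum_mu c la mu * (pm_coef (parts mu) (parts nu))%:R = 0.
Hypothesis J3 : forall la la', la != la' ->
  \sum_mu c la mu * c la' mu * (zee (parts mu))%:R * (e1 / b) ^+ size (parts mu) = 0.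
Hypothesis J4 : forall la,
  \sum_mu c la mu * c la mu * (zee (parts mu))%:R * (e1 / b) ^+ size (parts mu) != 0.

(** The coherent state is expanded in the Jack basis, where by [ip_coh] the coefficient of [P_la] is
    [P_la(Vy)] over its squared norm. The Hamiltonians act by eigenvalues, and the result is
    evaluated at [Vx]. *)
Lemma jack_moment_jets rs :
  \sum_la (\sum_mu c la mu * \prod_(k <- parts mu) (Vx k / b)) *
     (\sum_mu c la mu * \prod_(k <- parts mu) (Vy k / b)) /
     (\sum_mu c la mu * c la mu * (zee (parts mu))%:R * (e1 / b) ^+ size (parts mu))
     * \prod_(r <- rs) eig e1 b (pad la) r
  = \sum_(d < n.+1) jhams rs [::] d * kap (n - d)%N.
Proof.
have evP V la : pev b V (jackp c la) = \sum_mu c la mu * \prod_(k <- parts mu) (V k / b).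
  rewrite /pev raddf_sum /=; apply: eq_bigr => mu _.
  by rewrite mevalZ (meval_pexp (fun k => V k / b)).
rewrite -/(kser _) -srep_hams /=.
have J3' la la' : la != la' -> ip e1 b (jackp c la) (jackp c la') = 0.
  by move=> ne; rewrite ip_jackp J3.
have J4' la : ip e1 b (jackp c la) (jackp c la) != 0 by rewrite ip_jackp J4.
have lin rs' I (r : seq I) (P : pred I) (d : I -> F) (G : I -> {mpoly F[n]}) :
    foldr (@hamiltonian F e1 b n) (\sum_(k <- r | P k) d k *: G k) rs'
    = \sum_(k <- r | P k) d k *: foldr (@hamiltonian F e1 b n) (G k) rs'.
  elim: rs' => //= r' rs' ->; have h0 : hamiltonian e1 b r' 0 = 0 :> {mpoly F[n]}.
    have /eqP := @ham_lin F e1 b n r' 1 0 0; rewrite scale1r addr0 scale1r.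
    by rewrite -[X in X == _]addr0 (inj_eq (addrI _)) eq_sym => /eqP.
  elim/big_rec2: _ => // k g g' _ <-; exact: ham_lin.
have hE la rs' : foldr (@hamiltonian F e1 b n) (jackp c la) rs'
    = (\prod_(r <- rs') eig e1 b (pad la) r) *: jackp c la.
  elim: rs' => [|r rs' IH] /=; first by rewrite big_nil scale1r.
  rewrite IH -[_ *: _]addr0 ham_lin; have -> : hamiltonian e1 b r 0 = 0 :> {mpoly F[n]}.
    have /eqP := @ham_lin F e1 b n r 1 0 0; rewrite scale1r addr0 scale1r.
    by rewrite -[X in X == _]addr0 (inj_eq (addrI _)) eq_sym => /eqP.
  rewrite addr0 (ham_jackp b_neq0 J1 J2 J3' J4') scalerA big_cons.
  by rewrite [_ * eig _ _ _ _]mulrC.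
rewrite {1}(jackp_expand J1 J2 J3' J4' (@coh_homog F e1 b n e1_neq0 b_neq0 Vy n)) lin ev_sum.
apply: eq_bigr => la _; rewrite evZ hE evZ ip_coh ?jackp_homog //.
rewrite !evP ip_jackp; field; exact: J4.
Qed.

End JetsRepresent.
End JackAlgebra.
From mathcomp Require Import all_classical all_reals all_analysis.
From mathcomp Require Import complex.
Import Order.TTheory GRing.Theory Num.Theory.
Import numFieldNormedType.Exports.
Local Open Scope classical_set_scope.
Local Open Scope ring_scope.
Import JackAlgebra.
Set Implicit Arguments.
Unset Strict Implicit.
Unset Printing Implicit Defensive.
Local Notation partn := Defs.partn.

(** * Modulus, real and imaginary parts *)

Section ComplexNorm.
Variable R : realType.
Local Notation C := R[i].

Definition nrm (z : C) : R := Num.sqrt (sqmod z).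

Lemma nrmE (z : C) : nrm z = ComplexField.Normc.normc z.
Proof. by case: z. Qed.

Lemma nrm_ge0 (z : C) : 0 <= nrm z.
Proof. exact: sqrtr_ge0. Qed.

Lemma nrmD (z w : C) : nrm (z + w) <= nrm z + nrm w.
Proof. by rewrite !nrmE; exact: le_normcD. Qed.

Lemma nrmN (z : C) : nrm (- z) = nrm z.
Proof. by rewrite !nrmE; exact: normcN. Qed.

Lemma nrmM (z w : C) : nrm (z * w) = nrm z * nrm w.
Proof. by rewrite !nrmE; exact: ComplexField.Normc.normcM. Qed.

Lemma nrm_real (x : R) : nrm x%:C%C = `|x|.
Proof. by rewrite /nrm /sqmod /= expr0n addr0 sqrtr_sqr. Qed.

Lemma nrm0 : nrm 0 = 0.
Proof. by rewrite nrmE; exact: ComplexField.Normc.normc0. Qed.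

Lemma nrm_nat (k : nat) : nrm k%:R = k%:R.
Proof. by rewrite -(rmorph_nat (real_complex R)) nrm_real ger0_norm. Qed.

Lemma nrm_conj (z : C) : nrm z^*%C = nrm z.
Proof. by case: z => x y; rewrite /nrm /sqmod /= sqrrN. Qed.

Lemma nrm_sum I (r : seq I) (P : pred I) (G : I -> C) :
  nrm (\sum_(k <- r | P k) G k) <= \sum_(k <- r | P k) nrm (G k).
Proof.
elim/big_rec2: _ => [|k y x _ IH]; first by rewrite nrm0.
by apply: le_trans (nrmD _ _) _; rewrite lerD2l.
Qed.

Lemma Re_add (z w : C) : complex.Re (z + w) = complex.Re z + complex.Re w.
Proof. by case: z; case: w. Qed.

Lemma Re_sum I (r : seq I) (P : pred I) (G : I -> C) :
  complex.Re (\sum_(k <- r | P k) G k) = \sum_(k <- r | P k) complex.Re (G k).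
Proof. by elim/big_rec2: _ => // k y x _ <-; rewrite Re_add. Qed.

Lemma Im_add (z w : C) : complex.Im (z + w) = complex.Im z + complex.Im w.
Proof. by case: z; case: w. Qed.

Lemma Im_sum I (r : seq I) (P : pred I) (G : I -> C) :
  complex.Im (\sum_(k <- r | P k) G k) = \sum_(k <- r | P k) complex.Im (G k).
Proof. by elim/big_rec2: _ => // k y x _ <-; rewrite Im_add. Qed.

Lemma Re_nrm (z : C) : `|complex.Re z| <= nrm z.
Proof.
rewrite -sqrtr_sqr /nrm ler_sqrt; last by rewrite addr_ge0 ?sqr_ge0.
by rewrite lerDl sqr_ge0.
Qed.

Lemma Im_nrm (z : C) : `|complex.Im z| <= nrm z.
Proof.
rewrite -sqrtr_sqr /nrm ler_sqrt; last by rewrite addr_ge0 ?sqr_ge0.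
by rewrite lerDr sqr_ge0.
Qed.

End ComplexNorm.

(** * Uniform bounds on jets as the parameters tend to zero *)

Section JetBounds.
Variable R : realType.
Local Notation C := R[i].

(** Size and rate of convergence share one constant, which keeps the predicate stable under sums and
    under multiplication by constants. *)
Definition bnd2 (x : R) (u : R -> C) (u0 : C) := forall e, 0 < e <= 1 ->
  nrm (u e) <= x /\ nrm (u e - u0) <= e * x.

Lemma bnd2_ge0 x u u0 : bnd2 x u u0 -> 0 <= x.
Proof.
by move=> /(_ 1); rewrite ltr01 lexx => -[] // + _; apply: le_trans (nrm_ge0 _).
Qed.

Lemma bnd2_le x y u u0 : x <= y -> bnd2 x u u0 -> bnd2 y u u0.
Proof.
move=> xy h e he; have [h1 h2] := h e he; split; first exact: le_trans xy.
by apply: le_trans h2 _; rewrite ler_wpM2l //; case/andP: he => /ltW.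
Qed.

Lemma bnd2_0 x : 0 <= x -> bnd2 x (fun=> 0) 0.
Proof.
by move=> x0 e /andP[e0 _]; rewrite subr0 nrm0; split=> //; rewrite mulr_ge0 // ltW.
Qed.

Lemma bnd2_cst c : bnd2 (nrm c) (fun=> c) c.
Proof.
by move=> e /andP[e0 _]; rewrite subrr nrm0; split=> //; rewrite mulr_ge0 ?nrm_ge0 // ltW.
Qed.

Lemma bnd2D x y u v u0 v0 : bnd2 x u u0 -> bnd2 y v v0 ->
  bnd2 (x + y) (fun e => u e + v e) (u0 + v0).
Proof.
move=> hu hv e he; have [u1 u2] := hu e he; have [v1 v2] := hv e he; split.
  by apply: le_trans (nrmD _ _) _; apply: lerD.
by rewrite opprD addrACA mulrDr; apply: le_trans (nrmD _ _) _; apply: lerD.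
Qed.

Lemma bnd2_sum x n (u : nat -> R -> C) (u0 : nat -> C) : 0 <= x ->
  (forall k, (k < n)%N -> bnd2 x (u k) (u0 k)) ->
  bnd2 (n%:R * x) (fun e => \sum_(k < n) u k e) (\sum_(k < n) u0 k).
Proof.
move=> x0; elim: n => [|n IH] h.
  rewrite mul0r big_ord0; under eq_fun do rewrite big_ord0; exact: bnd2_0.
rewrite big_ord_recr /= -natr1 mulrDl mul1r; under eq_fun do rewrite big_ord_recr /=.
apply: bnd2D; last exact: h.
by apply: IH => k kn; apply: h; apply: ltnW.
Qed.

Lemma bnd2Z x (K : R) c u u0 : nrm c <= K -> bnd2 x u u0 ->
  bnd2 (K * x) (fun e => c * u e) (c * u0).
Proof.
move=> cK hu e he; have [u1 u2] := hu e he; have K0 := le_trans (nrm_ge0 _) cK.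
rewrite -mulrBr !nrmM; split; first by apply: ler_pM; rewrite ?nrm_ge0.
by rewrite mulrCA; apply: ler_pM; rewrite ?nrm_ge0.
Qed.

Lemma bnd2eps x (K : R) (c : R -> C) u u0 : 0 <= K ->
  (forall e, 0 < e <= 1 -> nrm (c e) <= e * K) -> bnd2 x u u0 ->
  bnd2 (K * x) (fun e => c e * u e) 0.
Proof.
move=> K0 cK hu e he; have [u1 _] := hu e he; have x0 := bnd2_ge0 hu.
have /andP[e0 e1] := he; rewrite subr0 nrmM mulrA.
have h : nrm (c e) * nrm (u e) <= e * K * x by apply: ler_pM; rewrite ?nrm_ge0 // cK.
split=> //; apply: le_trans h _; apply: ler_wpM2r => //.
by rewrite -[leRHS]mul1r ler_wpM2r.
Qed.

Variables (V : nat -> C) (A rho a0 b0 : R).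
Hypotheses (A1 : 1 <= A) (rho0 : 0 < rho) (rho1 : rho < 1).
Hypothesis Vle : forall k, nrm (V k.+1) <= A * rho ^+ k.+1.
Local Notation Vx := V.
Local Notation Vy := (fun k => (V k)^*%C).

Definition pb (K : R) (p d : nat) : R := K * d.+1%:R ^+ p * rho ^+ d.

Lemma pb_ge0 K p d : 0 <= K -> 0 <= pb K p d.
Proof. by move=> K0; rewrite !mulr_ge0 // exprn_ge0 // ltW. Qed.

Lemma pb_le K K' p p' d : 0 <= K -> K <= K' -> (p <= p')%N -> pb K p d <= pb K' p' d.
Proof.
move=> K0 KK pp; apply: ler_wpM2r; first by rewrite exprn_ge0 ?ltW.
apply: ler_pM => //.
by apply: ler_weXn2l => //; rewrite ler1n.
Qed.

Lemma pbS K p d : d.+1%:R * pb K p d = pb K p.+1 d.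
Proof. by rewrite /pb exprS; ring. Qed.

Lemma pbZ c K p d : c * pb K p d = pb (c * K) p d.
Proof. by rewrite /pb !mulrA. Qed.

Lemma Vx_le k : nrm (Vx k.+1) <= A.
Proof.
apply: le_trans (Vle k) _; rewrite ler_piMr //; first by apply: le_trans A1.
by rewrite exprn_ile1 ?ltW.
Qed.

(** The constants may depend on the length of the annihilation list only. [jlax] changes this length
    by one, so all lengths are treated together; the polynomial factor is absorbed by the geometric
    one later. *)
Definition sgood (g : R -> sjet C) (g0 : sjet C) := forall r, exists K p, 0 <= K /\
  forall s d, size s = r -> bnd2 (pb K p d) (fun e => g e s d) (g0 s d).
Definition vgood (h : R -> vjet C) (h0 : vjet C) := forall r, exists K p, 0 <= K /\
  forall m s d, size s = r -> bnd2 (pb K p d) (fun e => h e m s d) (h0 m s d).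

Lemma jinit_good : sgood (fun=> jinit Vy) (jinit Vy).
Proof.
move=> r; exists (A ^+ r), 0%N; split; first by apply: exprn_ge0; apply: le_trans A1.
move=> s d sr; apply: bnd2_le (bnd2_cst _); rewrite /jinit /pb expr0 mulr1.
case: eqP => [->|_]; last first.
  by rewrite mul0r nrm0 mulr_ge0 // exprn_ge0 ?(le_trans _ A1) ?ltW.
rewrite mul1r -sr; elim: s {sr} => [|k s IH].
  by rewrite big_nil /wt /= !expr0 mulr1 -(mulr1n 1) nrm_nat.
rewrite big_cons nrmM nrm_conj /= -[wt (k :: s)]/(k.+1 + wt s)%N exprD exprS.
rewrite mulrACA; apply: ler_pM; rewrite ?nrm_ge0 //.
Qed.

Lemma jraise_good g g0 : sgood g g0 -> vgood (fun e => jraise (g e)) (jraise g0).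
Proof.
move=> h r; have [K [p [K0 hK]]] := h r.+1; exists K, p; split=> // m s d sr.
by apply: hK; rewrite /= sr.
Qed.

(** The scaling is [e1 = e] and [b = b2 * e], so [e1 - b] is of first order in [e] and [e1 * b] of
    second order; [climit1] takes [a0 = 1 - b2] and [b0 = b2]. *)
Let dl (e : R) : C := (e * a0)%:C%C.
Let hb (e : R) : C := (e * (e * b0))%:C%C.

Lemma size_delete i s : (i < size s)%N -> size (delete i s) = (size s).-1.
Proof.
by move=> lt; rewrite size_cat size_take size_drop lt; lia.
Qed.

(** The contraction terms carry the factor [hb e] and vanish in the limit; the index [a < d] costs
    one power of [d + 1]. *)
Lemma jcreat_bnd a d x y s (g : R -> sjet C) g0 : (a < d)%N -> 0 <= y ->
  bnd2 x (fun e => g e s d) (g0 s d) ->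
  (forall i, (i < size s)%N -> bnd2 y (fun e => g e (delete i s) d) (g0 (delete i s) d)) ->
  bnd2 (A * x + (size s)%:R * (`|b0| * d.+1%:R * y))
    (fun e => jcreat Vx (hb e) a (g e) s d) (jcreat Vx 0 a g0 s d).
Proof.
move=> ad y0 hx hy; apply: bnd2D; first by apply: bnd2Z => //; apply: Vx_le.
apply: (@bnd2_sum (`|b0| * d.+1%:R * y) (size s) (fun i e =>
  (nth 0%N s i == a)%:R * (hb e * a.+1%:R) * g e (delete i s) d) (fun i =>
  (nth 0%N s i == a)%:R * (0 * a.+1%:R) * g0 (delete i s) d)).
  by rewrite !mulr_ge0.
move=> i si; rewrite mul0r mulr0 mul0r; apply: bnd2eps (hy i si).
  by rewrite mulr_ge0.
move=> e /andP[e0 e1]; rewrite !nrmM nrm_real nrm_nat nrm_nat !normrM.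
rewrite (ger0_norm (ltW e0)).
have -> : (nth 0%N s i == a)%:R * (e * (e * `|b0|) * a.+1%:R) =
    e * (((nth 0%N s i == a)%:R * e) * `|b0| * a.+1%:R) by ring.
apply: ler_wpM2l; first exact: ltW.
apply: ler_pM; [by rewrite !mulr_ge0 // ltW | by [] | | by rewrite ler_nat ltnS ltnW].
by rewrite ler_piMl //; case: (_ == _); rewrite ?mul1r // mul0r.
Qed.

(** The diagonal term has a factor [e] and tends to zero. By the support condition [m] may be
    assumed below [d], so that both sums have at most [d] terms. *)
Lemma jlax_good h h0 : (forall e, vsupp (h e)) -> vsupp h0 -> vgood h h0 ->
  vgood (fun e => jlax Vx (dl e) (hb e) (h e)) (jlax Vx 0 0 h0).
Proof.
move=> sh sh0 hh r.
have [K1 [p1 [K10 h1]]] := hh r; have [K2 [p2 [K20 h2]]] := hh r.+1.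
have [K3 [p3 [K30 h3]]] := hh r.-1.
pose K := K1 + K2 + K3; pose p := (p1 + p2 + p3)%N.
have K0 : 0 <= K by rewrite !addr_ge0.
have b1 m s d : size s = r -> bnd2 (pb K p d) (fun e => h e m s d) (h0 m s d).
  by move=> sr; apply: bnd2_le (h1 m s d sr); apply: pb_le => //; rewrite /K /p; [lra|by rewrite -addnA leq_addr].
have b2 m s d : size s = r.+1 -> bnd2 (pb K p d) (fun e => h e m s d) (h0 m s d).
  by move=> sr; apply: bnd2_le (h2 m s d sr); apply: pb_le => //; rewrite /K /p; [lra|by rewrite -addnA addnCA leq_addr].
have b3 m s d : size s = r.-1 -> bnd2 (pb K p d) (fun e => h e m s d) (h0 m s d).
  by move=> sr; apply: bnd2_le (h3 m s d sr); apply: pb_le => //; rewrite /K /p; [lra|by rewrite leq_addl].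
have A0 : 0 <= A by apply: le_trans A1.
exists ((`|a0| + 1 + A + r%:R * `|b0|) * K), p.+2; split.
  by rewrite mulr_ge0 // !addr_ge0 // mulr_ge0.
move=> m s d sr; have x0 : 0 <= pb K p d by apply: pb_ge0.
have P1 : pb K p d <= pb K p.+2 d by apply: pb_le => //; exact: leqW (leqnSn p).
have P2 : pb K p.+1 d <= pb K p.+2 d by apply: pb_le => //; exact: leqnSn.
rewrite -pbZ; case: (ltnP d m.+1) => [lt|md].
  have z h' dl' hb' : vsupp h' -> jlax Vx dl' hb' h' m s d = 0.
    by move=> sh'; apply: jlax_supp => //; exact: leq_trans lt (leq_addl _ _).
  rewrite z //; under eq_fun => e do rewrite z //.
  by apply: bnd2_0; rewrite mulr_ge0 ?pb_ge0 // !addr_ge0 // mulr_ge0.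
have -> : (`|a0| + 1 + A + r%:R * `|b0|) * pb K p.+2 d =
    `|a0| * pb K p.+2 d + pb K p.+2 d + (A * pb K p.+2 d + r%:R * `|b0| * pb K p.+2 d) by ring.
apply: bnd2D; first apply: bnd2D.
- rewrite !mul0r; apply: (@bnd2_le (`|a0| * d.+1%:R * pb K p d)).
    by rewrite -mulrA ler_wpM2l // pbS.
  apply: bnd2eps (b1 m s d sr); first by rewrite mulr_ge0.
  move=> e /andP[e0 e1]; rewrite nrmM nrm_real nrm_nat normrM (ger0_norm (ltW e0)).
  rewrite -mulrA; apply: ler_wpM2l; first exact: ltW.
  by apply: ler_wpM2l => //; rewrite ler_nat leqW.
- apply: (@bnd2_le (m%:R * pb K p d)).
    by apply: le_trans P2; rewrite -pbS ler_wpM2r // ler_nat leqW // ltnW.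
  apply: (@bnd2_sum _ _ (fun k e => h e (m - k.+1)%N (k :: s) d)
    (fun k => h0 (m - k.+1)%N (k :: s) d)) => // k _.
  by apply: b2; rewrite /= sr.
- apply: (@bnd2_le (d%:R * (A * pb K p d + r%:R * (`|b0| * d.+1%:R * pb K p d)))).
    rewrite mulrDr; apply: lerD.
      by rewrite mulrCA ler_wpM2l //; apply: le_trans P2; rewrite -pbS ler_wpM2r // ler_nat.
    have -> : d%:R * (r%:R * (`|b0| * d.+1%:R * pb K p d))
      = r%:R * `|b0| * (d%:R * pb K p.+1 d) by rewrite -pbS; ring.
    by rewrite ler_wpM2l ?mulr_ge0 // -[leRHS]pbS ler_wpM2r ?pb_ge0 // ler_nat.
  apply: (@bnd2_sum _ _ (fun a e => jcreat Vx (hb e) a (h e (m + a).+1) s d)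
    (fun a => jcreat Vx 0 a (h0 (m + a).+1) s d)).
    by apply: addr_ge0; [apply: mulr_ge0 | do 2 apply: mulr_ge0 => //; apply: mulr_ge0].
  move=> a ad; rewrite -sr; apply: jcreat_bnd => //; first exact: b1.
  by move=> i si; apply: b3; rewrite size_delete // sr.
Qed.

Lemma jlower_good h h0 : vgood h h0 ->
  sgood (fun e => jlower Vx (hb e) (h e)) (jlower Vx 0 h0).
Proof.
move=> hh r.
have [K1 [p1 [K10 h1]]] := hh r; have [K3 [p3 [K30 h3]]] := hh r.-1.
pose K := K1 + K3; pose p := (p1 + p3)%N.
have K0 : 0 <= K by rewrite !addr_ge0.
have b1 m s d : size s = r -> bnd2 (pb K p d) (fun e => h e m s d) (h0 m s d).
  by move=> sr; apply: bnd2_le (h1 m s d sr); apply: pb_le => //; rewrite /K /p; [lra|by rewrite leq_addr].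
have b3 m s d : size s = r.-1 -> bnd2 (pb K p d) (fun e => h e m s d) (h0 m s d).
  by move=> sr; apply: bnd2_le (h3 m s d sr); apply: pb_le => //; rewrite /K /p; [lra|by rewrite leq_addl].
have A0 : 0 <= A by apply: le_trans A1.
exists ((A + r%:R * `|b0|) * K), p.+2; split; first by rewrite mulr_ge0 // addr_ge0 // mulr_ge0.
move=> s d sr; have x0 : 0 <= pb K p d by apply: pb_ge0.
have P2 : pb K p.+1 d <= pb K p.+2 d by apply: pb_le => //; exact: leqnSn.
rewrite -pbZ; apply: (@bnd2_le (d%:R * (A * pb K p d + r%:R * (`|b0| * d.+1%:R * pb K p d)))).
  rewrite mulrDr mulrDl; apply: lerD.
    by rewrite mulrCA ler_wpM2l //; apply: le_trans P2; rewrite -pbS ler_wpM2r // ler_nat.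
  have -> : d%:R * (r%:R * (`|b0| * d.+1%:R * pb K p d))
    = r%:R * `|b0| * (d%:R * pb K p.+1 d) by rewrite -pbS; ring.
  by rewrite ler_wpM2l ?mulr_ge0 // -[leRHS]pbS ler_wpM2r ?pb_ge0 // ler_nat.
apply: (@bnd2_sum _ _ (fun a e => jcreat Vx (hb e) a (h e a) s d)
  (fun a => jcreat Vx 0 a (h0 a) s d)); first by apply: addr_ge0; [apply: mulr_ge0 | do 2 apply: mulr_ge0 => //; apply: mulr_ge0].
move=> a ad; rewrite -sr; apply: jcreat_bnd => //; first exact: b1.
by move=> i si; apply: b3; rewrite size_delete // sr.
Qed.

Definition jh (x y : C) rs := foldr (@jham C Vx x y) (jinit Vy) rs.

Lemma jh_supp x y rs : ssupp (jh x y rs).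
Proof. by elim: rs => [|r rs IH] /=; [apply: jinit_supp|apply: jham_supp]. Qed.

Lemma jh_good rs : sgood (fun e => jh (dl e) (hb e) rs) (jh 0 0 rs).
Proof.
elim: rs => [|r rs IH] /=; first exact: jinit_good.
apply: jlower_good; elim: r => [|r IHr] /=; first exact: jraise_good.
apply: jlax_good => // [e|]; apply: iter_jlax_supp; exact: jh_supp.
Qed.

End JetBounds.

(** * Wiener-Hopf factorization for a Laurent polynomial *)

Section WienerHopf.
Variables (F : comNzRingType) (v : {poly F}) (M : nat).

Definition hipart n (p : {poly F}) := p - take_poly n p.

Lemma coef_hipart n p i : (hipart n p)`_i = if (i < n)%N then 0 else p`_i.
Proof.
rewrite coefB coef_take_poly; case: ifP => _; first by rewrite subrr.
by rewrite subr0.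
Qed.

(* [v] stands for the Laurent polynomial [w^-M * v(w)], and [whY l] for
   [w^(-l M) * whY l], the l-th iterate of the Toeplitz operator on positive
   powers of [w]. *)
Fixpoint whY l : {poly F} :=
  if l is l'.+1 then hipart (l * M).+1 (v * whY l') else 1.

(** [whkap] is the part of degree zero in [w] of the nonpositive factor [u] below, and [whb j] is
    the constant term of the [j]-th power of the symbol. *)
Definition whkap l : F := if l is l'.+1 then - (v * whY l')`_(l * M) else 1.
Definition whb j : F := (v ^+ j)`_(j * M).
Let B j := hipart (j * M).+1 (v ^+ j).
Let u l := if l is l'.+1 then whY l - v * whY l' else 1.

Lemma coefM_top (p q : {poly F}) a b : (size p <= a.+1)%N -> (size q <= b.+1)%N ->
  (p * q)`_(a + b) = p`_a * q`_b.
Proof.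
move=> pa qb; rewrite coefM (bigD1 (inord a)) //= inordK; last by lia.
rewrite addKn big1 ?addr0 // => i ne.
have nea : (i : nat) != a by apply: contraNneq ne => e; apply/eqP/val_inj; rewrite /= inordK //; lia.
case: (ltngtP i a) nea => // [lt|gt] _.
  by rewrite [X in _ * X]nth_default ?mulr0 //; apply: leq_trans qb _; lia.
by rewrite [X in X * _]nth_default ?mul0r //; apply: leq_trans pa gt.
Qed.

Lemma coefM_low (p q : {poly F}) a b i : (forall k, (k < a)%N -> p`_k = 0) ->
  (forall k, (k < b)%N -> q`_k = 0) -> (i < a + b)%N -> (p * q)`_i = 0.
Proof.
move=> pa qb lt; rewrite coefM big1 // => k _.
case: (ltnP k a) => [/pa ->|ak]; first by rewrite mul0r.
by rewrite qb ?mulr0 //; have := ltn_ord k; lia.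
Qed.

Lemma size_u l : (size (u l) <= (l * M).+1)%N.
Proof.
case: l => [|l]; first by rewrite size_poly1.
apply/leq_sizeP => i le; rewrite /u /= coefB coef_hipart ifF ?subrr //.
by rewrite ltnNge le.
Qed.

Lemma coef_u l : (u l)`_(l * M) = whkap l.
Proof.
case: l => [|l]; first by rewrite coef1.
by rewrite /u /= coefB coef_hipart ltnSn sub0r.
Qed.

Lemma whY_low l i : (i < l * M)%N -> (whY l)`_i = 0.
Proof. by case: l => // l lt; rewrite /= coef_hipart ifT // ltnW. Qed.

Lemma unroll l : v * whY l = \sum_(j < l.+1) v ^+ j.+1 * u (l - j).
Proof.
elim: l => [|l IH]; first by rewrite big_ord1 expr1 /u subn0 /=.
rewrite big_ord_recl expr1 subn0.
rewrite (eq_bigr (fun j : 'I_l.+1 => v * (v ^+ j.+1 * u (l - j)))).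
  by rewrite -mulr_sumr -IH /u; ring.
by move=> j _; rewrite lift0 subSS exprS mulrA.
Qed.

(** With [Y = sum_l whY l z^l] and [U = sum_l u l z^l] one has [(1 - z v) Y = U], where [Y - 1]
    contains only positive powers of [w] and [U] only nonpositive ones. Hence the constant term in
    [w] of [log (1 - z v)] is the logarithm of that of [U]. The proof works with the logarithmic
    derivative in [z]. *)
Lemma newton_wh : newton whkap whb.
Proof.
(* As series, [X] is [z Y' - B Y] with [B] the positive part of [sum_j v^j z^j], while [rhs] is
   [z U'] plus the nonpositive part of that sum times [U]. [XE] is the identity [(1 - z v) X = rhs],
   up to a shift of the index. *)
pose X l := l%:R * whY l - \sum_(j < l) B j.+1 * whY (l - j.+1).
pose rhs l := l.+1%:R * u l.+1 + \sum_(j < l.+1) (v ^+ j.+1 - B j.+1) * u (l - j).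
have XE l : X l.+1 - v * X l = rhs l.
  rewrite /X /rhs; under [in RHS]eq_bigr => j _ do rewrite mulrBl.
  rewrite sumrB -unroll [v * (l%:R * _ - _)]mulrBr [v * \sum_(_ < _) _]mulr_sumr.
  have -> : \sum_(j < l.+1) B j.+1 * u (l - j) =
     \sum_(j < l.+1) B j.+1 * whY (l.+1 - j.+1) - \sum_(j < l) v * (B j.+1 * whY (l - j.+1)).
    rewrite big_ord_recr [in RHS]big_ord_recr /= [RHS]addrAC -sumrB.
    congr (_ + _); last by rewrite subSS !subnn.
    apply: eq_bigr => j _; rewrite subSS /u -(subnSK (ltn_ord j)) /=; ring.
  rewrite /u /= -natr1; ring.
have Bsz j : (size (v ^+ j - B j)%R <= (j * M).+1)%N.
  by rewrite /B /hipart opprB addrC subrK size_take_poly.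
have rsz l : (size (rhs l) <= (l.+1 * M).+1)%N.
  rewrite /rhs; apply: leq_trans (size_polyD _ _) _; rewrite geq_max; apply/andP; split.
    rewrite mulr_natl; apply/leq_sizeP => i le; rewrite coefMn nth_default ?mul0rn //.
    exact: leq_trans (size_u _) le.
  apply: leq_trans (size_sum _ _ _) _; apply/bigmax_leqP => j _.
  apply: leq_trans (size_polyMleq _ _) _.
  have := Bsz j.+1; have := size_u (l - j).
  have : (j.+1 * M + (l - j) * M = l.+1 * M)%N.
    by rewrite -mulnDl; congr (_ * _)%N; have := ltn_ord j; lia.
  by move: (size _) (size _) (j.+1 * M)%N ((l - j) * M)%N (l.+1 * M)%N; lia.
have Xlow l i : (i < (l.+1 * M).+1)%N -> (X l.+1)`_i = 0.
  move=> lt; rewrite /X coefB coef_sum mulr_natl coefMn coef_hipart lt mul0rn sub0r.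
  rewrite big1 ?oppr0 // => j _.
  apply: (@coefM_low _ _ (j.+1 * M).+1 ((l.+1 - j.+1) * M)).
  - by move=> k kk; rewrite /B coef_hipart kk.
  - by move=> k kk; apply: whY_low.
  - have : (j.+1 * M + (l.+1 - j.+1) * M = l.+1 * M)%N.
      by rewrite -mulnDl; congr (_ * _)%N; have := ltn_ord j; lia.
    by lia.
(* If [X l] is zero, then [X l.+1 = rhs l] has only positive and only nonpositive powers of [w], so
   it vanishes too. *)
have X0 l : X l = 0.
  elim: l => [|l IH]; first by rewrite /X mul0r big_ord0 subr0.
  apply/polyP => i; rewrite coef0; case: (ltnP i (l.+1 * M).+1) => [/Xlow //|ge].
  have := XE l; rewrite IH mulr0 subr0 => ->.
  by rewrite nth_default //; apply: leq_trans (rsz l) ge.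
move=> [|l]; first by rewrite /nresid mul0r big_ord0 addr0.
have := congr1 (fun p : {poly F} => p`_(l.+1 * M)) (XE l).
rewrite !X0 mulr0 subr0 coef0 /rhs coefD mulr_natl coefMn coef_u coef_sum => e.
rewrite /nresid mulr_natl [RHS]e; congr (_ + _); apply: eq_bigr => j _.
have eM : (l.+1 * M = j.+1 * M + (l - j) * M)%N.
  by rewrite -mulnDl; congr (_ * _)%N; have := ltn_ord j; lia.
rewrite [in RHS]eM coefM_top ?Bsz ?size_u // coef_u subSS; congr (_ * _).
by rewrite /B coefB coef_hipart ltnSn subr0.
Qed.

End WienerHopf.

(** * Jets at vanishing parameters *)

Section ClassicalJets.
Variables (F : comNzRingType) (Vx Vy : nat -> F).
Implicit Types (u G : nat -> F).

Definition shiftn k u d : F := if (k <= d)%N then u (d - k)%N else 0.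
Definition cauchyp G u d : F := \sum_(i < d.+1) G i * u (d - i)%N.

Lemma shiftnS j k u d : shiftn j (shiftn k u) d = shiftn (k + j) u d.
Proof.
rewrite /shiftn; case: (leqP j d) => jd; last by rewrite ifF //; lia.
by rewrite leq_subRL // addnC -subnDA [(k + j)%N]addnC.
Qed.

Lemma conv_shift G k u d : cauchyp G (shiftn k u) d = shiftn k (cauchyp G u) d.
Proof.
rewrite /cauchyp /shiftn; case: leqP => [kd|dk]; last first.
  by rewrite big1 // => i _; rewrite ifF ?mulr0 //; lia.
have le : (d - k < d.+1)%N by lia.
rewrite (big_ord_widen d.+1 (fun i => G i * u (d - k - i)%N)) //.
rewrite [RHS]big_mkcond; apply: eq_bigr => i _ /=.
have -> : (i < (d - k).+1)%N = (k <= d - i)%N by have := ltn_ord i; lia.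
by case: ifP => // _; rewrite ?mulr0 // -!subnDA addnC.
Qed.

Lemma conv_sum G n (c : nat -> F) (U : nat -> nat -> F) d :
  cauchyp G (fun d => \sum_(k < n) c k * U k d) d = \sum_(k < n) c k * cauchyp G (U k) d.
Proof.
rewrite /cauchyp; under eq_bigr => i _ do rewrite mulr_sumr.
rewrite exchange_big; apply: eq_bigr => k _; rewrite mulr_sumr.
by apply: eq_bigr => i _; rewrite mulrCA.
Qed.

Lemma convD G u v d : cauchyp G (fun d => u d + v d) d = cauchyp G u d + cauchyp G v d.
Proof. by rewrite /cauchyp -big_split; apply: eq_bigr => i _; rewrite mulrDr. Qed.

Lemma eq_conv G u v d : (forall d', (d' <= d)%N -> u d' = v d') -> cauchyp G u d = cauchyp G v d.
Proof. by move=> e; apply: eq_bigr => i _; rewrite e // leq_subr. Qed.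

(* Toeplitz operator with symbol [v], graded by the total degree of [Vy]. *)
Fixpoint clc r m d : F :=
  if r is r'.+1 then
    \sum_(k < m) Vy k.+1 * shiftn k.+1 (clc r' (m - k.+1)%N) d
    + \sum_(a < d) Vx a.+1 * clc r' (m + a).+1 d
  else (d == m.+1)%:R * Vy m.+1.

Definition clo r d : F := \sum_(m < d) Vx m.+1 * clc r m d.

Lemma clc_supp r m d : (d < m.+1)%N -> clc r m d = 0.
Proof.
elim: r m d => [|r IH] m d lt /=; first by rewrite ltn_eqF ?mul0r.
rewrite big1 ?add0r => [|k _]; first by rewrite big1 // => a _; rewrite IH ?mulr0 //; lia.
rewrite /shiftn; case: (leqP k.+1 d) => kd; last by rewrite mulr0.
by rewrite IH ?mulr0 //; have := ltn_ord k; lia.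
Qed.

Lemma clc_widen r m d D : (d <= D)%N ->
  \sum_(a < D) Vx a.+1 * clc r (m + a).+1 d = \sum_(a < d) Vx a.+1 * clc r (m + a).+1 d.
Proof.
move=> dD; rewrite [RHS](big_ord_widen D (fun a => Vx a.+1 * clc r (m + a).+1 d)) //.
rewrite [RHS]big_mkcond; apply: eq_bigr => a _ /=; case: ltnP => // da.
by rewrite clc_supp ?mulr0 //; lia.
Qed.

Lemma clo_widen r d D : (d <= D)%N ->
  \sum_(m < D) Vx m.+1 * clc r m d = clo r d.
Proof.
move=> dD; rewrite /clo [RHS](big_ord_widen D (fun a => Vx a.+1 * clc r a d)) //.
rewrite [RHS]big_mkcond; apply: eq_bigr => a _ /=; case: ltnP => // da.
by rewrite clc_supp ?mulr0 //; lia.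
Qed.

(** The jet of a multiple of the coherent state: annihilators act as the numbers [Vy], and [G]
    records the multiplier degree by degree. *)
Definition scl G : sjet F := fun s d => \prod_(k <- s) Vy k.+1 * shiftn (wt s) G d.

Lemma jcreat0 a (g : sjet F) s d : jcreat Vx 0 a g s d = Vx a.+1 * g s d.
Proof.
by rewrite /jcreat big1 ?addr0 // => i _; rewrite mul0r mulr0 mul0r.
Qed.

Lemma shiftn_sum k n (c : nat -> F) (U : nat -> nat -> F) d :
  shiftn k (fun d => \sum_(i < n) c i * U i d) d = \sum_(i < n) c i * shiftn k (U i) d.
Proof.
by rewrite /shiftn; case: ifP => // _; rewrite big1 // => i _; rewrite mulr0.
Qed.

Lemma eq_shiftn k u v d : (forall d', (d' <= d)%N -> u d' = v d') ->
  shiftn k u d = shiftn k v d.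
Proof. by move=> e; rewrite /shiftn; case: ifP => // _; rewrite e // leq_subr. Qed.

Lemma shiftnD k u v d : shiftn k (fun d => u d + v d) d = shiftn k u d + shiftn k v d.
Proof. by rewrite /shiftn; case: ifP => // _; rewrite addr0. Qed.

Lemma iter_jlax0 r G m s d : iter r (jlax Vx 0 0) (jraise (scl G)) m s d
  = \prod_(k <- s) Vy k.+1 * shiftn (wt s) (cauchyp G (clc r m)) d.
Proof.
elim: r m s d => [|r IH] m s d /=.
  rewrite /jraise /scl big_cons -[wt (m :: s)]/(m.+1 + wt s)%N -shiftnS.
  rewrite -mulrA mulrCA; congr (_ * _); rewrite /shiftn.
  case: ifP => _; last by rewrite mulr0.
  set D := (d - wt s)%N; rewrite /cauchyp.
  case: (leqP m.+1 D) => mD; last first.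
    by rewrite mulr0 big1 // => i _; rewrite /= ltn_eqF ?mul0r ?mulr0 //; lia.
  have lt : (D - m.+1 < D.+1)%N by lia.
  rewrite (bigD1 (Ordinal lt)) //= subKn // eqxx mul1r big1 ?addr0; first by rewrite mulrC.
  move=> i ne.
  have -> : (D - i == m.+1)%N = false.
    apply: contraNF ne => /eqP e; apply/eqP/val_inj => /=.
    by have := ltn_ord i; lia.
  by rewrite mul0r mulr0.
rewrite {1}/jlax !mul0r add0r.
under [X in X + _ = _]eq_bigr => k _ do rewrite IH big_cons -[wt (_ :: s)]/(k.+1 + wt s)%N -shiftnS.
under [X in _ + X = _]eq_bigr => a _ do rewrite jcreat0 IH.
rewrite (@eq_shiftn _ (cauchyp G _) (fun d' => \sum_(k < m) Vy k.+1 *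
   shiftn k.+1 (cauchyp G (clc r (m - k.+1)%N)) d' + \sum_(a < d) Vx a.+1 * cauchyp G (clc r (m + a).+1) d')).
  rewrite shiftnD mulrDr (shiftn_sum _ _ (fun k => Vy k.+1)
    (fun k => shiftn k.+1 (cauchyp G (clc r (m - k.+1)%N)))).
  rewrite (shiftn_sum _ _ (fun a => Vx a.+1) (fun a => cauchyp G (clc r (m + a).+1))).
  rewrite !mulr_sumr; congr (_ + _); apply: eq_bigr => k _.
    by rewrite -mulrA mulrCA.
  by rewrite mulrCA.
move=> d' d'd; rewrite convD; congr (_ + _).
  rewrite (conv_sum G _ (fun k => Vy k.+1) (fun k => shiftn k.+1 (clc r (m - k.+1)%N))).
  by apply: eq_bigr => k _; rewrite conv_shift.
rewrite -(conv_sum G _ (fun a => Vx a.+1) (fun a => clc r (m + a).+1)).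
apply: eq_conv => d2 d2d; rewrite clc_widen //; exact: leq_trans d'd.
Qed.

(** Without commutators a Hamiltonian multiplies the coherent state by a scalar with graded pieces
    [clo r]. Products of Hamiltonians therefore become Cauchy products, which is the source of the
    factorization of joint moments. *)
Lemma jham0 r G s d : jham Vx 0 0 r (scl G) s d = scl (cauchyp G (clo r)) s d.
Proof.
rewrite /jham /jlower; under eq_bigr => m _ do rewrite jcreat0 iter_jlax0 mulrCA.
rewrite -mulr_sumr /scl; congr (_ * _).
rewrite -(shiftn_sum _ _ (fun m => Vx m.+1) (fun m => cauchyp G (clc r m))).
apply: eq_shiftn => d' d'd.
rewrite -(conv_sum G _ (fun m => Vx m.+1) (clc r)); apply: eq_conv => d2 d2d.
by rewrite clo_widen //; apply: leq_trans d'd.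
Qed.

Fixpoint clos rs : nat -> F :=
  if rs is r :: rs' then cauchyp (clos rs') (clo r) else fun d => (d == 0%N)%:R.

Lemma jh0 rs s d : foldr (@jham F Vx 0 0) (jinit Vy) rs s d = scl (clos rs) s d.
Proof.
have -> : foldr (@jham F Vx 0 0) (jinit Vy) rs = scl (clos rs); last by [].
elim: rs {s d} => [|r rs IH] /=.
  apply: boolp.funext => s; apply: boolp.funext => d; rewrite /jinit /scl mulrC.
  congr (_ * _); rewrite /shiftn; case: leqP => [le|lt]; last by rewrite ltn_eqF.
  by congr (_%:R); rewrite subn_eq0; lia.
by rewrite IH; apply: boolp.funext => s; apply: boolp.funext => d; rewrite jham0.
Qed.

End ClassicalJets.

(** * Classical jets of a truncated symbol as Toeplitz iterates *)

Section TruncatedSymbol.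
Variables (F : comNzRingType) (Vx Vy : nat -> F) (M : nat).
Hypotheses (Vx0 : forall k, (M < k)%N -> Vx k = 0) (Vy0 : forall k, (M < k)%N -> Vy k = 0).

Definition vpoly : {poly F} :=
  \sum_(k < M) (Vy k.+1 *: 'X^(M + k.+1) + Vx k.+1 *: 'X^(M - k.+1)).

Local Notation Y := (whY vpoly M).

Lemma coef_vpolyM (p : {poly F}) i : (vpoly * p)`_i =
  \sum_(k < M) (if (i < M + k.+1)%N then 0 else Vy k.+1 * p`_(i - (M + k.+1)))
  + \sum_(a < M) (if (i < M - a.+1)%N then 0 else Vx a.+1 * p`_(i - (M - a.+1))).
Proof.
rewrite /vpoly mulr_suml coef_sum -big_split; apply: eq_bigr => k _ /=.
rewrite mulrDl coefD -!scalerAl !coefZ !coefXnM.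
by congr (_ + _); case: ifP; rewrite ?mulr0.
Qed.

(** The coefficient of [w^(m+1)] in the [l]-th Toeplitz iterate, once the factor [w^(l M)] is taken
    out. *)
Definition yc l m := (Y l)`_(l * M + m.+1).

Lemma yc1 m : yc 1 m = Vy m.+1.
Proof.
rewrite /yc /= coef_hipart mul1n ifF; last by lia.
rewrite coef_vpolyM [X in _ + X]big1 ?addr0; last first.
  by move=> a _; rewrite ifF; [rewrite coef1; case: eqP => //; [lia|rewrite mulr0]|lia].
case: (ltnP m M) => mM; last first.
  rewrite Vy0 // big1 // => k _; rewrite ifF; last by have := ltn_ord k; lia.
  rewrite coef1; case: eqP => [|_]; last by rewrite mulr0.
  by have := ltn_ord k; lia.
rewrite (bigD1 (Ordinal mM)) //= ltnn subnn coef1 eqxx mulr1 big1 ?addr0 // => k ne.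
case: ifP => // lt; rewrite coef1; case: eqP => [e|_]; last by rewrite mulr0.
by case/eqP: ne; apply: val_inj => /=; lia.
Qed.

Lemma sum_Vy (G : nat -> F) m : \sum_(k < m) Vy k.+1 * G k =
  \sum_(k < M | (k < m)%N) Vy k.+1 * G k.
Proof.
case: (leqP m M) => mM.
  by rewrite (big_ord_widen M (fun k => Vy k.+1 * G k) mM).
rewrite (big_mkcond (fun k : 'I_M => (k < m)%N)) /=.
rewrite [RHS](big_ord_widen m (fun k => if (k < m)%N then Vy k.+1 * G k else 0)); last exact: ltnW.
rewrite [RHS]big_mkcond; apply: eq_bigr => k _ /=; rewrite ltn_ord.
by case: ltnP => // Mk; rewrite Vy0 ?mul0r.
Qed.

Lemma ycS l m : yc l.+2 m = \sum_(k < m) Vy k.+1 * yc l.+1 (m - k.+1)%N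
  + \sum_(a < M) Vx a.+1 * yc l.+1 (m + a).+1.
Proof.
rewrite {1}/yc -/(whY _ _ _) [Y l.+2]/= coef_hipart ifF; last by lia.
rewrite coef_vpolyM; congr (_ + _); last first.
  apply: eq_bigr => a _; have aM := ltn_ord a; rewrite ifF; last by lia.
  by rewrite /yc; congr (_ * _`_ _); lia.
rewrite (sum_Vy (fun k => yc l.+1 (m - k.+1)%N)) [RHS]big_mkcond; apply: eq_bigr => k _ /=.
have kM := ltn_ord k; rewrite ifF; last by lia.
case: ltnP => km; first by rewrite /yc; congr (_ * _`_ _); lia.
case: (eqVneq (k : nat) m) => [km'|ne].
  rewrite [X in _ * X](_ : _ = 0) ?mulr0 // coef_hipart ifT //; lia.
by rewrite [X in _ * X](_ : _ = 0) ?mulr0 // coef_hipart ifT //; lia.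
Qed.

Lemma whkap1 : whkap vpoly M 1 = 0.
Proof.
rewrite /whkap /= mulr1 mul1n -[vpoly]mulr1 coef_vpolyM !big1 ?addr0 ?oppr0 // => k _.
  by rewrite ifF; [rewrite coef1; case: eqP => [|_]; rewrite ?mulr0 //; have := ltn_ord k; lia|lia].
by rewrite ifT //; lia.
Qed.

Lemma whkapS l : whkap vpoly M l.+2 = - \sum_(a < M) Vx a.+1 * yc l.+1 a.
Proof.
rewrite /whkap coef_vpolyM [X in X + _]big1 ?add0r => [|k _]; last first.
  case: ifP => // lt; rewrite [X in _ * X](_ : _ = 0) ?mulr0 // coef_hipart ifT //.
  by have := ltn_ord k; lia.
congr (- _); apply: eq_bigr => a _; have aM := ltn_ord a; rewrite ifF; last by lia.
by rewrite /yc; congr (_ * _`_ _); lia.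
Qed.

Lemma clc_high r m d : (r.+1 * M < d)%N -> clc Vx Vy r m d = 0.
Proof.
elim: r m d => [|r IH] m d lt /=.
  by case: eqP => [e|_]; rewrite ?mul0r // Vy0 ?mulr0 //; lia.
rewrite big1 ?add0r => [|k _].
  by rewrite big1 // => a _; rewrite IH ?mulr0 //; lia.
rewrite /shiftn; case: (leqP k.+1 d) => kd; last by rewrite mulr0.
case: (ltnP M k.+1) => Mk; first by rewrite Vy0 ?mul0r.
by rewrite IH ?mulr0 //; lia.
Qed.

(** Summing over [d] forgets the grading, after which the recursions of [clc] and [ycS] coincide;
    beyond the bound on [D] all degrees are zero. *)
Lemma sum_clc r m D : (r.+1 * M < D)%N -> \sum_(d < D) clc Vx Vy r m d = yc r.+1 m.
Proof.
elim: r m D => [|r IH] m D lt.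
  rewrite yc1 /=; case: (ltnP m.+1 D) => mD; last first.
    rewrite big1 => [|d _]; last by rewrite ltn_eqF ?mul0r // (leq_trans (ltn_ord d)).
    by rewrite Vy0 //; lia.
  rewrite (bigD1 (Ordinal mD)) //= eqxx mul1r big1 ?addr0 // => d ne.
  have -> : (d == m.+1 :> nat) = false by apply: contraNF ne => /eqP e; apply/eqP/val_inj.
  by rewrite mul0r.
rewrite ycS /= big_split /=; congr (_ + _).
  rewrite exchange_big; apply: eq_bigr => k _ /=; rewrite -mulr_sumr.
  case: (ltnP M k.+1) => Mk; first by rewrite Vy0 ?mul0r.
  congr (_ * _); have kD : (k.+1 <= D)%N by lia.
  rewrite -(big_mkord predT (fun d => shiftn k.+1 (clc Vx Vy r (m - k.+1)%N) d)).
  rewrite (big_cat_nat (leq0n k.+1) kD) /= big_nat big1 ?add0r => [|d /andP[_ dk]]; last first.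
    by rewrite /shiftn ifF //; lia.
  rewrite -{1}[k.+1]add0n big_addn big_mkord -(IH _ (D - k.+1)%N); last by lia.
  by apply: eq_bigr => d _; rewrite /shiftn leq_addl addnK.
under eq_bigr => d _ do rewrite -(@clc_widen _ Vx Vy r m d _ (leq_addr M d)).
rewrite -[RHS](@big_mkord _ _ _ M predT (fun a => Vx a.+1 * yc r.+1 (m + a).+1)).
rewrite (eq_bigr (fun d : 'I_D => \sum_(a < M) Vx a.+1 * clc Vx Vy r (m + a).+1 d)).
  rewrite exchange_big big_mkord; apply: eq_bigr => a _; rewrite -mulr_sumr IH //.
  by lia.
move=> d _; rewrite [RHS](big_ord_widen (d + M) (fun a => Vx a.+1 * clc Vx Vy r (m + a).+1 d));
  last exact: leq_addl.
rewrite [RHS]big_mkcond; apply: eq_bigr => a _ /=; case: ltnP => // Ma.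
by rewrite Vx0 ?mul0r.
Qed.

Lemma sum_clo r D : (r.+1 * M < D)%N -> \sum_(d < D) clo Vx Vy r d = - whkap vpoly M r.+2.
Proof.
move=> lt; rewrite whkapS opprK.
rewrite (eq_bigr (fun d : 'I_D => \sum_(a < M) Vx a.+1 * clc Vx Vy r a d)).
  by rewrite exchange_big; apply: eq_bigr => a _; rewrite -mulr_sumr sum_clc.
move=> d _; rewrite -(@clo_widen _ Vx Vy r d _ (leq_addr M d)).
rewrite [RHS](big_ord_widen (d + M) (fun a => Vx a.+1 * clc Vx Vy r a d)); last exact: leq_addl.
rewrite [RHS]big_mkcond; apply: eq_bigr => a _ /=; case: ltnP => // Ma.
by rewrite Vx0 ?mul0r.
Qed.

End TruncatedSymbol.

(** * Dependence of the classical jets on finitely many coefficients *)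

Section ClassicalAgree.
Variables (F : comNzRingType) (Vx Vy Wx Wy : nat -> F).

Lemma clc_agree r m d : (forall k, (k <= d)%N -> Vx k = Wx k /\ Vy k = Wy k) ->
  clc Vx Vy r m d = clc Wx Wy r m d.
Proof.
elim: r m d => [|r IH] m d h /=.
  by case: eqP => [e|_]; rewrite ?mul0r // (h m.+1 _).2 // e.
congr (_ + _); apply: eq_bigr => k _.
  rewrite /shiftn; case: ifP => kd; last by rewrite !mulr0.
  by rewrite (h k.+1 kd).2 IH // => k' k'd; apply: h; apply: leq_trans k'd (leq_subr _ _).
by rewrite (h k.+1 _).1 ?IH.
Qed.

Lemma clo_agree r d : (forall k, (k <= d)%N -> Vx k = Wx k /\ Vy k = Wy k) ->
  clo Vx Vy r d = clo Wx Wy r d.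
Proof.
by move=> h; apply: eq_bigr => k _; rewrite (h k.+1 _).1 ?(clc_agree _ _ h).
Qed.

End ClassicalAgree.

(** * Geometric bounds on the classical jets *)

Section ClassicalBound.
Variables (R : realType) (Vx Vy : nat -> R[i]) (A rho : R).
Hypotheses (A1 : 1 <= A) (rho0 : 0 < rho) (rho1 : rho < 1).
Hypothesis Vxle : forall k, nrm (Vx k.+1) <= A * rho ^+ k.+1.
Hypothesis Vyle : forall k, nrm (Vy k.+1) <= A * rho ^+ k.+1.

Let A0 : 0 <= A. Proof. exact: le_trans A1. Qed.

Let pos a c k d : 0 <= A ^+ a * (2 * d.+1%:R) ^+ c * rho ^+ k.
Proof.
have r0 := ltW rho0; apply: mulr_ge0; last exact: exprn_ge0.
by apply: mulr_ge0; apply: exprn_ge0 => //; apply: mulr_ge0.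
Qed.

(** The degree adds up the indices of the factors [Vy k], each bounded by [A * rho ^ k], so
    [rho ^ d] comes out as a factor. A Toeplitz step has at most [2 * d] terms because [m] is below
    [d]. *)
Lemma clc_bound r m d : nrm (clc Vx Vy r m d) <= A ^+ r.+1 * (2 * d.+1%:R) ^+ r * rho ^+ d.
Proof.
elim: r m d => [|r IH] m d.
  rewrite /= expr1 expr0 mulr1; case: eqP => [->|_]; first by rewrite mul1r.
  by rewrite mul0r nrm0 mulr_ge0 // exprn_ge0 // ltW.
case: (ltnP d m.+1) => [lt|md].
  by rewrite clc_supp // nrm0 pos.
pose x := A ^+ r.+2 * (2 * d.+1%:R) ^+ r * rho ^+ d.
have x0 : 0 <= x by apply: pos.
have -> : A ^+ r.+2 * (2 * d.+1%:R) ^+ r.+1 * rho ^+ d = d.+1%:R * x + d.+1%:R * x.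
  by rewrite /x [(2 * _) ^+ r.+1]exprS; ring.
have cst k (y : R) : (k <= d.+1)%N -> \sum_(i < k) x <= d.+1%:R * x.
  by move=> kd; rewrite sumr_const card_ord -[x *+ k]mulr_natl ler_wpM2r // ler_nat.
apply: le_trans (nrmD _ _) _; apply: lerD; apply: le_trans (nrm_sum _ _ _) _.
  apply: le_trans (cst m 0 _); last by lia.
  apply: ler_sum => k _; rewrite /shiftn; case: ifP => kd; last by rewrite mulr0 nrm0.
  rewrite nrmM; apply: le_trans (ler_pM (nrm_ge0 _) (nrm_ge0 _) (Vyle k) (IH _ _)) _.
  have -> : A * rho ^+ k.+1 * (A ^+ r.+1 * (2 * (d - k.+1).+1%:R) ^+ r * rho ^+ (d - k.+1)) =
    A ^+ r.+2 * (2 * (d - k.+1).+1%:R) ^+ r * rho ^+ d.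
    have -> : rho ^+ d = rho ^+ k.+1 * rho ^+ (d - k.+1) by rewrite -exprD subnKC.
    by rewrite [A ^+ r.+2]exprS; ring.
  apply: ler_wpM2r; first by apply: exprn_ge0; exact: ltW.
  apply: ler_wpM2l; first exact: exprn_ge0.
  apply: lerXn2r; rewrite ?nnegrE; [exact: mulr_ge0|exact: mulr_ge0|].
  by apply: ler_wpM2l => //; rewrite ler_nat ltnS leq_subr.
apply: le_trans (cst d 0 _) => //; apply: ler_sum => a _; rewrite nrmM.
apply: le_trans (ler_pM (nrm_ge0 _) (nrm_ge0 _) (Vxle a) (IH _ _)) _.
rewrite /x [A ^+ r.+2]exprS -!mulrA; apply: ler_wpM2l => //.
by apply: ler_piMl; [rewrite mulrA; exact: pos|apply: exprn_ile1; exact: ltW].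
Qed.

Lemma clo_bound r d :
  nrm (clo Vx Vy r d) <= A ^+ r.+2 * 2 ^+ r * d.+1%:R ^+ r.+1 * rho ^+ d.
Proof.
apply: le_trans (nrm_sum _ _ _) _.
pose x := A ^+ r.+2 * (2 * d.+1%:R) ^+ r * rho ^+ d.
have x0 : 0 <= x by apply: pos.
apply: (@le_trans _ _ (\sum_(m < d) x)).
  apply: ler_sum => a _; rewrite nrmM.
  apply: le_trans (ler_pM (nrm_ge0 _) (nrm_ge0 _) (Vxle a) (clc_bound _ _ _)) _.
  rewrite /x [A ^+ r.+2]exprS -!mulrA; apply: ler_wpM2l => //.
  by apply: ler_piMl; [rewrite mulrA; exact: pos|apply: exprn_ile1; exact: ltW].
rewrite sumr_const card_ord -[x *+ d]mulr_natl /x exprMn [d.+1%:R ^+ r.+1]exprS.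
have -> : A ^+ r.+2 * 2 ^+ r * (d.+1%:R * d.+1%:R ^+ r) * rho ^+ d =
   d.+1%:R * (A ^+ r.+2 * (2 ^+ r * d.+1%:R ^+ r) * rho ^+ d) by ring.
by apply: ler_wpM2r; [rewrite -exprMn; exact: pos|rewrite ler_nat].
Qed.

End ClassicalBound.

(** * Geometrically bounded series and Cauchy products *)

Section Series.
Variable R : realType.
Implicit Types (a b u v x k : nat -> R).

(** Bernoulli's inequality bounds one power of [d + 1]; each further power is paid with the square
    root of the geometric factor at hand. *)
Lemma powgeo_bounded (q : R) p : 0 < q -> q < 1 ->
  exists K : R, 0 <= K /\ forall d, d.+1%:R ^+ p * q ^+ d <= K.
Proof.
have base q' : 0 < q' -> q' < 1 -> exists K : R, 0 <= K /\ forall d, d.+1%:R * q' ^+ d <= K.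
  move=> q0 q1; pose dl := q'^-1 - 1.
  have dl0 : 0 < dl by rewrite subr_gt0 invf_gt1.
  exists (1 + dl^-1); split=> [|d]; first by rewrite addr_ge0 // invr_ge0 ltW.
  have bern : 1 + d%:R * dl <= q'^-1 ^+ d.
    elim: d => [|d IH]; first by rewrite mul0r addr0 expr0.
    have Q : q'^-1 = 1 + dl by rewrite /dl addrC subrK.
    have Q0 : 0 <= q'^-1 by rewrite invr_ge0 ltW.
    rewrite exprS; apply: le_trans (ler_wpM2l Q0 IH); rewrite Q -subr_ge0.
    have -> : (1 + dl) * (1 + d%:R * dl) - (1 + d.+1%:R * dl) = d%:R * dl * dl.
      by rewrite -natr1; ring.
    by rewrite !mulr_ge0 // ltW.
  have qd : 0 < q' ^+ d by apply: exprn_gt0.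
  rewrite -ler_pdivlMr // -exprVn; apply: (@le_trans _ _ ((1 + dl^-1) * (1 + d%:R * dl))).
    have dln : dl != 0 by rewrite gt_eqF.
    rewrite -subr_ge0.
    have -> : (1 + dl^-1) * (1 + d%:R * dl) - d.+1%:R = d%:R * dl + dl^-1.
      by rewrite -natr1; field.
    by apply: addr_ge0; [apply: mulr_ge0 => //; exact: ltW | rewrite invr_ge0 ltW].
  by rewrite ler_wpM2l // addr_ge0 // invr_ge0 ltW.
elim: p q => [|p IH] q q0 q1.
  exists 1; split=> // d; rewrite expr0 mul1r exprn_ile1 // ltW //.
pose s := Num.sqrt q.
have s0 : 0 < s by rewrite sqrtr_gt0.
have s1 : s < 1 by rewrite -sqrtr1 ltr_sqrt.
have [K1 [K10 h1]] := base s s0 s1; have [K2 [K20 h2]] := IH s s0 s1.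
exists (K1 * K2); split=> [|d]; first exact: mulr_ge0.
have -> : d.+1%:R ^+ p.+1 * q ^+ d = (d.+1%:R * s ^+ d) * (d.+1%:R ^+ p * s ^+ d).
  rewrite -[q in LHS](sqr_sqrtr (ltW q0)) -/s expr2 exprMn exprS; ring.
by apply: ler_pM; rewrite ?mulr_ge0 ?exprn_ge0 // ltW.
Qed.

Definition geob (s : R) u := exists K : R, 0 <= K /\ forall d, `|u d| <= K * s ^+ d.

Lemma powgeo_geob (q : R) (K : R) p u : 0 < q -> q < 1 -> 0 <= K ->
  (forall d, `|u d| <= K * d.+1%:R ^+ p * q ^+ d) -> geob (Num.sqrt q) u.
Proof.
move=> q0 q1 K0 h; pose s := Num.sqrt q.
have s0 : 0 < s by rewrite sqrtr_gt0.
have s1 : s < 1 by rewrite -sqrtr1 ltr_sqrt.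
have [K1 [K10 h1]] := powgeo_bounded p s0 s1.
exists (K * K1); split=> [|d]; first exact: mulr_ge0.
apply: le_trans (h d) _.
have -> : K * d.+1%:R ^+ p * q ^+ d = K * (d.+1%:R ^+ p * s ^+ d) * s ^+ d.
  rewrite -[q in LHS](sqr_sqrtr (ltW q0)) -/s expr2 exprMn; ring.
apply: ler_wpM2r; first by apply: exprn_ge0; exact: ltW.
exact: ler_wpM2l.
Qed.

Lemma sqrt_lt1 (q : R) : 0 < q -> q < 1 -> 0 < Num.sqrt q < 1.
Proof. by move=> q0 q1; rewrite sqrtr_gt0 q0 -sqrtr1 ltr_sqrt. Qed.

Lemma geob_cvg s u : 0 < s < 1 -> geob s u -> cvgn (series u).
Proof.
move=> /andP[s0 s1] [K [K0 h]]; apply: normed_cvg.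
apply: (@series_le_cvg _ _ (geometric K s)) => [n|n|n|].
- exact: normr_ge0.
- by apply: geometric_ge0 => //; exact: ltW.
- exact: h.
- by apply: is_cvg_geometric_series; rewrite ger0_norm // ltW.
Qed.

Lemma geob_norm_lim s u (K : R) : 0 < s < 1 -> (forall d, `|u d| <= K * s ^+ d) ->
  `|limn (series u)| <= K / (1 - s).
Proof.
move=> /andP[s0 s1] h.
have K0 : 0 <= K by have := h 0%N; rewrite expr0 mulr1; apply: le_trans.
have cu : cvgn (series u) by apply: (@geob_cvg s); [rewrite s0 s1|exists K].
have cn : cvgn (series (fun n => `|u n|)).
  apply: (@geob_cvg s); first by rewrite s0 s1.
  by exists K; split=> // d; rewrite normr_id.
have sl : `|s| < 1 by rewrite ger0_norm // ltW.
apply: (@le_trans _ _ (limn (series (fun n => `|u n|)))).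
  by apply: lim_series_norm.
rewrite -(cvg_lim _ (cvg_geometric_series (a := K) sl)) //.
apply: lim_series_le => //; exact: is_cvg_geometric_series.
Qed.

Lemma geobD s u v : geob s u -> geob s v -> geob s (fun d => u d + v d).
Proof.
move=> [K [K0 h]] [K' [K'0 h']]; exists (K + K'); split=> [|d]; first exact: addr_ge0.
by apply: le_trans (ler_normD _ _) _; rewrite mulrDl; apply: lerD.
Qed.

Lemma geobZ s c u : geob s u -> geob s (fun d => c * u d).
Proof.
move=> [K [K0 h]]; exists (`|c| * K); split=> [|d]; first exact: mulr_ge0.
by rewrite normrM -mulrA ler_wpM2l.
Qed.

Lemma geob_le s u v : (forall d, `|u d| <= `|v d|) -> geob s v -> geob s u.
Proof. by move=> h [K [K0 hK]]; exists K; split=> // d; apply: le_trans (hK d). Qed.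

Lemma series_ord u n : series u n = \sum_(i < n) u i.
Proof. by rewrite seriesEord. Qed.

Lemma series_cauchyp u v n :
  series (cauchyp u v) n = \sum_(i < n) u i * series v (n - i)%N.
Proof.
elim: n => [|n IH]; first by rewrite series_ord !big_ord0.
rewrite seriesSr IH [RHS]big_ord_recr; have -> : (n.+1 - (@ord_max n))%N = 1%N by rewrite subSnn.
have e1 : series v 1 = v 0%N by rewrite series_ord big_ord_recl big_ord0 addr0.
rewrite e1 -[RHS]/(\sum_(i < n) u i * series v (n.+1 - i)%N + u n * v 0%N).
have -> : \sum_(i < n) u i * series v (n.+1 - i)%N
    = \sum_(i < n) u i * series v (n - i)%N + \sum_(i < n) u i * v (n - i)%N.
  rewrite -big_split; apply: eq_bigr => i _.
  by rewrite subSn ?(ltnW (ltn_ord i)) // seriesSr mulrDr.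
by rewrite -addrA; congr (_ + _); rewrite /cauchyp big_ord_recr subnn.
Qed.

(** For nonnegative terms the product of the partial sums of length [n] lies between the partial
    sums of the Cauchy product of lengths [n] and [2 n]. *)
Lemma cauchy_product_pos u v (U W : R) : (forall n, 0 <= u n) -> (forall n, 0 <= v n) ->
  series u @ \oo --> U -> series v @ \oo --> W -> series (cauchyp u v) @ \oo --> U * W.
Proof.
move=> u0 v0 cu cv.
have mv : {homo series v : m n / (m <= n)%N >-> m <= n}.
  by apply/nondecreasing_seqP => n; rewrite seriesSr lerDl.
have mu : {homo series u : m n / (m <= n)%N >-> m <= n}.
  by apply/nondecreasing_seqP => n; rewrite seriesSr lerDl.
have s0 (w : nat -> R) n : (forall n, 0 <= w n) -> 0 <= series w n.
  by move=> w0; rewrite series_ord; apply: sumr_ge0.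
have up n : series (cauchyp u v) n <= series u n * series v n.
  rewrite series_cauchyp [series u n]series_ord mulr_suml; apply: ler_sum => i _.
  by rewrite ler_wpM2l // mv // leq_subr.
have lo n : series u n * series v n <= series (cauchyp u v) n.*2.
  rewrite series_cauchyp [series u n]series_ord mulr_suml.
  rewrite (big_ord_widen n.*2 (fun i => u i * series v n)); last by rewrite -addnn leq_addr.
  rewrite big_mkcond; apply: ler_sum => i _; case: ifP => lt; last first.
    by rewrite mulr_ge0 // s0.
  by apply: ler_wpM2l => //; apply: mv; move: {+}(nat_of_ord i) lt => j lt; rewrite -addnn -addnBA ?leq_addr // ltnW.
have cuv : series u n * series v n @[n --> \oo] --> U * W by apply: cvgM.
have mc : {homo series (cauchyp u v) : m n / (m <= n)%N >-> m <= n}.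
  apply/nondecreasing_seqP => n; rewrite seriesSr lerDl.
  by apply: sumr_ge0 => i _; apply: mulr_ge0.
have bU n : series u n * series v n <= U * W.
  apply: ler_pM; rewrite ?s0 //.
    by rewrite -(cvg_lim _ cu) //; apply: nondecreasing_cvgn_le => //; apply/cvg_ex; exists U.
  by rewrite -(cvg_lim _ cv) //; apply: nondecreasing_cvgn_le => //; apply/cvg_ex; exists W.
have cc : cvgn (series (cauchyp u v)).
  apply: nondecreasing_is_cvgn => //; exists (U * W) => _ [n _ <-].
  exact: le_trans (up n) (bU n).
have : limn (series (cauchyp u v)) = U * W; last by move=> <-.
apply/eqP; rewrite eq_le; apply/andP; split.
  apply: limr_le => //; near=> n; exact: le_trans (up n) (bU n).
rewrite -(cvg_lim _ cuv) //; apply: limr_le; first by apply/cvg_ex; exists (U * W).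
near=> n; apply: le_trans (lo n) _; exact: nondecreasing_cvgn_le.
Unshelve. all: by end_near. Qed.

Lemma conv_lin c u u' v n : cauchyp (fun d => u d + c * u' d) v n = cauchyp u v n + c * cauchyp u' v n.
Proof.
by rewrite /cauchyp mulr_sumr -big_split; apply: eq_bigr => i _; rewrite /= mulrDl mulrA.
Qed.

Lemma convC u v n : cauchyp u v n = cauchyp v u n.
Proof.
rewrite /cauchyp (reindex_inj rev_ord_inj) /=; apply: eq_bigr => i _.
by rewrite mulrC subSS subKn // -ltnS.
Qed.

Lemma posneg u : exists u1 u2 : nat -> R, [/\ forall d, 0 <= u1 d <= `|u d|,
  forall d, 0 <= u2 d <= `|u d| & forall d, u d = u1 d + (-1) * u2 d].
Proof.
exists (fun d => (`|u d| + u d) / 2), (fun d => (`|u d| - u d) / 2); split=> d.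
- by have := ler_norm (u d); have := ler_norm (- u d); rewrite normrN; lra.
- by have := ler_norm (u d); have := ler_norm (- u d); rewrite normrN; lra.
- by lra.
Qed.

Lemma series_lin u u' c (U U' : R) : series u @ \oo --> U -> series u' @ \oo --> U' ->
  series (fun d => u d + c * u' d) @ \oo --> U + c * U'.
Proof.
move=> cu cu'; have -> : series (fun d => u d + c * u' d)
    = (fun n => series u n + c * series u' n).
  by apply/funext => n; rewrite !series_ord big_split /= mulr_sumr.
by apply: cvgD => //; apply: cvgMr.
Qed.

(** The signed factor is split into positive and negative parts. The other factor only has to be
    nonnegative and summable; it will be the expansion of [PiV]. *)
Lemma cauchy_product_half u v (W : R) s : 0 < s < 1 -> geob s u -> (forall n, 0 <= v n) ->
  series v @ \oo --> W -> series (cauchyp u v) @ \oo --> limn (series u) * W.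
Proof.
move=> s01 gu v0 cv; have [u1 [u2 [h1 h2 e]]] := posneg u.
have g1 : geob s u1.
  apply: geob_le gu => d; have /andP[p q] := h1 d; by rewrite ger0_norm.
have g2 : geob s u2.
  apply: geob_le gu => d; have /andP[p q] := h2 d; by rewrite ger0_norm.
have c1 := geob_cvg s01 g1; have c2 := geob_cvg s01 g2.
have eu : u = fun d => u1 d + (-1) * u2 d by apply/funext.
have -> : limn (series u) = limn (series u1) + (-1) * limn (series u2).
  by apply: cvg_lim => //; rewrite eu; apply: series_lin.
have -> : cauchyp u v = fun n => cauchyp u1 v n + (-1) * cauchyp u2 v n.
  by apply/funext => n; rewrite eu conv_lin.
rewrite mulrDl -mulrA; apply: series_lin; apply: cauchy_product_pos => //.
  by move=> n; have /andP[] := h1 n.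
by move=> n; have /andP[] := h2 n.
Qed.

Lemma cauchy_product u v s : 0 < s < 1 -> geob s u -> geob s v ->
  series (cauchyp u v) @ \oo --> limn (series u) * limn (series v).
Proof.
move=> s01 gu gv; have [v1 [v2 [h1 h2 e]]] := posneg v.
have g1 : geob s v1.
  apply: geob_le gv => d; have /andP[p q] := h1 d; by rewrite ger0_norm.
have g2 : geob s v2.
  apply: geob_le gv => d; have /andP[p q] := h2 d; by rewrite ger0_norm.
have c1 := geob_cvg s01 g1; have c2 := geob_cvg s01 g2.
have ev : v = fun d => v1 d + (-1) * v2 d by apply/funext.
have -> : limn (series v) = limn (series v1) + (-1) * limn (series v2).
  by apply: cvg_lim => //; rewrite ev; apply: series_lin.
have -> : cauchyp u v = fun n => cauchyp u v1 n + (-1) * cauchyp u v2 n.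
  by apply/funext => n; rewrite convC ev conv_lin ![cauchyp _ u n]convC.
rewrite mulrDr mulrCA; apply: series_lin; apply: (cauchy_product_half s01) => //.
  by move=> n; have /andP[] := h1 n.
by move=> n; have /andP[] := h2 n.
Qed.

End Series.

(** * Limits of finite sums and products *)

Section CvgBig.
Context {R : realType} {T : Type} {F : set_system T} {FF : Filter F}.
Variables (I : Type) (f : I -> T -> R) (a : I -> R).
Hypothesis fa : forall i, f i x @[x --> F] --> a i.

Lemma cvg_bigsum (r : seq I) : \sum_(i <- r) f i x @[x --> F] --> \sum_(i <- r) a i.
Proof.
elim: r => [|i r IH].
  by rewrite big_nil; under eq_fun do rewrite big_nil; exact: cvg_cst.
by rewrite big_cons; under eq_fun do rewrite big_cons; exact: cvgD.
Qed.

Lemma cvg_bigprod (r : seq I) : \prod_(i <- r) f i x @[x --> F] --> \prod_(i <- r) a i.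
Proof.
elim: r => [|i r IH].
  by rewrite big_nil; under eq_fun do rewrite big_nil; exact: cvg_cst.
by rewrite big_cons; under eq_fun do rewrite big_cons; exact: cvgM.
Qed.

End CvgBig.

(** * The exponential of a power series and its sum *)

Section FormalExp.
Variables (R : realType) (x : nat -> R).

(* Coefficients of the powers of [sum_i x_i t^i], and of its exponential. *)
Fixpoint cpow m : nat -> R := if m is m'.+1 then cauchyp x (cpow m') else fun j => (j == 0%N)%:R.

Definition cexp j : R := \sum_(m < j.+1) cpow m j / m`!%:R.

Lemma coef_cpow m j J : (j < J)%N -> ((\poly_(i < J) x i) ^+ m)`_j = cpow m j.
Proof.
elim: m j => [|m IH] j jJ; first by rewrite expr0 coef1.
rewrite exprS coefM [RHS]/= /cauchyp; apply: eq_bigr => i _.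
rewrite coef_poly IH; last exact: leq_ltn_trans (leq_subr _ _) jJ.
by rewrite ifT //; apply: leq_trans jJ; rewrite ltn_ord.
Qed.

Hypothesis x0 : x 0 = 0.

Lemma cpow_low m j : (j < m)%N -> cpow m j = 0.
Proof.
elim: m j => [//|m IH] j jm /=; apply: big1 => i _.
case: (posnP i) => [->|i0]; first by rewrite x0 mul0r.
rewrite IH ?mulr0 //; have := ltn_ord i; lia.
Qed.

Lemma cexp_widen j J : (j < J)%N -> \sum_(m < J) cpow m j / m`!%:R = cexp j.
Proof.
move=> jJ; rewrite /cexp [RHS](big_ord_widen J (fun m => cpow m j / m`!%:R)) //.
rewrite [RHS]big_mkcond; apply: eq_bigr => m _; case: ltnP => // jm.
by rewrite cpow_low ?mul0r.
Qed.

Lemma cexp0 : cexp 0 = 1.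
Proof. by rewrite /cexp big_ord1 /= divr1. Qed.

(** Coefficients of [E' = x' E] for [E = exp x], obtained from the derivative of each power of the
    truncated series. *)
Lemma cexpS j : j.+1%:R * cexp j.+1 = \sum_(k < j.+1) k.+1%:R * x k.+1 * cexp (j - k).
Proof.
rewrite /cexp mulr_sumr big_ord_recl [cpow _ _]/= mul0r mulr0 add0r.
pose p := \poly_(i < j.+2) x i.
have step (m : 'I_j.+1) : j.+1%:R * (cpow m.+1 j.+1 / (m.+1)`!%:R)
    = \sum_(k < j.+1) k.+1%:R * x k.+1 * (cpow m (j - k) / m`!%:R).
  rewrite -(@coef_cpow _ _ j.+2) // -/p mulrA mulr_natl -coef_deriv deriv_exp.
  rewrite coefMn -[_ *+ m.+1]mulr_natr factS natrM invfM -mulrA [X in _ * X]mulrA.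
  rewrite divff ?pnatr_eq0 // mul1r.
  rewrite coefM mulr_suml; apply: eq_bigr => k _.
  rewrite coef_deriv [p`_k.+1]coef_poly ifT; last by have := ltn_ord k; rewrite ltnS.
  rewrite /p coef_cpow; last first.
    by rewrite ltnS; apply: leq_trans (leq_subr _ _) _.
  by rewrite -[x k.+1 *+ _]mulr_natl mulrA.
rewrite (eq_bigr _ (fun m _ => step m)) exchange_big; apply: eq_bigr => k _.
by rewrite -mulr_sumr (@cexp_widen (j - k) j.+1) // ltnS leq_subr.
Qed.

Hypothesis xge0 : forall k, 0 <= x k.

Lemma cpow_ge0 m j : 0 <= cpow m j.
Proof.
by elim: m j => [|m IH] j /=; rewrite ?ler0n // /cauchyp; apply: sumr_ge0 => i _; apply: mulr_ge0.
Qed.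

Lemma cexp_ge0 j : 0 <= cexp j.
Proof. by apply: sumr_ge0 => m _; rewrite divr_ge0 ?cpow_ge0. Qed.

Variable X : R.
Hypothesis cx : series x @ \oo --> X.

Lemma series_delta0 : series (fun j => (j == 0%N)%:R : R) @ \oo --> (1 : R).
Proof.
apply: cvg_near_cst; exists 1%N => // -[//|n] _.
by rewrite series_ord big_ord_recl big1 ?addr0.
Qed.

Lemma cvg_cpow m : series (cpow m) @ \oo --> X ^+ m.
Proof.
elim: m => [|m IH]; first exact: series_delta0.
by rewrite exprS; apply: cauchy_product_pos => //; exact: cpow_ge0.
Qed.

(** All terms are nonnegative, so [expR X] bounds the partial sums. Conversely, any fixed number of
    terms of the exponential is reached by letting the degree grow first. *)
Lemma cvg_cexp : series cexp @ \oo --> expR X.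
Proof.
have mono (w : nat -> R) : (forall n, 0 <= w n) -> {homo series w : m n / (m <= n)%N >-> m <= n}.
  by move=> w0; apply/nondecreasing_seqP => n; rewrite seriesSr lerDl.
have sE N K : (N <= K)%N -> series cexp N = \sum_(m < K) series (cpow m) N / m`!%:R.
  move=> NK; rewrite series_ord.
  rewrite (eq_bigr (fun j : 'I_N => \sum_(m < K) cpow m j / m`!%:R)); last first.
    by move=> j _; rewrite cexp_widen //; exact: leq_trans NK.
  by rewrite exchange_big; apply: eq_bigr => m _; rewrite -mulr_suml series_ord.
have X0 : 0 <= X.
  rewrite -(cvg_lim _ cx) //; apply: limr_ge; first by apply/cvg_ex; exists X.
  by near=> n; rewrite series_ord; apply: sumr_ge0.
have ce : series (exp_coeff X) @ \oo --> expR X.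
  exact: (is_cvg_series_exp_coeff X).
have ec0 n : 0 <= exp_coeff X n by apply: exp_coeff_ge0.
have up N : series cexp N <= expR X.
  apply: (@le_trans _ _ (series (exp_coeff X) N)); last first.
    rewrite -(cvg_lim _ ce) //; apply: nondecreasing_cvgn_le; first exact: mono.
    by apply/cvg_ex; exists (expR X).
  rewrite (sE _ N) // series_ord; apply: ler_sum => m _; rewrite /exp_coeff /=.
  apply: ler_wpM2r => //; rewrite -(cvg_lim _ (@cvg_cpow m)) //.
  apply: nondecreasing_cvgn_le; first exact: mono (cpow_ge0 m).
  by apply/cvg_ex; exists (X ^+ m); exact: cvg_cpow.
have cc : cvgn (series cexp).
  apply: nondecreasing_is_cvgn; first exact: mono cexp_ge0.
  by exists (expR X) => _ [n _ <-].
have <- : limn (series cexp) = expR X; last by [].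
apply/eqP; rewrite eq_le; apply/andP; split.
  by apply: limr_le => //; near=> n; exact: up.
rewrite -(cvg_lim _ ce) //; apply: limr_le; first by apply/cvg_ex; exists (expR X).
near=> M; rewrite series_ord.
have cM : (fun N => \sum_(m < M) series (cpow m) N / m`!%:R) @ \oo
    --> \sum_(m < M) exp_coeff X m.
  apply: cvg_bigsum => m; apply: cvgMl; exact: cvg_cpow.
rewrite -(cvg_lim _ cM) //; apply: ler_lim => //; first by apply/cvg_ex; eexists; exact: cM.
exists M => // N /= MN; rewrite (sE N N) //.
rewrite (big_ord_widen N (fun m => series (cpow m) N / m`!%:R)) // big_mkcond.
apply: ler_sum => m _; case: ifP => // _; apply: divr_ge0 => //.
by rewrite series_ord; apply: sumr_ge0 => j _; exact: cpow_ge0.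
Unshelve. all: by end_near. Qed.

End FormalExp.

(** * Dominated convergence for series *)

Section DominatedSeries.
Variable R : realType.

Lemma squeeze_norm0 {T : Type} {F : set_system T} {FF : Filter F} (f g : T -> R) :
  (\forall x \near F, `|f x| <= g x) -> g x @[x --> F] --> 0 -> f x @[x --> F] --> 0.
Proof.
move=> fg g0; apply: (squeeze_cvgr (f := fun x => - g x) (h := g)) => //.
  by apply: filterS fg => x; rewrite ler_norml.
by rewrite -oppr0; exact: cvgN.
Qed.

(** The difference lives in degrees above [M]. With [t] the square root of [s], one factor [t ^ M]
    gives the convergence and the remaining [t ^ d] the summability. *)
Lemma series_agree_cvg (u : nat -> nat -> R) (w : nat -> R) s K : 0 < s < 1 ->
  (forall M d, `|u M d| <= K * s ^+ d) -> (forall M d, (d <= M)%N -> u M d = w d) ->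
  limn (series (u M)) @[M --> \oo] --> limn (series w).
Proof.
move=> s01 hu hw; have /andP[s0 s1] := s01; pose t := Num.sqrt s.
have t01 : 0 < t < 1 by exact: sqrt_lt1.
have /andP[t0 t1] := t01.
have K0 : 0 <= K by have := hu 0%N 0%N; rewrite expr0 mulr1; apply: le_trans.
have hwb d : `|w d| <= K * s ^+ d by rewrite -(hw d d).
have cu M : cvgn (series (u M)) by apply: (geob_cvg s01); exists K.
have cw : cvgn (series w) by apply: (geob_cvg s01); exists K.
have zb M d : `|u M d + (-1) * w d| <= (2 * K * t ^+ M) * t ^+ d.
  case: (leqP d M) => dM.
    by rewrite hw // mulN1r subrr normr0 !mulr_ge0 // exprn_ge0 // ltW.
  apply: (@le_trans _ _ (2 * K * s ^+ d)).
    apply: le_trans (ler_normD _ _) _; rewrite mulN1r normrN.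
    by have := lerD (hu M d) (hwb d); rewrite -mulrA; lra.
  rewrite -[s](sqr_sqrtr (ltW s0)) -/t expr2 exprMn mulrA.
  apply: ler_wpM2r; first by rewrite exprn_ge0 // ltW.
  apply: ler_wpM2l; first exact: mulr_ge0.
  by apply: ler_wiXn2l; [exact: ltW|exact: ltW|exact: ltnW].
have lz M : limn (series (fun d => u M d + (-1) * w d))
    = limn (series (u M)) + (-1) * limn (series w).
  by apply: cvg_lim => //; apply: series_lin.
have c0 : (limn (series (u M)) + (-1) * limn (series w)) @[M --> \oo] --> 0.
  apply: (@squeeze_norm0 _ _ _ _ (fun M => 2 * K / (1 - t) * t ^+ M)).
    near=> M; rewrite -lz mulrAC; exact: geob_norm_lim (zb M).
  rewrite -(mulr0 (2 * K / (1 - t))); apply: cvgMr; apply: cvg_expr.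
  by rewrite ger0_norm // ltW.
have -> : (fun M => limn (series (u M)))
   = (fun M => (limn (series (u M)) + (-1) * limn (series w)) + limn (series w)).
  by apply/funext => M; rewrite mulN1r subrK.
by rewrite -[X in _ --> X]add0r; apply: cvgD => //; exact: cvg_cst.
Unshelve. all: by end_near. Qed.

End DominatedSeries.

(** * Newton's identities with real power sums *)

Section ReIm.
Variable R : realType.
Local Notation C := R[i].
Local Notation Re := (@complex.Re R).
Local Notation Im := (@complex.Im R).

Lemma Re_mul (z w : C) : Re (z * w) = Re z * Re w - Im z * Im w.
Proof. by case: z; case: w. Qed.
Lemma Im_mul (z w : C) : Im (z * w) = Re z * Im w + Im z * Re w.
Proof. by case: z => a b; case: w => c d /=; rewrite [a * d + _]addrC addrC. Qed.
Lemma Re_opp (z : C) : Re (- z) = - Re z. Proof. by case: z. Qed.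
Lemma Im_opp (z : C) : Im (- z) = - Im z. Proof. by case: z. Qed.
Lemma Re_nat n : Re n%:R = n%:R.
Proof. by rewrite -(rmorph_nat (real_complex R)). Qed.
Lemma Im_nat n : Im n%:R = 0.
Proof. by rewrite -(rmorph_nat (real_complex R)). Qed.

Lemma Re_newton (e b : nat -> C) (b' : nat -> R) : e 0%N = 1 -> (forall j, b j = (b' j)%:C%C) ->
  newton e b -> (forall l, Im (e l) = 0) /\ newton (fun l => Re (e l)) b'.
Proof.
move=> e0 hb hn.
have im l : Im (e l) = 0.
  have [n nl] := ubnP l; elim: n l nl => // n IH [|l] ln; first by rewrite e0.
  have := congr1 Im (hn l.+1); rewrite /nresid Im_add Im_mul Re_nat Im_nat mul0r addr0 Im_sum.
  rewrite big1 ?addr0 => [/eqP|j _]; first by rewrite mulf_eq0 pnatr_eq0 /= => /eqP.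
  rewrite hb Im_mul /= mul0r addr0 IH ?mulr0 //.
  by rewrite subSS; apply: leq_ltn_trans (leq_subr _ _) _.
split=> // l; have := congr1 Re (hn l); rewrite [Re 0]/=.
rewrite /nresid Re_add Re_mul Re_nat Im_nat mul0r subr0 Re_sum => h; rewrite -[RHS]h; congr (_ + _).
by apply: eq_bigr => j _; rewrite hb Re_mul /= mul0r subr0.
Qed.

End ReIm.

(** * Classical values of the Hamiltonians for an analytic symbol *)

Section ClassicalLimit.
Variables (R : realType) (V : nat -> R[i]) (A rho : R).
Hypotheses (A1 : 1 <= A) (rho0 : 0 < rho) (rho1 : rho < 1).
Hypothesis Vle : forall k, nrm (V k.+1) <= A * rho ^+ k.+1.
Local Notation C := R[i].
Local Notation Re := (@complex.Re R).
Local Notation Im := (@complex.Im R).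
Local Notation cj W := (fun k => (W k)^*%C).

Definition trunc (W : nat -> C) M k : C := if (k <= M)%N then W k else 0.
Definition tpoly M : {poly C} := vpoly (trunc V M) (trunc (cj V) M) M.

(** Summing real parts is enough: the imaginary parts sum to zero by [clo_im]. *)
Definition cO r : R := limn (series (fun d => Re (clo V (cj V) r d))).
(** The coefficients of [1 - sum_r cO r z^(r+2)], the classical counterpart of [eigser] at row 0. *)
Definition ceta l : R := match l with 0 => 1 | 1 => 0 | r.+2 => - cO r end.

Let K r : R := A ^+ r.+2 * 2 ^+ r.
Let K0 r : 0 <= K r.
Proof. by rewrite mulr_ge0 // exprn_ge0 // (le_trans _ A1). Qed.

Let t := Num.sqrt rho.
Let t01 : 0 < t < 1. Proof. exact: sqrt_lt1. Qed.

Let truncle M k : nrm (trunc V M k.+1) <= A * rho ^+ k.+1.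
Proof.
rewrite /trunc; case: ifP => // _; rewrite nrm0 mulr_ge0 ?exprn_ge0 ?ltW //.
exact: lt_le_trans A1.
Qed.

Let trunclec M k : nrm (trunc (cj V) M k.+1) <= A * rho ^+ k.+1.
Proof.
rewrite /trunc; case: ifP => _; first by rewrite nrm_conj.
by rewrite nrm0 mulr_ge0 ?exprn_ge0 ?ltW //; exact: lt_le_trans A1.
Qed.

Lemma clo_geob r : exists2 K', 0 <= K' & forall W W', (forall k, nrm (W k.+1) <= A * rho ^+ k.+1) ->
  (forall k, nrm (W' k.+1) <= A * rho ^+ k.+1) ->
  forall d, nrm (clo W W' r d) <= K' * t ^+ d.
Proof.
pose w d := K r * d.+1%:R ^+ r.+1 * rho ^+ d.
have wb d : `|w d| <= K r * d.+1%:R ^+ r.+1 * rho ^+ d.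
  rewrite ger0_norm //; apply: mulr_ge0; last by rewrite exprn_ge0 // ltW.
  by apply: mulr_ge0; [exact: K0|exact: exprn_ge0].
have [K1 [K10 h1]] := powgeo_geob rho0 rho1 (K0 r) wb.
exists K1 => // W W' hW hW' d.
apply: le_trans (clo_bound A1 rho0 rho1 hW hW' r d) _.
by apply: le_trans (ler_norm _) (h1 d).
Qed.

Variables (beta : nat -> nat -> R) (betai : nat -> R).
Hypothesis hb : forall M j, whb (tpoly M) M j = (beta M j)%:C%C.
Hypothesis hbl : forall j, beta M j @[M --> \oo] --> betai j.

Let eM M l : C := whkap (tpoly M) M l.
Let eMn M : (forall l, Im (eM M l) = 0) /\ newton (fun l => Re (eM M l)) (beta M).
Proof. apply: Re_newton (hb M) _ => //; exact: newton_wh. Qed.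

Let eM_sum M r : forall D, (r.+1 * M < D)%N ->
  \sum_(d < D) clo (trunc V M) (trunc (cj V) M) r d = - eM M r.+2.
Proof.
by move=> D; apply: sum_clo => k Mk; rewrite /trunc leqNgt Mk.
Qed.

Let lim_clo (f : {additive C -> R}) : (forall z, `|f z| <= nrm z) -> forall r,
  (- f (eM M r.+2)) @[M --> \oo] --> limn (series (fun d => f (clo V (cj V) r d))).
Proof.
move=> fle r; have [K' K'0 hK'] := clo_geob r.
have e M : - f (eM M r.+2)
   = limn (series (fun d => f (clo (trunc V M) (trunc (cj V) M) r d))).
  apply/esym/cvg_lim => //; apply: cvg_near_cst; exists (r.+1 * M).+1 => // D /= lt.
  by rewrite series_ord -raddf_sum eM_sum // raddfN.
under eq_fun do rewrite e.
apply: (series_agree_cvg t01 (K := K')) => [M d|M d dM].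
  exact: le_trans (fle _) (hK' _ _ (truncle M) (trunclec M) d).
congr (f _); apply: clo_agree => k kd.
by rewrite /trunc (leq_trans kd dM).
Qed.

Lemma clo_im r : limn (series (fun d => Im (clo V (cj V) r d))) = 0.
Proof.
have h := @lim_clo (GRing.Additive.clone _ _ Im _) (@Im_nrm R) r.
rewrite -(cvg_lim _ h) //; apply: cvg_lim => //.
have -> : (fun M => - Im (eM M r.+2)) = (fun=> 0); last exact: cvg_cst.
by apply/funext => M; rewrite (eMn M).1 oppr0.
Qed.

(** [newton_wh] holds for each truncated symbol. Truncation at [M] does not change degrees up to
    [M], so the identities survive the limit by dominated convergence. *)
Lemma newton_ceta : newton ceta betai.
Proof.
have c l : Re (eM M l) @[M --> \oo] --> ceta l.
  case: l => [|[|r]] /=.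
  - by have -> : (fun M => Re (eM M 0)) = (fun=> 1); [|exact: cvg_cst].
  - have -> : (fun M => Re (eM M 1)) = (fun=> 0); last exact: cvg_cst.
    by apply/funext => M; rewrite /eM /tpoly whkap1.
  - have h := @lim_clo (GRing.Additive.clone _ _ Re _) (@Re_nrm R) r.
    have -> : (fun M => Re (eM M r.+2)) = (fun M => - - Re (eM M r.+2)).
      by apply/funext => M; rewrite opprK.
    exact: cvgN h.
move=> l.
have h : nresid (fun l => Re (eM M l)) (beta M) l @[M --> \oo] --> nresid ceta betai l.
  apply: cvgD; first by apply: cvgMr; exact: c.
  by apply: cvg_bigsum => j; apply: cvgM => //; exact: hbl.
rewrite -(cvg_lim _ h) //; apply: cvg_lim => //.
have -> : (fun M => nresid (fun l => Re (eM M l)) (beta M) l) = (fun=> 0).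
  by apply/funext => M; exact: (eMn M).2.
exact: cvg_cst.
Qed.


Lemma pb_geob K' p : 0 <= K' -> exists2 K2, 0 <= K2 & forall d, pb rho K' p d <= K2 * t ^+ d.
Proof.
move=> K'0; have wb d : `|pb rho K' p d| <= K' * d.+1%:R ^+ p * rho ^+ d.
  by rewrite ger0_norm //; exact: pb_ge0.
have [K1 [K10 h1]] := powgeo_geob rho0 rho1 K'0 wb.
by exists K1 => // d; apply: le_trans (ler_norm _) (h1 d).
Qed.

Lemma jh00 rs d : jh V 0 0 rs [::] d = clos V (cj V) rs d.
Proof. by rewrite /jh jh0 /scl big_nil mul1r /shiftn leq0n subn0. Qed.

Lemma jh_geob a0 b0 rs : exists2 K', 0 <= K' & forall e, 0 < e <= 1 -> forall d,
  nrm (jh V (e * a0)%:C%C (e * (e * b0))%:C%C rs [::] d) <= K' * t ^+ d /\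
  nrm (jh V (e * a0)%:C%C (e * (e * b0))%:C%C rs [::] d - clos V (cj V) rs d) <= e * K' * t ^+ d.
Proof.
have [K1 [p [K10 h]]] := @jh_good R V A rho a0 b0 A1 rho0 rho1 Vle rs 0%N.
have [K2 K20 h2] := pb_geob p K10; exists K2 => // e e01 d.
have [b1 b2] := h [::] d erefl e e01; rewrite jh00 in b2.
split; first exact: le_trans b1 (h2 d).
apply: le_trans b2 _; rewrite -mulrA; apply: ler_wpM2l => //.
by case/andP: e01 => /ltW.
Qed.

Lemma clos_geob rs : exists2 K', 0 <= K' & forall d, nrm (clos V (cj V) rs d) <= K' * t ^+ d.
Proof.
have [K1 K10 h] := jh_geob 0 0 rs; exists (2 * K1); first exact: mulr_ge0.
move=> d; have [|h1 h2] := h 1 _ d; first by rewrite ltr01 lexx.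
move: h1 h2; move: (jh _ _ _ _ _ _) (clos _ _ _ _) => z w h1 h2.
have -> : w = z + - (z - w) by rewrite opprB addrC subrK.
apply: le_trans (nrmD _ _) _; rewrite nrmN.
rewrite [1 * K1]mul1r in h2; apply: le_trans (lerD h1 h2) _.
by rewrite -mulrDl -[K1 in leLHS]mul1r -mulrDl.
Qed.

Let geobRe (u : nat -> C) K' : 0 <= K' -> (forall d, nrm (u d) <= K' * t ^+ d) ->
  geob t (fun d => Re (u d)).
Proof. by move=> K'0 h; exists K'; split=> // d; apply: le_trans (Re_nrm _) (h d). Qed.
Let geobIm (u : nat -> C) K' : 0 <= K' -> (forall d, nrm (u d) <= K' * t ^+ d) ->
  geob t (fun d => Im (u d)).
Proof. by move=> K'0 h; exists K'; split=> // d; apply: le_trans (Im_nrm _) (h d). Qed.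

(** The Cauchy product of complex series is taken in real and imaginary parts; all products with an
    imaginary part sum to zero. *)
Lemma clos_lim rs : limn (series (fun d => Re (clos V (cj V) rs d))) = \prod_(r <- rs) cO r /\
  limn (series (fun d => Im (clos V (cj V) rs d))) = 0.
Proof.
elim: rs => [|r rs [IH1 IH2]].
  rewrite big_nil; split; apply: cvg_lim => //.
    have -> : (fun d => Re (clos V (cj V) [::] d)) = (fun d => (d == 0%N)%:R).
      by apply/funext => d /=; rewrite Re_nat.
    exact: series_delta0.
  have -> : (fun d => Im (clos V (cj V) [::] d)) = (fun d => 0).
    by apply/funext => d /=; rewrite Im_nat.
  have -> : series (fun=> 0 : R) = (fun=> 0); last exact: cvg_cst.
  by apply/funext => n; rewrite series_ord big1.
have [K1 K10 h1] := clos_geob rs.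
have [K2 K20 h2'] := clo_geob r.
have h2 := h2' V (cj V) Vle (fun k => ltac:(by rewrite nrm_conj)).
have p1 := cauchy_product t01 (geobRe K10 h1) (geobRe K20 h2).
have p2 := cauchy_product t01 (geobIm K10 h1) (geobIm K20 h2).
have p3 := cauchy_product t01 (geobRe K10 h1) (geobIm K20 h2).
have p4 := cauchy_product t01 (geobIm K10 h1) (geobRe K20 h2).
rewrite big_cons -IH1 /=; split; apply: cvg_lim => //.
  have -> : (fun d => Re (cauchyp (clos V (cj V) rs) (clo V (cj V) r) d)) =
    (fun d => cauchyp (fun d => Re (clos V (cj V) rs d)) (fun d => Re (clo V (cj V) r d)) d
      + (-1) * cauchyp (fun d => Im (clos V (cj V) rs d)) (fun d => Im (clo V (cj V) r d)) d).
    apply/funext => d; rewrite /cauchyp Re_sum mulN1r -sumrB.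
    by apply: eq_bigr => i _; rewrite Re_mul.
  rewrite -[X in _ --> X]addr0 -(mulr0 (-1)); rewrite IH2 mul0r in p2.
  by apply: series_lin => //; rewrite mulrC.
have -> : (fun d => Im (cauchyp (clos V (cj V) rs) (clo V (cj V) r) d)) =
    (fun d => cauchyp (fun d => Re (clos V (cj V) rs d)) (fun d => Im (clo V (cj V) r d)) d
      + 1 * cauchyp (fun d => Im (clos V (cj V) rs d)) (fun d => Re (clo V (cj V) r d)) d).
  apply/funext => d; rewrite /cauchyp Im_sum mul1r -big_split.
  by apply: eq_bigr => i _; rewrite Im_mul.
rewrite IH2 mul0r in p4; rewrite clo_im mulr0 in p3.
by have := series_lin (c := 1) p3 p4; rewrite [1 * 0]mulr0 addr0; apply.
Qed.

Lemma lim_series_dist (s : R) u v K' : 0 < s < 1 -> geob s u -> geob s v ->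
  (forall d, `|u d - v d| <= K' * s ^+ d) ->
  `|limn (series u) - limn (series v)| <= K' / (1 - s).
Proof.
move=> s01 gu gv h; have cu := geob_cvg s01 gu; have cv := geob_cvg s01 gv.
have := cvg_lim _ (series_lin (c := -1) cu cv); rewrite mulN1r => <- //.
by apply: geob_norm_lim => // d; rewrite mulN1r.
Qed.

Lemma jets_lim a0 b0 rs :
  (forall e, 0 < e <= 1 -> geob t (fun d => Re (jh V (e * a0)%:C%C (e * (e * b0))%:C%C rs [::] d))) /\
  exists2 K', 0 <= K' & forall e, 0 < e <= 1 ->
  `|limn (series (fun d => Re (jh V (e * a0)%:C%C (e * (e * b0))%:C%C rs [::] d)))
    - \prod_(r <- rs) cO r| <= e * K'.
Proof.
have [K1 K10 h1] := jh_geob a0 b0 rs; have [K2 K20 h2] := clos_geob rs.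
have g e (e01 : 0 < e <= 1) := geobRe K10 (fun d => (h1 e e01 d).1).
split=> //; exists (K1 / (1 - t)).
  by apply: divr_ge0 => //; rewrite subr_ge0; case/andP: t01 => _ /ltW.
move=> e e01; rewrite -(clos_lim rs).1 [e * (K1 / _)]mulrA.
have hd (z w : C) (y : R) : nrm (z - w) <= y -> `|Re z - Re w| <= y.
  by move=> le; have := Re_nrm (z - w); rewrite Re_add Re_opp => /le_trans; apply.
exact: (lim_series_dist t01 (g e e01) (geobRe K20 h2) (fun d => hd _ _ _ (h1 e e01 d).2)).
Qed.

End ClassicalLimit.

(** * Averages over the circle *)

Section CircleAverage.
Variable R : realType.
Local Notation mu := (@lebesgue_measure R).
Implicit Types (g h : R -> R).

Definition circle : set R := `[0, 2 * pi]%classic.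
Definition avg g : R := (2 * pi)^-1 * \int[mu]_(x in circle) g x.
Definition bmeas g := measurable_fun setT g /\ exists B, forall x, `|g x| <= B.

Let tp0 : 0 < 2 * pi :> R. Proof. by rewrite mulr_gt0 // pi_gt0. Qed.
Let tpn : 2 * pi != 0 :> R. Proof. by rewrite gt_eqF. Qed.

Lemma measurable_circle : measurable circle.
Proof. exact: measurable_itv. Qed.

Lemma mu_circle : mu circle = (2 * pi)%:E.
Proof. by rewrite /circle lebesgue_measure_itv /= lte_fin tp0 oppr0 adde0. Qed.

Lemma bmeas_int g : bmeas g -> mu.-integrable circle (EFin \o g).
Proof.
move=> [mg [B hB]]; apply: measurable_bounded_integrable.
- exact: measurable_circle.
- by have := ltry (2 * pi : R); rewrite -mu_circle.
- exact: measurable_funTS.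
- exists B; split; first exact: num_real.
  by move=> M /ltW BM x _; exact: le_trans (hB x) BM.
Qed.

Lemma bmeas_cst c : bmeas (fun=> c).
Proof. by split; [exact: measurable_cst|exists `|c|]. Qed.

Lemma bmeasD g h : bmeas g -> bmeas h -> bmeas (fun x => g x + h x).
Proof.
move=> [mg [B hB]] [mh [B' hB']]; split; first exact: measurable_realfun.measurable_funD.
by exists (B + B') => x; apply: le_trans (ler_normD _ _) _; apply: lerD.
Qed.

Lemma bmeasM g h : bmeas g -> bmeas h -> bmeas (fun x => g x * h x).
Proof.
move=> [mg [B hB]] [mh [B' hB']]; split; first exact: measurable_realfun.measurable_funM.
by exists (B * B') => x; rewrite normrM; apply: ler_pM.
Qed.

Lemma bmeasZ c g : bmeas g -> bmeas (fun x => c * g x).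
Proof. exact/bmeasM/bmeas_cst. Qed.

Lemma bmeasB g h : bmeas g -> bmeas h -> bmeas (fun x => g x - h x).
Proof.
move=> bg bh; have := bmeasD bg (bmeasZ (-1) bh).
by under eq_fun do rewrite mulN1r.
Qed.

Lemma bmeasX n g : bmeas g -> bmeas (fun x => g x ^+ n).
Proof.
move=> bg; elim: n => [|n IH]; first exact: bmeas_cst.
by under eq_fun do rewrite exprS; exact: bmeasM.
Qed.

Lemma bmeas_norm g : bmeas g -> bmeas (fun x => `|g x|).
Proof.
move=> [mg [B hB]]; split; first exact: measurableT_comp.
by exists B => x; rewrite normr_id.
Qed.

Lemma bmeas_sum n (G : nat -> R -> R) : (forall k, (k < n)%N -> bmeas (G k)) ->
  bmeas (fun x => \sum_(k < n) G k x).
Proof.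
elim: n => [|n IH] h.
  by under eq_fun do rewrite big_ord0; exact: bmeas_cst.
under eq_fun do rewrite big_ord_recr /=; apply: bmeasD; last exact: h.
by apply: IH => k kn; apply: h; exact: ltnW.
Qed.

Lemma avg_cst c : avg (fun=> c) = c.
Proof.
rewrite /avg Rintegral_cst; last exact: measurable_circle.
by rewrite [fine _](congr1 fine mu_circle) /= mulrC mulfK.
Qed.

Lemma avgD g h : bmeas g -> bmeas h -> avg (fun x => g x + h x) = avg g + avg h.
Proof.
move=> bg bh; rewrite /avg RintegralD ?mulrDr //; first exact: measurable_circle.
  exact: bmeas_int.
exact: bmeas_int.
Qed.

Lemma avgZ c g : bmeas g -> avg (fun x => c * g x) = c * avg g.
Proof.
move=> bg; rewrite /avg RintegralZl; [exact: mulrCA|exact: measurable_circle|].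
exact: bmeas_int.
Qed.

Lemma avgB g h : bmeas g -> bmeas h -> avg (fun x => g x - h x) = avg g - avg h.
Proof.
move=> bg bh; rewrite -[- avg h]mulN1r -avgZ // -avgD //; last exact: bmeasZ.
by under [in RHS]eq_fun do rewrite mulN1r.
Qed.

Lemma avg_sum n (G : nat -> R -> R) : (forall k, (k < n)%N -> bmeas (G k)) ->
  avg (fun x => \sum_(k < n) G k x) = \sum_(k < n) avg (G k).
Proof.
elim: n => [|n IH] h.
  by rewrite big_ord0; under eq_fun do rewrite big_ord0; exact: avg_cst.
rewrite big_ord_recr /= -IH; last by move=> k kn; apply: h; exact: ltnW.
under eq_fun do rewrite big_ord_recr /=; apply: avgD; last exact: h.
by apply: bmeas_sum => k kn; apply: h; exact: ltnW.
Qed.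

Lemma le_avg g h : bmeas g -> bmeas h -> (forall x, g x <= h x) -> avg g <= avg h.
Proof.
move=> bg bh gh; apply: ler_wpM2l; first by rewrite invr_ge0 ltW.
by apply: le_Rintegral => //; [exact: measurable_circle|exact: bmeas_int..].
Qed.

Lemma norm_avg g : bmeas g -> `|avg g| <= avg (fun x => `|g x|).
Proof.
move=> bg; rewrite /avg normrM [`|(2 * pi)^-1|]ger0_norm; last by rewrite invr_ge0 ltW.
apply: ler_wpM2l; first by rewrite invr_ge0 ltW.
by apply: le_normr_Rintegral; [exact: measurable_circle|exact: bmeas_int].
Qed.

Lemma avg_dominated (G : nat -> R -> R) g (B : R) : (forall n, bmeas (G n)) -> bmeas g ->
  (forall n x, `|G n x| <= B) -> (forall x, G n x @[n --> \oo] --> g x) ->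
  avg (G n) @[n --> \oo] --> avg g.
Proof.
move=> bG bg hB hG; apply: cvgMr; rewrite /Rintegral.
have c x : circle x -> (G n x)%:E @[n --> \oo] --> (g x)%:E.
  by move=> _; apply: cvg_EFin; [exact: nearW|exact: hG].
have b x n : circle x -> (`|(G n x)%:E| <= B%:E)%E by move=> _; rewrite lee_fin.
have [||||_ _ h] := @dominated_convergence _ _ R mu circle measurable_circle
  (fun n x => (G n x)%:E) (fun x => (g x)%:E) (fun=> B%:E) (fun n => measurable_int _ (bmeas_int (bG n))).
- exact: measurable_int (bmeas_int bg).
- exact: aeW.
- exact: bmeas_int (bmeas_cst B).
- exact: aeW.
apply: fine_cvg; rewrite fineK //; apply: integrable_fin_num; first exact: measurable_circle.
exact: bmeas_int.
Qed.

End CircleAverage.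

(** * Fourier orthogonality and constant terms of powers of the symbol *)

Section Trig.
Variable R : realType.
Local Notation C := R[i].
Local Notation mu := (@lebesgue_measure R).
Local Notation Re := (@complex.Re R).
Local Notation Im := (@complex.Im R).

Lemma cos_2pi_nat k : cos (k%:R * (2 * pi)) = 1 :> R /\ sin (k%:R * (2 * pi)) = 0 :> R.
Proof.
have e : 2 * pi = pi *+ 2 :> R by rewrite mulr_natl.
elim: k => [|k [IH1 IH2]]; first by rewrite mul0r cos0 sin0.
by rewrite -natr1 mulrDl mul1r cosD sinD IH1 IH2 e cos2pi sin2pi; split; ring.
Qed.

Lemma cos_2pi_diff i n : cos ((i%:R - n%:R) * (2 * pi)) = 1 :> R /\
  sin ((i%:R - n%:R) * (2 * pi)) = 0 :> R.
Proof.
rewrite mulrBl cosB sinB (cos_2pi_nat i).1 (cos_2pi_nat i).2 (cos_2pi_nat n).1 (cos_2pi_nat n).2.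
by split; ring.
Qed.

Lemma continuous_cosM (x : R) : continuous (fun y => cos (x * y)).
Proof.
move=> y; apply: (@continuous_comp _ _ _ ( *%R x) cos); last exact: continuous_cos.
exact: mulrl_continuous.
Qed.

Lemma continuous_sinM (x : R) : continuous (fun y => sin (x * y)).
Proof.
move=> y; apply: (@continuous_comp _ _ _ ( *%R x) sin); last exact: continuous_sin.
exact: mulrl_continuous.
Qed.

Lemma bmeas_cos (x : R) : bmeas (fun y => cos (x * y)).
Proof.
split; last by exists 1 => y; exact: cos_max.
by apply: measurable_realfun.continuous_measurable_fun; exact: continuous_cosM.
Qed.

Lemma bmeas_sin (x : R) : bmeas (fun y => sin (x * y)).
Proof.
split; last by exists 1 => y; exact: sin_max.
by apply: measurable_realfun.continuous_measurable_fun; exact: continuous_sinM.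
Qed.

Lemma FTC_circle (F f : R -> R) : continuous f -> (forall y : R, is_derive y 1 F (f y)) ->
  \int[mu]_(y in @circle R) f y = F (2 * pi) - F 0.
Proof.
move=> cf dF; have tp0 : 0 < 2 * pi :> R by rewrite mulr_gt0 // pi_gt0.
have cF : continuous F.
  by move=> y; apply/differentiable_continuous/derivable1_diffP; have := dF y.
rewrite /Rintegral /circle (@continuous_FTC2 _ f F) //.
- exact: continuous_subspaceT.
- split; first by move=> y _; have := dF y.
    exact/cvg_at_right_filter/cF.
  exact/cvg_at_left_filter/cF.
- by move=> y _; rewrite derive1E; apply: (@derive_val _ _ _ _ _ _ _ (dF y)).
Qed.

Lemma is_derive_sinM (x y : R) : is_derive y 1 (fun y => sin (x * y)) (x * cos (x * y)).
Proof. by apply: is_derive_eq; rewrite /GRing.scale /= mulr1 mulrC. Qed.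

Lemma is_derive_cosM (x y : R) : is_derive y 1 (fun y => - cos (x * y)) (x * sin (x * y)).
Proof. by apply: is_derive_eq; rewrite /GRing.scale /= mulr1 mulNr opprK mulrC. Qed.

Lemma avg_cos i n : avg (fun y => cos ((i%:R - n%:R) * y)) = (i == n)%:R :> R.
Proof.
case: eqVneq => [->|ne].
  by under eq_fun do rewrite subrr mul0r cos0; exact: avg_cst.
set x := i%:R - n%:R; have x0 : x != 0 by rewrite subr_eq0 eqr_nat.
apply: (mulfI x0); rewrite mulr0 -avgZ; last exact: bmeas_cos.
have cf : continuous (fun y => x * cos (x * y)).
  by move=> y; apply: cvgM; [exact: cvg_cst|exact: continuous_cosM].
rewrite /avg (FTC_circle cf (is_derive_sinM x)).
by rewrite (cos_2pi_diff i n).2 mulr0 sin0 subrr mulr0.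
Qed.

Lemma avg_sin i n : avg (fun y => sin ((i%:R - n%:R) * y)) = 0 :> R.
Proof.
case: (eqVneq i n) => [->|ne].
  by under eq_fun do rewrite subrr mul0r sin0; exact: avg_cst.
set x := i%:R - n%:R; have x0 : x != 0 by rewrite subr_eq0 eqr_nat.
apply: (mulfI x0); rewrite mulr0 -avgZ; last exact: bmeas_sin.
have cf : continuous (fun y => x * sin (x * y)).
  by move=> y; apply: cvgM; [exact: cvg_cst|exact: continuous_sinM].
rewrite /avg (FTC_circle cf (is_derive_cosM x)).
by rewrite (cos_2pi_diff i n).1 mulr0 cos0 subrr mulr0.
Qed.

(** The exponential of [- i x y]. The sign is negative because [tpoly] puts the conjugates of the
    [V k] on the positive powers of [w]. *)
Definition cexpN (x y : R) : C := Complex (cos (x * y)) (- sin (x * y)).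

Lemma cexpND x x' y : cexpN (x + x') y = cexpN x y * cexpN x' y.
Proof.
rewrite /cexpN mulrDl cosD sinD; apply/eqP; rewrite eq_complex /=.
by apply/andP; split; apply/eqP; ring.
Qed.

Lemma cexpN0 y : cexpN 0 y = 1.
Proof. by rewrite /cexpN mul0r cos0 sin0 oppr0. Qed.

Lemma cexpN_nat n y : cexpN n%:R y = cexpN 1 y ^+ n.
Proof.
by elim: n => [|n IH]; rewrite ?cexpN0 ?expr0 // -natr1 cexpND IH exprSr.
Qed.

Variable V : nat -> C.
Definition vN N (y : R) : R := \sum_(1 <= k < N)
     2 * (Re (V k) * cos (k%:R * y) - Im (V k) * sin (k%:R * y)).

Lemma bmeas_vN N : bmeas (vN N).
Proof.
rewrite /vN; under eq_fun do rewrite big_add1 big_mkord.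
apply: (bmeas_sum (G := fun k y =>
  2 * (Re (V k.+1) * cos (k.+1%:R * y) - Im (V k.+1) * sin (k.+1%:R * y)))) => k _.
apply: bmeasZ; apply: bmeasB; apply: bmeasZ.
  exact: bmeas_cos.
exact: bmeas_sin.
Qed.

Lemma tpoly_eval M y : (tpoly V M).[cexpN 1 y] = (vN M.+1 y)%:C%C * cexpN M%:R y.
Proof.
rewrite /vN big_add1 /= big_mkord rmorph_sum mulr_suml /tpoly /vpoly horner_sum.
apply: eq_bigr => k _; rewrite hornerD !hornerZ !hornerXn -!cexpN_nat.
rewrite /trunc ltn_ord natrD natrB ?ltn_ord // !cexpND.
have -> : cexpN (- k.+1%:R) y = (cexpN k.+1%:R y)^*%C.
  by rewrite /cexpN mulNr cosN sinN /=.
rewrite mulrCA [V k.+1 * _]mulrCA -mulrDr mulrC; congr (_ * _).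
case: (V k.+1) => a b; rewrite /cexpN /=.
by apply/eqP; rewrite eq_complex /=; apply/andP; split; apply/eqP; ring.
Qed.

(** On the circle [tpoly] is [vN] times a pure exponential of frequency [M]. Averaging its [j]-th
    power against the opposite frequency leaves the coefficient of index [j * M]. *)
Lemma whb_tpoly M j : whb (tpoly V M) M j = (avg (fun y => vN M.+1 y ^+ j))%:C%C.
Proof.
set p := tpoly V M ^+ j; pose n := (j * M)%N.
have e y : (vN M.+1 y ^+ j)%:C%C = \sum_(i < size p) p`_i * cexpN (i%:R - n%:R) y.
  have -> : (vN M.+1 y ^+ j)%:C%C = p.[cexpN 1 y] * cexpN (- n%:R) y.
    rewrite horner_exp tpoly_eval exprMn -rmorphXn -mulrA.
    rewrite [cexpN M%:R y]cexpN_nat -exprM mulnC -/n -cexpN_nat -cexpND subrr cexpN0.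
    by rewrite mulr1.
  rewrite horner_coef mulr_suml; apply: eq_bigr => i _.
  by rewrite -cexpN_nat -mulrA -cexpND.
have bR i : bmeas (fun y => Re (p`_i * cexpN (i%:R - n%:R) y)).
  under eq_fun do rewrite Re_mul /= mulrN opprK.
  by apply: bmeasD; apply: bmeasZ; [exact: bmeas_cos|exact: bmeas_sin].
have bI i : bmeas (fun y => Im (p`_i * cexpN (i%:R - n%:R) y)).
  under eq_fun do rewrite Im_mul /= mulrN -mulNr.
  by apply: bmeasD; apply: bmeasZ; [exact: bmeas_sin|exact: bmeas_cos].
have sel (q : nat -> R) : (forall i, (size p <= i)%N -> q i = 0) ->
    \sum_(i < size p) q i * (i == n :> nat)%:R = q n.
  move=> q0; case: (ltnP n (size p)) => lt.
    rewrite (bigD1 (Ordinal lt)) //= eqxx mulr1 big1 ?addr0 // => i ne.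
    by rewrite (_ : (i == n :> nat) = false) ?mulr0 //; apply/negbTE.
  rewrite q0 // big1 // => i _.
  by rewrite (_ : (i == n :> nat) = false) ?mulr0 // ltn_eqF // (leq_trans _ lt).
have eR : avg (fun y => vN M.+1 y ^+ j) = Re p`_n.
  have -> : (fun y => vN M.+1 y ^+ j)
      = fun y => \sum_(i < size p) Re (p`_i * cexpN (i%:R - n%:R) y).
    by apply/funext => y; rewrite -Re_sum -e.
  rewrite (avg_sum (G := fun i y => Re (p`_i * cexpN (i%:R - n%:R) y))) //.
  rewrite -(sel (fun i => Re p`_i)); last by move=> i le; rewrite nth_default.
  apply: eq_bigr => i _; under eq_fun do rewrite Re_mul /= mulrN opprK.
  rewrite avgD; [|exact: bmeasZ (bmeas_cos _)|exact: bmeasZ (bmeas_sin _)].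
  rewrite (avgZ _ (bmeas_cos _)) (avgZ _ (bmeas_sin _)).
  by rewrite avg_cos avg_sin mulr0 addr0.
have eI : 0 = Im p`_n.
  rewrite -[LHS](avg_cst 0).
  have -> : (fun=> 0 : R) = fun y => \sum_(i < size p) Im (p`_i * cexpN (i%:R - n%:R) y).
    by apply/funext => y; rewrite -Im_sum -e.
  rewrite (avg_sum (G := fun i y => Im (p`_i * cexpN (i%:R - n%:R) y))) //.
  rewrite -(sel (fun i => Im p`_i)); last by move=> i le; rewrite nth_default.
  apply: eq_bigr => i _; under eq_fun do rewrite Im_mul /= mulrN -mulNr.
  rewrite avgD; [|exact: bmeasZ (bmeas_sin _)|exact: bmeasZ (bmeas_cos _)].
  rewrite (avgZ _ (bmeas_sin _)) (avgZ _ (bmeas_cos _)).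
  by rewrite avg_cos avg_sin mulr0 add0r.
rewrite /whb -/p -/n eR; move: eI; case: (p`_n) => a b /= <- //.
Qed.

End Trig.

(** * The symbol as limit of its truncations *)

Section SymbolLimit.
Variables (R : realType) (V : nat -> R[i]) (A rho : R).
Hypotheses (A1 : 1 <= A) (rho0 : 0 < rho) (rho1 : rho < 1).
Hypothesis Vle : forall k, nrm (V k.+1) <= A * rho ^+ k.+1.
Local Notation Re := (@complex.Re R).
Local Notation Im := (@complex.Im R).

Definition drop0 (u : nat -> R) k : R := if k is _.+1 then u k else 0.

Lemma sum1_series (u : nat -> R) : (fun N => \sum_(1 <= k < N) u k) = series (drop0 u).
Proof.
apply/funext => -[|N]; first by rewrite big_geq // series_ord big_ord0.
by rewrite series_ord big_ord_recl /= add0r big_add1 big_mkord.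
Qed.

Let t y k := 2 * (Re (V k) * cos (k%:R * y) - Im (V k) * sin (k%:R * y)).

Let A0 : 0 <= A. Proof. exact: le_trans A1. Qed.

Let tle y k : `|drop0 (t y) k| <= 4 * A * rho ^+ k.
Proof.
case: k => [|k]; first by rewrite normr0 mulr1 mulr_ge0.
have m (a b : R) : `|b| <= 1 -> `|a * b| <= `|a|.
  by move=> b1; rewrite normrM ler_piMr.
rewrite /= normrM ger0_norm // -[4 * A * _]mulrA.
have -> : 4 = 2 * 2 :> R by rewrite -natrM.
rewrite -[2 * 2 * _]mulrA; apply: ler_wpM2l => //.
apply: le_trans (ler_normB _ _) _; rewrite mulrDl !mul1r; apply: lerD.
  by apply: le_trans (m _ _ (cos_max _)) _; apply: le_trans (Re_nrm _) (Vle k).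
by apply: le_trans (m _ _ (sin_max _)) _; apply: le_trans (Im_nrm _) (Vle k).
Qed.

Lemma vN_cvg y : vN V N y @[N --> \oo] --> symbol V y.
Proof.
have e : (fun N => vN V N y) = series (drop0 (t y)) by rewrite -sum1_series.
rewrite /symbol -/(vN V _ y) e; apply: (geob_cvg (s := rho)); first by rewrite rho0.
by exists (4 * A); split=> [|d]; [rewrite mulr_ge0|exact: tle].
Qed.

Definition symbound : R := 4 * A / (1 - rho).

Lemma vN_le N y : `|vN V N y| <= symbound.
Proof.
rewrite -[vN V N y]/((fun N => vN V N y) N) [X in X N]sum1_series series_ord.
apply: le_trans (ler_norm_sum _ _ _) _.
apply: le_trans (@geometric_le_lim R N (4 * A) rho _ rho0 _); last first.
- by rewrite ger0_norm // ltW.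
- by rewrite mulr_ge0.
by rewrite series_ord; apply: ler_sum => k _; exact: tle.
Qed.

Lemma symbol_le y : `|symbol V y| <= symbound.
Proof.
have h : `|vN V N y| @[N --> \oo] --> `|symbol V y| by apply: cvg_norm; exact: vN_cvg.
rewrite -(cvg_lim _ h) //.
apply: limr_le; first by apply/cvg_ex; eexists; exact: h.
by near=> N; exact: vN_le.
Unshelve. all: by end_near. Qed.

Lemma bmeas_symbol : bmeas (symbol V).
Proof.
split; last by exists symbound; exact: symbol_le.
apply: (@measurable_realfun.measurable_fun_cvg _ _ _ _ (vN V)).
  by move=> N; have [] := bmeas_vN V N.
by move=> y _; exact: vN_cvg.
Qed.

Lemma avg_vNX j : avg (fun y => vN V M.+1 y ^+ j) @[M --> \oo] --> avg (fun y => symbol V y ^+ j).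
Proof.
apply: (avg_dominated (B := symbound ^+ j)).
- by move=> n; apply: bmeasX; exact: bmeas_vN.
- by apply: bmeasX; exact: bmeas_symbol.
- by move=> n y; rewrite normrX lerXn2r ?nnegrE ?vN_le // (le_trans _ (vN_le 0 0)).
- move=> y; have h := @vN_cvg y; rewrite -(cvg_shiftS (fun N => vN V N y)) in h.
  exact: (cvg_comp _ _ h (@exprn_continuous _ j _)).
Qed.

Lemma newton_symbol : newton (ceta V) (fun j => avg (fun y => symbol V y ^+ j)).
Proof.
apply: (newton_ceta A1 rho0 rho1 Vle (beta := fun M j => avg (fun y => vN V M.+1 y ^+ j))).
  by move=> M j; exact: whb_tpoly.
by move=> j; exact: avg_vNX.
Qed.

End SymbolLimit.

(** * Moments of the functions |c - z| *)

Section AbsMoments.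
Variable R : realType.
Local Notation mu := (@lebesgue_measure R).

Lemma continuous_integrable_itv (f : R -> R) a b : continuous f ->
  mu.-integrable `[a, b] (EFin \o f).
Proof.
move=> cf; apply: continuous_compact_integrable; first exact: segment_compact.
exact: continuous_subspaceT.
Qed.

Lemma FTC_itv (F f : R -> R) a b : a <= b -> continuous f ->
  (forall y : R, is_derive y 1 F (f y)) -> \int[mu]_(y in `[a, b]) f y = F b - F a.
Proof.
rewrite le_eqVlt => /predU1P[->|ab] cf dF.
  by rewrite set_itv1 Rintegral_set1 subrr.
have cF : continuous F.
  by move=> y; apply/differentiable_continuous/derivable1_diffP; have := dF y.
rewrite /Rintegral (@continuous_FTC2 _ f F) //.
- exact: continuous_subspaceT.
- split; first by move=> y _; have := dF y.
    exact/cvg_at_right_filter/cF.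
  exact/cvg_at_left_filter/cF.
- by move=> y _; rewrite derive1E; apply: (@derive_val _ _ _ _ _ _ _ (dF y)).
Qed.

Lemma Rintegral_split (f : R -> R) a z b : a <= z -> z <= b -> continuous f ->
  \int[mu]_(y in `[a, b]) f y = \int[mu]_(y in `[a, z]) f y + \int[mu]_(y in `[z, b]) f y.
Proof.
move=> az zb cf; have h := continuous_integrable_itv a b cf.
have := @Rintegral_itvB R f (BLeft a) (BRight b) z h; rewrite !bnd_simp => /(_ az zb) e.
apply/eqP; rewrite addrC -subr_eq e; apply/eqP; apply: Rintegral_itv_obnd_cbnd.
apply: integrableS (continuous_integrable_itv z b cf) => //.
exact: subset_itv_oc_cc.
Qed.

(** The second derivative of [c ^+ l]; the numerical factor is zero for [l <= 1], where the
    truncated exponent would be wrong. *)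
Definition kern l (c : R) : R := (l * l.-1)%:R * c ^+ (l - 2).

Lemma continuous_kern l : continuous (kern l).
Proof. by move=> c; apply: cvgM; [exact: cvg_cst|exact: exprn_continuous]. Qed.

(** A primitive of [kern l c * (c - z)] in [c]. It is affine in [z], which is why boundary terms
    drop out later. *)
Definition kernF l (z c : R) : R := l%:R * c ^+ l.-1 * (c - z) - c ^+ l.

Lemma is_derive_kernF l (z c : R) : is_derive c 1 (kernF l z) (kern l c * (c - z)).
Proof.
have dX n : is_derive c 1 (fun y : R => y ^+ n) (n%:R * c ^+ n.-1).
  by apply: DeriveDef; [exact: exprn_derivable|rewrite exp_derive /GRing.scale /= mulr1].
have d1 : is_derive c 1 (fun y : R => y - z) 1.
  by apply: is_derive_eq (is_deriveB (is_derive_id c 1) (is_derive_cst z c 1)) _; rewrite subr0.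
have := is_deriveB (is_deriveM (is_deriveZ l%:R (dX l.-1)) d1) (dX l).
move=> h; apply: is_derive_eq h _; rewrite /kern /GRing.scale /= -subn2 natrM.
by rewrite mulr1 -[_ *: _]/(l%:R * c ^+ l.-1); ring.
Qed.

(** Two integrations by parts: the second derivative of [|c - z|] is twice the unit mass at [z], and
    the [kernF] terms are the boundary contributions. *)
Lemma int_kern l B z : `|z| <= B ->
  \int[mu]_(c in `[- B, B]) (kern l c * `|c - z|) = 2 * z ^+ l + kernF l z B + kernF l z (- B).
Proof.
rewrite ler_norml => /andP[Bz zB].
have c1 : continuous (fun c => kern l c * (c - z)).
  move=> c; apply: cvgM; first exact: continuous_kern.
  by apply: cvgB; [exact: cvg_id|exact: cvg_cst].
have c2 : continuous (fun c => kern l c * `|c - z|).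
  move=> c; apply: cvgM; first exact: continuous_kern.
  by apply: cvg_norm; apply: cvgB; [exact: cvg_id|exact: cvg_cst].
rewrite (Rintegral_split Bz zB c2).
have -> : \int[mu]_(c in `[- B, z]) (kern l c * `|c - z|)
   = - (\int[mu]_(c in `[- B, z]) (kern l c * (c - z))).
  have := @RintegralZl _ _ R mu _ (fun c => kern l c * (c - z)) (-1) (measurable_itv `[- B, z])
    (continuous_integrable_itv (- B) z c1).
  rewrite mulN1r => <-; apply: eq_Rintegral => c; rewrite inE /= in_itv /= => /andP[_ cz].
  by rewrite ler0_norm ?subr_le0 // mulN1r mulrN.
have -> : \int[mu]_(c in `[z, B]) (kern l c * `|c - z|)
   = \int[mu]_(c in `[z, B]) (kern l c * (c - z)).
  apply: eq_Rintegral => c; rewrite inE /= in_itv /= => /andP[zc _].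
  by rewrite ger0_norm ?subr_ge0.
rewrite !(FTC_itv _ c1 (is_derive_kernF l z)) //.
by rewrite /kernF subrr mulr0 sub0r; ring.
Qed.

End AbsMoments.

(** * Linear statistics of combinations of |c - z| *)

Section AbsSums.
Variable R : realType.
Local Notation mu := (@lebesgue_measure R).
Implicit Types (zs : seq (R * R)).

Definition absum zs (c : R) : R := \sum_(p <- zs) p.1 * `|c - p.2|.

Lemma continuous_absB (z : R) : continuous (fun c : R => `|c - z|).
Proof.
by move=> c; apply: cvg_norm; apply: cvgB; [exact: cvg_id|exact: cvg_cst].
Qed.

Lemma continuous_absum zs : continuous (absum zs).
Proof.
move=> c; apply: cvg_bigsum => p; apply: cvgM; first exact: cvg_cst.
exact: continuous_absB.
Qed.

Lemma continuous_kernM l (g : R -> R) : continuous g -> continuous (fun c => kern l c * g c).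
Proof. by move=> cg c; apply: cvgM; [exact: continuous_kern|exact: cg]. Qed.

Lemma int_kernB l B (f g : R -> R) : continuous f -> continuous g ->
  \int[mu]_(c in `[- B, B]) (kern l c * (f c - g c))
  = \int[mu]_(c in `[- B, B]) (kern l c * f c) - \int[mu]_(c in `[- B, B]) (kern l c * g c).
Proof.
move=> cf cg; under eq_Rintegral do rewrite mulrBr.
apply: (@RintegralB _ _ R mu); first exact: measurable_itv.
  exact/continuous_integrable_itv/continuous_kernM.
exact/continuous_integrable_itv/continuous_kernM.
Qed.

Lemma int_kern_absum l B zs : (forall p, p \in zs -> `|p.2| <= B) ->
  \int[mu]_(c in `[- B, B]) (kern l c * absum zs c)
  = \sum_(p <- zs) p.1 * (2 * p.2 ^+ l + kernF l p.2 B + kernF l p.2 (- B)).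
Proof.
elim: zs => [|p zs IH] h.
  rewrite big_nil; under eq_Rintegral do rewrite /absum big_nil mulr0.
  by rewrite Rintegral_cst ?mul0r //; exact: measurable_itv.
rewrite big_cons -IH => [|q qz]; last by apply: h; rewrite inE qz orbT.
rewrite -int_kern; last by apply: h; rewrite inE eqxx.
under eq_Rintegral do rewrite /absum big_cons mulrDr mulrCA.
have i1 := continuous_integrable_itv (- B) B (@continuous_kernM l _ (@continuous_absB p.2)).
rewrite -(@RintegralZl _ _ R mu _ _ p.1 (measurable_itv `[- B, B]) i1).
apply: (@RintegralD _ _ R mu); first exact: measurable_itv.
  apply: continuous_integrable_itv => c; apply: cvgM; first exact: cvg_cst.
  exact/continuous_kernM/continuous_absB.
exact/continuous_integrable_itv/continuous_kernM/continuous_absum.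
Qed.

Lemma ch_compact l (f : R -> R) B : continuous f -> (forall c, B < `|c| -> f c = `|c|) ->
  ch l f = 0 ^+ l + 2^-1 * \int[mu]_(c in `[- B, B]) (kern l c * (f c - `|c|)).
Proof.
move=> cf hf; rewrite /ch; congr (_ + _); rewrite [_ / 2]mulrC -mulrA; congr (_ * _).
have cfB : continuous (fun c : R => f c - `|c|).
  by move=> c; apply: cvgB; [exact: cf|apply: cvg_norm; exact: cvg_id].
pose h c := c ^+ (l - 2) * (f c - `|c|).
have -> : \int[mu]_c h c = \int[mu]_(c in `[- B, B]) h c.
  rewrite [RHS]Rintegral_mkcond; congr (Rintegral _ _ _); apply/funext => c.
  rewrite patchE; case: ifPn => //; rewrite notin_setE /= in_itv /= => /negP.
  by rewrite -ler_norml -ltNge => cB; rewrite /h hf // subrr mulr0.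
rewrite -(@RintegralZl _ _ R mu _ h (l * l.-1)%:R (measurable_itv `[- B, B])).
  by apply: eq_Rintegral => c _; rewrite /kern /h mulrA.
apply: continuous_integrable_itv => c; apply: cvgM; last exact: cfB.
exact: exprn_continuous.
Qed.

Lemma kernF_lin l (z B : R) : kernF l z B = kernF l 0 B - (l%:R * B ^+ l.-1) * z.
Proof. by rewrite /kernF; ring. Qed.

(** Total weight one and mean zero make the combination equal to [|c|] far out and its boundary
    terms equal to those of [|c|], since [kernF] is affine in [z]. *)
Lemma ch_absum l zs : \sum_(p <- zs) p.1 = 1 -> \sum_(p <- zs) p.1 * p.2 = 0 ->
  ch l (absum zs) = \sum_(p <- zs) p.1 * p.2 ^+ l.
Proof.
move=> s1 s0; pose B := \sum_(p <- zs) `|p.2|.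
have B0 : 0 <= B by apply: sumr_ge0.
have zB p : p \in zs -> `|p.2| <= B.
  by move=> pz; rewrite /B (big_rem p) //= lerDl; apply: sumr_ge0.
have out c : B < `|c| -> absum zs c = `|c|.
  move=> Bc; have [c0|c0] := leP 0 c.
    rewrite ger0_norm // in Bc *; rewrite -[RHS]subr0 -s0 -[c in RHS]mul1r -s1 mulr_suml -sumrB.
    apply: eq_big_seq => p /zB pB; rewrite ger0_norm ?mulrBr // subr_ge0.
    exact: le_trans (ler_norm _) (le_trans pB (ltW Bc)).
  rewrite ltr0_norm // in Bc *.
  rewrite -[RHS]add0r -s0 -[- c]mul1r -s1 mulr_suml -big_split.
  apply: eq_big_seq => p /zB pB /=; rewrite ler0_norm ?opprB ?mulrBr ?mulrN // subr_le0.
  by rewrite -lerN2; apply: le_trans (le_trans pB (ltW Bc)); rewrite -normrN ler_norm.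
rewrite (ch_compact _ (@continuous_absum zs) out).
have -> : \int[mu]_(c in `[- B, B]) (kern l c * (absum zs c - `|c|)) =
    \int[mu]_(c in `[- B, B]) (kern l c * (absum zs c - `|c - 0|)).
  by apply: eq_Rintegral => c _; rewrite subr0.
rewrite int_kernB; [|exact: continuous_absum|exact: continuous_absB].
rewrite int_kern_absum // int_kern ?normr0 //.
have lin b : \sum_(p <- zs) p.1 * kernF l p.2 b = kernF l 0 b.
  have -> : kernF l 0 b = \sum_(p <- zs) (p.1 * kernF l 0 b - (l%:R * b ^+ l.-1) * (p.1 * p.2)).
    by rewrite sumrB -mulr_suml -mulr_sumr s1 s0 mulr0 mul1r subr0.
  by apply: eq_bigr => p _; rewrite kernF_lin; ring.
have -> : \sum_(p <- zs) p.1 * (2 * p.2 ^+ l + kernF l p.2 B + kernF l p.2 (- B))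
  = 2 * \sum_(p <- zs) p.1 * p.2 ^+ l + kernF l 0 B + kernF l 0 (- B).
  rewrite -!lin mulr_sumr -!big_split; apply: eq_bigr => p _ /=; ring.
by field.
Qed.

End AbsSums.

(** * An explicit formula for the profile of a diagram *)

Section ProfileFormula.
Variables (R : realType) (e1 b : R) (lam : nat -> nat) (N : nat).
Hypotheses (e10 : 0 < e1) (b0 : 0 < b).
Hypothesis lamS : forall i j, (i <= j)%N -> (lam j <= lam i)%N.

(* [(crossing c k) / b] is the length, in row [k], of the part of the antidiagonal ray
   [w e1 - u b = c] that stays below the end [w = lam k] of the row. *)
Definition crossing (c : R) k : R :=
  Num.min (Num.max ((lam k)%:R * e1 - c - k%:R * b) 0) b.

Let crossing_ge0 c k : 0 <= crossing c k.
Proof. by rewrite le_min le_max lexx orbT ltW. Qed.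

Let crossing_le c k : crossing c k <= b.
Proof. by rewrite ge_min lexx orbT. Qed.

Let crossing_full c k : b <= (lam k)%:R * e1 - c - k%:R * b -> crossing c k = b.
Proof. by move=> h; rewrite /crossing min_r // le_max h. Qed.

Let crossing_lb c k y : y <= b -> y <= (lam k)%:R * e1 - c - k%:R * b -> y <= crossing c k.
Proof. by move=> yb yx; rewrite le_min yb le_max yx. Qed.

Let crossing_ub c k : 0 < crossing c k -> crossing c k <= (lam k)%:R * e1 - c - k%:R * b.
Proof.
rewrite /crossing; set x := _ - _ - _ => h; rewrite ge_min; apply/orP; left.
have [//|x0] := leP 0 x.
by move: h; rewrite (max_r (ltW x0)) lt_min ltxx.
Qed.

Let lam_ge0 k : 0 <= (lam k)%:R * e1. Proof. by rewrite mulr_ge0 // ltW. Qed.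

Let lam_mono i j : (i <= j)%N -> (lam j)%:R * e1 <= (lam i)%:R * e1.
Proof. by move=> ij; rewrite ler_wpM2r ?ler_nat ?lamS // ltW. Qed.

Let nat_mono i j : (i < j)%N -> i%:R * b + b <= j%:R * b.
Proof. by move=> ij; rewrite -[X in _ + X]mul1r -mulrDl natr1 ler_wpM2r ?ler_nat // ltW. Qed.

Let sum_full c m : (forall k, (k < m)%N -> b <= (lam k)%:R * e1 - c - k%:R * b) ->
  \sum_(k < m) crossing c k = m%:R * b.
Proof.
move=> h; rewrite (eq_bigr (fun=> b)) => [|k _]; last exact: crossing_full (h k (ltn_ord k)).
by rewrite sumr_const card_ord mulr_natl.
Qed.

Let sum_ge0 c m : 0 <= \sum_(k < m) crossing c k.
Proof. exact: sumr_ge0. Qed.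

Let sum_le c i : (i < N)%N -> \sum_(k < i) crossing c k + crossing c i <= \sum_(k < N) crossing c k.
Proof.
move=> iN.
have -> : \sum_(k < i) crossing c k + crossing c i = \sum_(k < i.+1) crossing c k.
  by rewrite big_ord_recr.
rewrite (big_ord_widen N (crossing c)) // big_mkcond; apply: ler_sum => k _.
by case: ifP.
Qed.

(** Above the abscissa [c = w e1 - u b] the height is [w e1 + u b = c + 2 u b], and [u b] is
    collected row by row through [crossing]. The absolute value term is [c] for [c >= - (N%:R * b)]
    and corrects the abscissas to the left of the [N] rows. *)
Definition gprof c : R := `|c + N%:R * b| - N%:R * b + 2 * \sum_(k < N) crossing c k.

Lemma gprof_left c : c < - (N%:R * b) -> gprof c = `|c|.
Proof.
move=> cN; have Nb : 0 <= N%:R * b by rewrite mulr_ge0 // ltW.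
have c0 : c < 0 by lra.
rewrite /gprof sum_full => [|k kN]; last first.
  by have := nat_mono kN; have := lam_ge0 k; move: cN; lra.
rewrite [`|c|]ltr0_norm // ltr0_norm; last by move: cN; lra.
by lra.
Qed.

Lemma gprof_right c : - (N%:R * b) <= c -> gprof c = c + 2 * \sum_(k < N) crossing c k.
Proof.
by move=> cN; rewrite /gprof ger0_norm ?addrK // -[N%:R * b]opprK subr_ge0.
Qed.

Let sum_lb c m : Num.min (- c) (m%:R * b) <= \sum_(k < m) crossing c k.
Proof.
elim: m => [|m IH]; first by rewrite mul0r big_ord0 ge_min lexx orbT.
rewrite big_ord_recr /=; have x0 := lam_ge0 m.
have mb : m.+1%:R * b = m%:R * b + b by rewrite -natr1 mulrDl mul1r.
have t0 := crossing_ge0 c m.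
have [h|h] := leP (- c) (m%:R * b).
  rewrite (min_l h) in IH; rewrite ge_min; apply/orP; left; move: IH t0; lra.
rewrite (min_r (ltW h)) in IH.
have [h'|h'] := leP (- c) (m.+1%:R * b).
  have : - c - m%:R * b <= crossing c m.
    by apply: crossing_lb; [move: mb h'; lra|move: x0; lra].
  by move: IH; lra.
rewrite crossing_full; first by rewrite mb; move: IH; lra.
by move: mb h' x0; lra.
Qed.

Lemma norm_le_gprof c : `|c| <= gprof c.
Proof.
have [cN|cN] := ltP c (- (N%:R * b)); first by rewrite gprof_left.
rewrite gprof_right //; have s0 := sum_ge0 c N; have [c0|c0] := leP 0 c.
  by rewrite ger0_norm //; move: s0; lra.
have := sum_lb c N; rewrite min_l; last by rewrite lerNl.
by rewrite ltr0_norm //; lra.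
Qed.

Lemma box_le_gprof c u w i : (i < N)%N -> i%:R <= u -> u <= i.+1%:R -> 0 <= w ->
  w <= (lam i)%:R -> c = - (u * b) + w * e1 -> u * b + w * e1 <= gprof c.
Proof.
move=> iN iu ui w0 wl ec.
have we0 : 0 <= w * e1 by rewrite mulr_ge0 // ltW.
have wle : w * e1 <= (lam i)%:R * e1 by rewrite ler_wpM2r // ltW.
have iub : i%:R * b <= u * b by rewrite ler_wpM2r // ltW.
have uib : u * b <= i%:R * b + b.
  by rewrite -[X in _ + X]mul1r -mulrDl natr1 ler_wpM2r // ltW.
have uN : u * b <= N%:R * b.
  by apply: le_trans uib _; exact: nat_mono.
rewrite gprof_right; last by rewrite ec lerNl opprD opprK; move: uN we0; lra.
have s := sum_le c iN.
rewrite sum_full in s; last first.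
  move=> k ki; have := lam_mono (ltnW ki); have := nat_mono ki.
  by rewrite ec; move: wle iub; lra.
have t : u * b - i%:R * b <= crossing c i.
  by apply: crossing_lb; rewrite ?ec; move: uib wle; lra.
by rewrite ec in s t *; move: s t; lra.
Qed.

Lemma gprof_attained c : gprof c = `|c| \/ exists i u w,
  [/\ (i < N)%N, i%:R <= u <= i.+1%:R, 0 <= w <= (lam i)%:R, (0 < lam i)%N &
   c = - (u * b) + w * e1 /\ gprof c = u * b + w * e1].
Proof.
have [cN|cN] := ltP c (- (N%:R * b)); first by left; rewrite gprof_left.
have nl := norm_le_gprof c; have cc := ler_norm c; have cc' := ler_norm (- c).
rewrite normrN in cc'.
case: (pselect (exists i, (i < N)%N && (0 < crossing c i))) => [ex|nex]; last first.
  left; apply/eqP; rewrite eq_le nl andbT gprof_right // big1 => [|k _].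
    by rewrite mulr0 addr0.
  apply/eqP; rewrite eq_le crossing_ge0 andbT leNgt; apply/negP => h; apply: nex.
  by exists k; rewrite ltn_ord.
have bd i : (i < N)%N && (0 < crossing c i) -> (i <= N)%N by move=> /andP[/ltnW].
(* The top point lies in the last row with a positive crossing: the rows above it are crossed
   completely, the rows below it not at all. *)
case: (ex_maxnP ex bd) => i /andP[iN ti] mx.
have tx := crossing_ub ti; have tb := crossing_le c i.
have s : \sum_(k < N) crossing c k = i%:R * b + crossing c i.
  have <- : \sum_(k < i) crossing c k = i%:R * b.
    apply: sum_full => k ki; have := lam_mono (ltnW ki); have := nat_mono ki.
    by move: tx ti; lra.
  have -> : \sum_(k < i) crossing c k + crossing c i = \sum_(k < i.+1) crossing c k.
    by rewrite big_ord_recr.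
  rewrite [RHS](big_ord_widen N (crossing c)) // [RHS]big_mkcond; apply: eq_bigr => k _.
  case: ltnP => // ik; apply/eqP; rewrite eq_le crossing_ge0 andbT leNgt; apply/negP => h.
  by have := mx k; rewrite ltn_ord h => /(_ isT); rewrite leqNgt ik.
pose ub := i%:R * b + crossing c i.
have eg : gprof c = c + 2 * ub by rewrite gprof_right // s.
have [h|h] := leP (c + ub) 0.
  by left; apply/eqP; rewrite eq_le nl andbT eg; move: h cc'; lra.
right; exists i, (ub / b), ((c + ub) / e1).
have e1n : e1 != 0 by rewrite gt_eqF.
have bn : b != 0 by rewrite gt_eqF.
have cl : c + ub <= (lam i)%:R * e1 by rewrite /ub; move: tx; lra.
split=> //.
- rewrite ler_pdivlMr // ler_pdivrMr // -natr1 mulrDl mul1r /ub.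
  by rewrite lerDl crossing_ge0 lerD2l.
- by apply/andP; split; [apply: divr_ge0; exact: ltW|rewrite ler_pdivrMr].
- rewrite lt0n; apply/negP => /eqP l0; move: cl h; rewrite l0 mul0r; lra.
- by rewrite !divfK // eg; split; ring.
Qed.

End ProfileFormula.

(** * Linear statistics of the profile of a partition *)

Section ProfileMoments.
Variables (R : realType) (e1 b : R) (n : nat) (la : partn n).
Hypotheses (e10 : 0 < e1) (b0 : 0 < b).
Let lam := nth 0%N (pad la).

Let lamS i j : (i <= j)%N -> (lam j <= lam i)%N.
Proof.
move=> ij; case: (ltnP j (size (pad la))) => js; last by rewrite /lam nth_default.
have geqT : transitive geq by move=> x y z /= h1 h2; exact: leq_trans h2 h1.
have h := sorted_leq_nth geqT leqnn 0%N (pad_sorted la).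
by apply: h; rewrite ?inE //; exact: leq_ltn_trans js.
Qed.

Let split_real (w : R) m : 0 <= w -> w <= m%:R -> (0 < m)%N ->
  exists j t, [/\ (j < m)%N, 0 <= t <= 1 & w = j%:R + t].
Proof.
move=> w0; elim: m => [//|m IH] wm _; case: (leP m%:R w) => mw.
  exists m, (w - m%:R); split=> //; last by rewrite addrC subrK.
  by rewrite subr_ge0 mw lerBlDr addrC natr1.
have m0 : (0 < m)%N by rewrite -(ltr_nat R); exact: le_lt_trans mw.
by have [j [t [jm t01 ->]]] := IH (ltW mw) m0; exists j, t; split=> //; apply: ltnW.
Qed.

Lemma profileE c : profile (- b) e1 la c = gprof e1 b lam n c.
Proof.
rewrite /profile; set S := (X in sup X).
have ub y : S y -> y <= gprof e1 b lam n c.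
  move=> [->|[i [j [s [t [il jl /andP[s0 s1] /andP[t0 t1] [ec ->]]]]]]].
    exact: norm_le_gprof.
  rewrite mulrN opprK; apply: (box_le_gprof e10 b0 lamS (i := i)).
  - exact: leq_trans (size_parts la).
  - by rewrite lerDl.
  - by rewrite -natr1 lerD2l.
  - exact: addr_ge0.
  - rewrite nth_parts in jl; apply: (@le_trans _ _ j.+1%:R); last by rewrite ler_nat.
    by rewrite -natr1 lerD2l.
  - by rewrite ec mulrN.
have Sg : S (gprof e1 b lam n c).
  case: (gprof_attained n e10 b0 lamS c) => [->|[i [u [w [iN]]]]]; first by left.
  move=> /andP[iu ui] /andP[w0 wl] l0 [ec ->]; right.
  have [j [t [jl t01 ew]]] := split_real w0 wl l0.
  exists i, j, (u - i%:R), t; rewrite nth_parts; split=> //.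
  - rewrite ltnNge; apply/negP => h; move: l0.
    by rewrite /lam -nth_parts nth_default.
  - by rewrite subr_ge0 iu lerBlDr addrC natr1.
  - have -> : i%:R + (u - i%:R) = u by rewrite addrC subrK.
    by rewrite mulrN opprK -ew.
apply/eqP; rewrite eq_le; apply/andP; split.
  by apply: ge_sup; [exists (gprof e1 b lam n c)|move=> y /ub].
apply: ub_le_sup => //; exists (gprof e1 b lam n c) => y; exact: ub.
Qed.

Definition corners : seq (R * R) :=
  (1, - (b * n%:R)) :: [seq (1, rowx e1 b (pad la) i) | i <- iota 0 n]
    ++ [seq (-1, rowy e1 b (pad la) i) | i <- iota 0 n].

Lemma sum_corners (G : R * R -> R) : \sum_(p <- corners) G p = G (1, - (b * n%:R)) +
  \sum_(i < n) (G (1, rowx e1 b (pad la) i) + G (-1, rowy e1 b (pad la) i)).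
Proof.
rewrite big_cons big_cat !big_map big_split /=; congr (_ + (_ + _)).
  by rewrite -(big_mkord xpredT (fun i => G (1, rowx e1 b (pad la) i))) /index_iota subn0.
by rewrite -(big_mkord xpredT (fun i => G (-1, rowy e1 b (pad la) i))) /index_iota subn0.
Qed.

Let clampE (z : R) : `|z| - `|z + b| = - b + 2 * Num.min (Num.max (- z) 0) b.
Proof.
case: (leP 0 z) => z0.
  rewrite max_r ?oppr_le0 // min_l ?ltW // !ger0_norm ?addr_ge0 // ?ltW //; lra.
rewrite max_l ?oppr_ge0 ?ltW // ltr0_norm //; case: (leP 0 (z + b)) => zb.
  rewrite ger0_norm // min_l; lra.
rewrite ltr0_norm // min_r; lra.
Qed.

(** By [clampE], the clamped length [crossing] of a row is, up to a constant and a factor 2, the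
    difference of two absolute values centred at the corners of that row. *)
Lemma profile_absum : profile (- b) e1 la = absum corners.
Proof.
apply/funext => c; rewrite profileE /absum sum_corners /= mul1r opprK [b * _]mulrC.
have -> : \sum_(i < n) (1 * `|c - rowx e1 b (pad la) i| + -1 * `|c - rowy e1 b (pad la) i|)
  = \sum_(i < n) (- b + 2 * crossing e1 b lam c i).
  apply: eq_bigr => i _; rewrite mul1r mulN1r.
  have -> : c - rowy e1 b (pad la) i = (c - rowx e1 b (pad la) i) + b.
    by rewrite /rowx /rowy -natr1; ring.
  by rewrite clampE /crossing /rowx /lam; congr (_ + 2 * Num.min (Num.max _ _) _); ring.
rewrite big_split /= -mulr_sumr sumr_const card_ord /gprof mulNrn -[b *+ n]mulr_natl.
by rewrite addrA.
Qed.

Lemma ch_profile l : ch l (profile (- b) e1 la) = chpow e1 b (pad la) l.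
Proof.
rewrite profile_absum ch_absum; last first.
- rewrite sum_corners /= mul1r (eq_bigr (fun=> b)) => [|i _].
    by rewrite sumr_const card_ord -[b *+ n]mulr_natr addNr.
  by rewrite /rowx /rowy -natr1; ring.
- by rewrite sum_corners big1 ?addr0 // => i _; rewrite /= subrr.
rewrite sum_corners /chpow size_pad /= mul1r; congr (_ + _).
by apply: eq_bigr => i _; rewrite mul1r mulN1r.
Qed.

End ProfileMoments.

(** * Fubini's theorem for bounded functions on sets of finite measure *)

Section BoundedFubini.
Context (d1 d2 : measure_display) (T1 : measurableType d1) (T2 : measurableType d2) (R : realType).
Variables (m1 : {sigma_finite_measure set T1 -> \bar R}) (m2 : {sigma_finite_measure set T2 -> \bar R}).
Variables (I : set T1) (J : set T2) (H : T1 -> T2 -> R) (K : R).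
Hypotheses (mI : measurable I) (mJ : measurable J).
Hypotheses (fI : (m1 I < +oo)%E) (fJ : (m2 J < +oo)%E).
Hypothesis mH : measurable_fun setT (fun p : T1 * T2 => H p.1 p.2).
Hypothesis HK : forall x y, I x -> J y -> `|H x y| <= K.

Lemma bounded_Fubini : \int[m1]_(x in I) (\int[m2]_(y in J) H x y)
  = \int[m2]_(y in J) (\int[m1]_(x in I) H x y).
Proof.
pose h (p : T1 * T2) := H p.1 p.2.
have mIJ : measurable (I `*` J) by exact: measurableX.
have fin : ((m1 \x m2)%E (I `*` J) < +oo)%E.
  by rewrite product_measure1E // lte_mul_pinfty // ge0_fin_numE.
have ih : (m1 \x m2)%E.-integrable setT ((EFin \o h) \_ (I `*` J)).
  apply/(integrable_mkcond (EFin \o h) mIJ); apply: measurable_bounded_integrable => //.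
  - exact: measurable_funTS.
  - exists K; split; first exact: num_real.
    by move=> M /ltW KM [x y] [/= Ix Jy]; exact: le_trans (HK Ix Jy) KM.
have pE x y : ((EFin \o h) \_ (I `*` J)) (x, y)
    = if x \in I then (if y \in J then (H x y)%:E else 0%E) else 0%E.
  by rewrite patchE in_setX; case: (x \in I); case: (y \in J).
have mHx x : measurable_fun setT (H x) by exact: (measurableT_comp mH (measurable_pair1 x)).
have mHy y : measurable_fun setT (H ^~ y) by exact: (measurableT_comp mH (measurable_pair2 y)).
have i1 x : I x -> m2.-integrable J (EFin \o H x).
  move=> Ix; apply: measurable_bounded_integrable => //; first exact: measurable_funTS.
  exists K; split; first exact: num_real.
  by move=> M /ltW KM y Jy; exact: le_trans (HK Ix Jy) KM.
have i2 y : J y -> m1.-integrable I (EFin \o H ^~ y).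
  move=> Jy; apply: measurable_bounded_integrable => //; first exact: measurable_funTS.
  exists K; split; first exact: num_real.
  by move=> M /ltW KM x Ix; exact: le_trans (HK Ix Jy) KM.
have := Fubini ih.
have -> : (\int[m1]_x \int[m2]_y ((EFin \o h) \_ (I `*` J)) (x, y) =
   \int[m1]_(x in I) (\int[m2]_(y in J) H x y)%:E)%E.
  rewrite [RHS]integral_mkcond; apply: eq_integral => x _; rewrite patchE.
  under eq_integral do rewrite pE.
  case: ifPn => [|_]; last by rewrite integral0.
  rewrite inE => Ix; rewrite /Rintegral fineK; last exact: integrable_fin_num (i1 x Ix).
  rewrite [RHS]integral_mkcond; apply: eq_integral => y _.
  by rewrite patchE.
have -> : (\int[m2]_y \int[m1]_x ((EFin \o h) \_ (I `*` J)) (x, y) =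
   \int[m2]_(y in J) (\int[m1]_(x in I) H x y)%:E)%E.
  rewrite [RHS]integral_mkcond; apply: eq_integral => y _; rewrite patchE.
  under eq_integral do rewrite pE.
  case: ifPn => [|/negbTE yJ]; last first.
    rewrite -[RHS](integral0 m1 setT); apply: eq_integral => x _.
    by case: ifP.
  rewrite inE => Jy; rewrite /Rintegral fineK; last exact: integrable_fin_num (i2 y Jy).
  rewrite [RHS]integral_mkcond; apply: eq_integral => x _.
  by rewrite patchE.
by rewrite {1 3}/Rintegral => ->.
Qed.

End BoundedFubini.

(** * The limit shape *)

Section LimitShape.
Variables (R : realType) (v : R -> R) (B : R).
Hypotheses (bv : bmeas v) (vB : forall y, `|v y| <= B) (v0 : avg v = 0).
Local Notation mu := (@lebesgue_measure R).

(** A superposition of the profiles [|c - z|], so that half its second derivative is the law of [v]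
    under the uniform measure. *)
Definition lshape (c : R) : R := avg (fun y => `|c - v y|).

Let bc c : bmeas (fun y => c - v y). Proof. exact: bmeasB (bmeas_cst c) bv. Qed.
Let bnc c : bmeas (fun y => `|c - v y|). Proof. exact: bmeas_norm. Qed.

Lemma lshape_lip x y : `|lshape x - lshape y| <= `|x - y|.
Proof.
rewrite /lshape -avgB //; apply: le_trans (norm_avg (bmeasB (bnc x) (bnc y))) _.
rewrite -(avg_cst `|x - y|); apply: le_avg.
- exact/bmeas_norm/bmeasB.
- exact: bmeas_cst.
- move=> t; apply: le_trans (ler_dist_dist _ _) _.
  by rewrite opprB addrA subrK.
Qed.

Lemma lshape_ge0 x : 0 <= lshape x.
Proof. by rewrite -(avg_cst 0); apply: le_avg => //; exact: bmeas_cst. Qed.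

Lemma lshape_out c : B <= `|c| -> lshape c = `|c|.
Proof.
move=> Bc; have [c0|c0] := leP 0 c.
  rewrite ger0_norm // in Bc *; rewrite /lshape.
  have -> : (fun y => `|c - v y|) = (fun y => c - v y).
    apply/funext => y; rewrite ger0_norm // subr_ge0.
    exact: le_trans (ler_norm _) (le_trans (vB y) Bc).
  by rewrite avgB ?avg_cst ?v0 ?subr0 //; exact: bmeas_cst.
rewrite ltr0_norm // in Bc *; rewrite /lshape.
have -> : (fun y => `|c - v y|) = (fun y => v y - c).
  apply/funext => y; rewrite ler0_norm ?opprB // subr_le0 -lerN2.
  by apply: le_trans (le_trans (vB y) Bc); rewrite -normrN ler_norm.
by rewrite avgB ?avg_cst ?v0 ?sub0r //; exact: bmeas_cst.
Qed.

Lemma continuous_lshape : continuous lshape.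
Proof.
move=> c; apply/cvgrPdist_lt => e e0; near=> x.
apply: le_lt_trans (lshape_lip c x) _; near: x; exact: cvgr_dist_lt.
Unshelve. all: by end_near. Qed.

Lemma lshape_profile : continuous_profile lshape.
Proof.
split; [exact: lshape_lip|exact: lshape_ge0|].
have -> : (fun c => (lshape c - `|c|)%:E) = (fun c => (lshape c - `|c|)%:E) \_ (`[- B, B]).
  apply/funext => c; rewrite patchE; case: ifPn => //.
  rewrite notin_setE /= in_itv /= => /negP.
  by rewrite -ler_norml -ltNge => /ltW cB; rewrite lshape_out // subrr.
apply/(@integrable_mkcond _ _ R mu _ _ (measurable_itv `[- B, B])).
apply: continuous_integrable_itv => c; apply: cvgB; first exact: continuous_lshape.
by apply: cvg_norm; exact: cvg_id.
Qed.

(** Exchange the two integrals and apply [int_kern] at each [z = v y]. The boundary terms are affine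
    in [v y] and [v] has mean zero, so they average to their value at [z = 0]. *)
Lemma ch_lshape l : ch l lshape = avg (fun y => v y ^+ l).
Proof.
have tp0 : 2 * pi != 0 :> R by rewrite gt_eqF // mulr_gt0 // pi_gt0.
have B0 : 0 <= B by exact: le_trans (vB 0).
rewrite (ch_compact l continuous_lshape (fun c cB => lshape_out (ltW cB))).
have cabs : continuous (fun c : R => `|c|) by move=> c; apply: cvg_norm; exact: cvg_id.
rewrite int_kernB //; last exact: continuous_lshape.
have -> : \int[mu]_(c in `[- B, B]) (kern l c * `|c|)
    = \int[mu]_(c in `[- B, B]) (kern l c * `|c - 0|).
  by apply: eq_Rintegral => c _; rewrite subr0.
rewrite int_kern ?normr0 //.
have [K hK] : exists K, forall c : R, `|c| <= B -> `|kern l c| <= K.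
  exists ((l * l.-1)%:R * B ^+ (l - 2)) => c cB.
  by rewrite /kern normrM normrX normr_nat; apply: ler_wpM2l => //; exact: lerXn2r.
have mH : measurable_fun setT (fun p : R * R => kern l p.1 * `|p.1 - v p.2|).
  have mv : measurable_fun setT (fun p : R * R => v p.2).
    exact: (measurableT_comp bv.1 measurable_snd).
  have mk : measurable_fun setT (fun p : R * R => kern l p.1).
    apply: measurableT_comp measurable_fst.
    by apply: measurable_realfun.continuous_measurable_fun; exact: continuous_kern.
  apply: measurable_realfun.measurable_funM => //; apply: measurableT_comp => //.
  exact: measurable_realfun.measurable_funB measurable_fst mv.
have fub := @bounded_Fubini _ _ _ _ R mu mu `[- B, B]%classic (@circle R)
  (fun c y => kern l c * `|c - v y|) (K * (B + B)) (measurable_itv `[- B, B])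
  (@measurable_circle R).
have e1 : \int[mu]_(c in `[- B, B]) (kern l c * lshape c)
   = (2 * pi)^-1 * \int[mu]_(c in `[- B, B])
        (\int[mu]_(y in @circle R) (kern l c * `|c - v y|)).
  have ic c : \int[mu]_(y in @circle R) (kern l c * `|c - v y|) = (2 * pi) * (kern l c * lshape c).
    rewrite (@RintegralZl _ _ R mu _ _ _ (@measurable_circle R) (bmeas_int (bnc c))).
    by rewrite /lshape /avg mulrCA mulVKf.
  under [in RHS]eq_Rintegral do rewrite ic.
  rewrite (@RintegralZl _ _ R mu _ (fun c => kern l c * lshape c) _ (measurable_itv `[- B, B])).
    by rewrite mulKf.
  exact/continuous_integrable_itv/continuous_kernM/continuous_lshape.
rewrite e1 fub //; first last.
- move=> c y; rewrite /= in_itv /= -ler_norml => cB _; rewrite normrM normr_id.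
  apply: ler_pM => //; first exact: hK.
  by apply: le_trans (ler_normB _ _) _; apply: lerD.
- by rewrite [X in (X < _)%E](mu_circle R) ltry.
- by rewrite [X in (X < _)%E]lebesgue_measure_itv /=; case: ifP => _; rewrite ?ltry.
have -> : (2 * pi)^-1 * \int[mu]_(y in @circle R)
     (\int[mu]_(c in `[- B, B]) (kern l c * `|c - v y|)) =
  avg (fun y => 2 * v y ^+ l + (kernF l 0 B - (l%:R * B ^+ l.-1) * v y)
     + (kernF l 0 (- B) - (l%:R * (- B) ^+ l.-1) * v y)).
  congr (_ * _); apply: eq_Rintegral => y _.
  by rewrite int_kern // (kernF_lin l (v y) B) (kernF_lin l (v y) (- B)).
have bX := bmeasX l bv.
have b1 (a k : R) : bmeas (fun y => a - k * v y).
  by apply: bmeasB; [exact: bmeas_cst|exact: bmeasZ].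
have a1 (a k : R) : avg (fun y => a - k * v y) = a.
  rewrite avgB; [|exact: bmeas_cst|exact: bmeasZ].
  by rewrite avg_cst avgZ // v0 mulr0 subr0.
rewrite (avgD (bmeasD (bmeasZ 2 bX) (b1 _ _)) (b1 _ _)) (avgD (bmeasZ 2 bX) (b1 _ _)).
by rewrite !a1 (avgZ _ bX); field.
Qed.


Lemma avg_indic (E : set R) : measurable E ->
  mu [set t : R | 0 <= t < 2 * pi /\ E t] = (2 * pi * avg (\1_E : R -> R))%:E.
Proof.
move=> mE; have tp0 : 2 * pi != 0 :> R by rewrite gt_eqF // mulr_gt0 // pi_gt0.
have bE : bmeas (\1_E : R -> R).
  split; first exact: measurable_realfun.measurable_indic.
  by exists 1 => x; rewrite indicE; case: (x \in E); rewrite ?normr1 ?normr0.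
have -> : [set t : R | 0 <= t < 2 * pi /\ E t] = E `&` `[0, (2 * pi)[.
  by apply/seteqP; split=> t /=; rewrite in_itv /= => -[].
have io : mu.-integrable `[0, (2 * pi)[ (EFin \o (\1_E : R -> R)).
  apply: (@integrableS _ _ R mu _ _ _ (@measurable_circle R)) (bmeas_int bE) => //.
  by move=> t; rewrite /circle /= !in_itv /= => /andP[-> /ltW].
rewrite /avg /circle -Rintegral_itv_bndo_bndc // mulVKf //.
rewrite /Rintegral fineK; first by rewrite (integral_indic mu).
by apply: (@integrable_fin_num _ _ R mu).
Qed.

(** Right difference quotients are at least [2 P(v <= c) - 1] and left ones at most
    [2 P(v < c) - 1]. Where the derivative exists, these bounds and [P(v < c) <= P(v <= c)] pin it
    down. *)
Lemma lshape_derive c : derivable lshape c 1 ->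
  mu [set t : R | 0 <= t < 2 * pi /\ v t < c] = (pi * (1 + derive1 lshape c))%:E.
Proof.
move=> df; pose E := [set t | v t < c]; pose G := [set t | v t <= c].
have mE : measurable E.
  have := bv.1 measurableT `]-oo, c[%classic (measurable_itv _); rewrite setTI.
  by congr measurable; apply/seteqP; split=> t; rewrite /= in_itv.
have mG : measurable G.
  have := bv.1 measurableT `]-oo, c]%classic (measurable_itv _); rewrite setTI.
  by congr measurable; apply/seteqP; split=> t; rewrite /= in_itv.
have bI (S : set R) : measurable S -> bmeas (\1_S : R -> R).
  move=> mS; split; first exact: measurable_realfun.measurable_indic.
  by exists 1 => x; rewrite indicE; case: (x \in S); rewrite ?normr1 ?normr0.
have bL (S : set R) (h : R) : measurable S -> bmeas (fun y => h * (2 * \1_S y - 1)).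
  by move=> mS; apply: bmeasZ; apply: bmeasB; [apply: bmeasZ; exact: bI|exact: bmeas_cst].
have aL (S : set R) (h : R) : measurable S ->
    avg (fun y => h * (2 * \1_S y - 1)) = h * (2 * avg (\1_S : R -> R) - 1).
  move=> mS; rewrite avgZ; last first.
    by apply: bmeasB; [apply: bmeasZ; exact: bI|exact: bmeas_cst].
  rewrite avgB; [|by apply: bmeasZ; exact: bI|exact: bmeas_cst].
  by rewrite avgZ ?avg_cst //; exact: bI.
have right h : 0 < h -> 2 * avg (\1_G : R -> R) - 1 <= h^-1 * (lshape (h + c) - lshape c).
  move=> h0; rewrite ler_pdivlMl // -aL // /lshape -avgB //.
  apply: le_avg; [exact: bL|exact: bmeasB|move=> y].
  rewrite indicE; case: (boolP (y \in G)); rewrite ?inE ?notin_setE /G /= => hy.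
    rewrite !ger0_norm; lra.
  have := ler_normD (h + c - v y) (- h).
  have -> : h + c - v y - h = c - v y by ring.
  rewrite [`|- h|]normrN [`|h|]gtr0_norm //; lra.
have left h : h < 0 -> h^-1 * (lshape (h + c) - lshape c) <= 2 * avg (\1_E : R -> R) - 1.
  move=> h0; have k0 : 0 < - h by rewrite oppr_gt0.
  have -> : h^-1 * (lshape (h + c) - lshape c) = (- h)^-1 * (lshape c - lshape (h + c)).
    by rewrite invrN mulNr -mulrN opprB.
  rewrite ler_pdivrMl // -aL // /lshape -avgB //.
  apply: le_avg; [exact: bmeasB|exact: bL|move=> y].
  rewrite indicE; case: (boolP (y \in E)); rewrite ?inE ?notin_setE /E /= => hy.
    have := ler_normD (h + c - v y) (- h).
    have -> : h + c - v y - h = c - v y by ring.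
    rewrite [`|- h|]gtr0_norm //; lra.
  move/negP: hy; rewrite -leNgt => hy.
  rewrite !ler0_norm; lra.
have EG : avg (\1_E : R -> R) <= avg (\1_G : R -> R).
  apply: le_avg; [exact: bI|exact: bI|move=> y]; rewrite !indicE ler_nat.
  by case: (boolP (y \in E)) => //; rewrite inE => /= h; rewrite mem_set //= /G /= ltW.
have cv : h^-1 * (lshape (h + c) - lshape c) @[h --> 0^'] --> derive1 lshape c.
  rewrite derive1E; have := df; rewrite /derivable /derive.
  under eq_fun do rewrite /= -[_ *: 1]/(_ * 1) mulr1.
  by [].
have key e : 0 < e -> exists2 dl, 0 < dl & forall h, `|h| < dl -> h != 0 ->
    `|derive1 lshape c - h^-1 * (lshape (h + c) - lshape c)| < e.
  move=> e0; have /cvgrPdist_lt/(_ e e0) := cv.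
  rewrite /dnbhs /within /= => /nbhs_ballP [dl /= dl0 H]; exists dl => // h hd h0.
  by apply: H => //; rewrite /ball /= sub0r normrN.
have d1 : 2 * avg (\1_G : R -> R) - 1 <= derive1 lshape c.
  apply/ler_addgt0Pr => e e0; have [dl dl0 H] := key e e0.
  have h0 : 0 < dl / 2 by rewrite divr_gt0.
  have := H (dl / 2); rewrite gtr0_norm // gt_eqF // => /(_ _ isT).
  have -> : dl / 2 < dl by lra.
  move=> /(_ isT); have := right _ h0; set q := (dl / 2)^-1 * _ => r.
  by rewrite ltr_norml; lra.
have d2 : derive1 lshape c <= 2 * avg (\1_E : R -> R) - 1.
  apply/ler_addgt0Pr => e e0; have [dl dl0 H] := key e e0.
  have h0 : - (dl / 2) < 0 by rewrite oppr_lt0 divr_gt0.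
  have := H (- (dl / 2)); rewrite ltr0_norm // lt_eqF // opprK => /(_ _ isT).
  have -> : dl / 2 < dl by lra.
  move=> /(_ isT); have := left _ h0; set q := (- (dl / 2))^-1 * _ => r.
  by rewrite ltr_norml; lra.
rewrite (avg_indic mE); congr (_%:E).
have -> : derive1 lshape c = 2 * avg (\1_E : R -> R) - 1 by apply/eqP; rewrite eq_le d2; lra.
by ring.
Qed.

End LimitShape.

Lemma mulC_conj (R : realType) (z : R[i]) : z * z^*%C = (sqmod z)%:C%C.
Proof.
case: z => a b; apply/eqP; rewrite eq_complex /= /sqmod /=.
by apply/andP; split; apply/eqP; ring.
Qed.

(** * Expectations at fixed parameters *)

Section FixedParameters.
Variables (R : realType) (e b : R).
Hypotheses (e0 : 0 < e) (b0 : 0 < b).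
Local Notation C := R[i].
Local Notation Re := (@complex.Re R).
Local Notation inC := (real_complex R).

Lemma jackc_family n : jack_family (e / b) (@jackc R (e / b) n).
Proof.
have [c [h1 h2 h3]] := @jack_exists R e b n e0 b0.
apply: (@xgetPex _ [ffun _ => [ffun _ => 0]]
  [set c : {ffun partn n -> {ffun partn n -> R}} | jack_family (e / b) c]).
exists [ffun la => [ffun mu => c la mu]]; split.
- by move=> la; rewrite -[RHS](h1 la); apply: eq_bigr => mu _; rewrite !ffunE.
- by move=> la nu d; rewrite -[RHS](h2 la nu d); apply: eq_bigr => mu _; rewrite !ffunE.
- by move=> la nu d; rewrite -[RHS](h3 la nu d); apply: eq_bigr => mu _; rewrite !ffunE.
Qed.

Lemma zee_gt0 mu : (0 < zee mu)%N.
Proof.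
rewrite /zee big_add1 /= big_mkord; apply: prodn_gt0 => k.
by rewrite muln_gt0 expn_gt0 fact_gt0.
Qed.

Lemma jack_norm_gt0 n (la : partn n) : 0 < jack_norm (e / b) la.
Proof.
have [h1 _ _] := jackc_family n; have al0 : 0 < e / b by rewrite divr_gt0.
have t0 (mu : partn n) : 0 <= (@jackc R (e / b) n la mu) ^+ 2 * (zee (parts mu))%:R
      * (e / b) ^+ size (parts mu).
  apply: mulr_ge0; last by rewrite exprn_ge0 // ltW.
  by rewrite mulr_ge0 ?sqr_ge0.
rewrite lt_def sumr_ge0 ?andbT; last by move=> mu _.
apply/eqP => s0; have z (mu : partn n) : @jackc R (e / b) n la mu = 0.
  have /eqP : (@jackc R (e / b) n la mu) ^+ 2 * (zee (parts mu))%:R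
      * (e / b) ^+ size (parts mu) = 0 by apply: (psumr_eq0P _ s0) => // nu _.
  rewrite mulf_eq0 [X in _ || X]gt_eqF ?exprn_gt0 // orbF mulf_eq0.
  by rewrite [X in _ || X]gt_eqF ?orbF ?ltr0n ?zee_gt0 // sqrf_eq0 => /eqP.
have := h1 la; rewrite big1 => [|mu _]; last by rewrite z mul0r.
by move/esym/eqP; rewrite oner_eq0.
Qed.

Lemma eigc_inC la r v : eigc (inC e) (inC b) la r v = inC (eigc e b la r v).
Proof.
elim: r v => [|r IH] v /=; first by rewrite rmorphM rmorph_nat.
rewrite rmorphD !rmorphM rmorphB !rmorphM !rmorph_nat IH rmorph_sum; congr (_ + _ * _).
by apply: eq_bigr => x _; rewrite !IH rmorphB.
Qed.

Lemma eig_inC la r : eig (inC e) (inC b) la r = inC (eig e b la r).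
Proof.
by rewrite /eig rmorphM rmorph_sum; congr (_ * _); apply: eq_bigr => x _; rewrite eigc_inC.
Qed.

Variable V : nat -> C.

(** The exponent of [PiV] by degree, with a zero in degree 0, so that the coefficients of its
    exponential satisfy the recursion demanded of [kap]. *)
Definition xPi (k : nat) : R := drop0 (fun k => sqmod (V k) / (- e * - b * k%:R)) k.

Lemma xPi_ge0 k : 0 <= xPi k.
Proof.
case: k => [//|k]; rewrite /xPi /= divr_ge0 ?addr_ge0 ?sqr_ge0 //.
by rewrite mulrNN !mulr_ge0 // ltW.
Qed.

Lemma moment_degree n rs :
  \sum_(la : partn n) sqmod (jackV (- b) e V la) / jack_norm (e / b) la
     * \prod_(r <- rs) eig e b (pad la) r
  = cauchyp (fun d => Re (jh V (inC (e - b)) (inC (e * b)) rs [::] d)) (cexp xPi) n.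
Proof.
have [h1 h2 h3] := jackc_family n.
have en : inC e != 0 by rewrite fmorph_eq0 gt_eqF.
have bn : inC b != 0 by rewrite fmorph_eq0 gt_eqF.
have k0 : inC (cexp xPi 0) = 1 by rewrite cexp0 rmorph1.
have kS j : j.+1%:R * inC (cexp xPi j.+1) = (inC e * inC b)^-1 *
    \sum_(k < j.+1) V k.+1 * (V k.+1)^*%C * inC (cexp xPi (j - k)).
  rewrite -(rmorph_nat inC) -rmorphM cexpS // -rmorphM -fmorphV rmorph_sum mulr_sumr.
  apply: eq_bigr => k _; rewrite mulC_conj -!rmorphM; congr (inC _).
  rewrite /xPi /= mulrNN invfM [_^-1 * k.+1%:R^-1]mulrC.
  have k1 : k.+1%:R != 0 :> R by rewrite pnatr_eq0.
  by field; rewrite ?k1 ?gt_eqF.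
pose cC (la mu : partn n) : C := inC (@jackc R (e / b) n la mu).
have J1 (la : partn n) : \sum_mu cC la mu * (pm_coef (parts mu) (parts la))%:R = 1.
  rewrite -[RHS](rmorph1 inC) -[X in _ = inC X](h1 la) rmorph_sum; apply: eq_bigr => mu _.
  by rewrite rmorphM rmorph_nat.
have J2 (la nu : partn n) : ~~ dominates (parts la) (parts nu) ->
    \sum_mu cC la mu * (pm_coef (parts mu) (parts nu))%:R = 0.
  move=> d; rewrite -[RHS](rmorph0 inC) -[X in _ = inC X](h2 la nu d) rmorph_sum; apply: eq_bigr => mu _.
  by rewrite rmorphM rmorph_nat.
have ipC (la la' : partn n) : \sum_mu cC la mu * cC la' mu * (zee (parts mu))%:R
     * (inC e / inC b) ^+ size (parts mu)
   = inC (\sum_mu @jackc R (e / b) n la mu * @jackc R (e / b) n la' mu * (zee (parts mu))%:R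
     * (e / b) ^+ size (parts mu)).
  rewrite rmorph_sum; apply: eq_bigr => mu _.
  by rewrite !rmorphM rmorph_nat rmorphXn rmorphM fmorphV.
have nC (la : partn n) : \sum_mu cC la mu * cC la mu * (zee (parts mu))%:R
     * (inC e / inC b) ^+ size (parts mu) = inC (jack_norm (e / b) la).
  by rewrite ipC; congr (inC _); apply: eq_bigr => mu _; rewrite expr2.
have J3 (la la' : partn n) : la != la' -> \sum_mu cC la mu * cC la' mu * (zee (parts mu))%:R
     * (inC e / inC b) ^+ size (parts mu) = 0.
  by move=> ne; rewrite ipC h3 ?rmorph0.
have J4 (la : partn n) : \sum_mu cC la mu * cC la mu * (zee (parts mu))%:R
     * (inC e / inC b) ^+ size (parts mu) != 0.
  by rewrite nC fmorph_eq0 gt_eqF // jack_norm_gt0.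
have jV (la : partn n) : \sum_mu cC la mu * \prod_(k <- parts mu) (V k / inC b) = jackV (- b) e V la.
  by rewrite /jackV opprK.
have jVc (la : partn n) : \sum_mu cC la mu * \prod_(k <- parts mu) ((V k)^*%C / inC b)
    = (jackV (- b) e V la)^*%C.
  rewrite -jV rmorph_sum; apply: eq_bigr => mu _; rewrite rmorphM rmorph_prod.
  congr (_ * _); first by rewrite /cC /= oppr0.
  by apply: eq_bigr => k _; rewrite rmorphM fmorphV /= oppr0.
have key := @jack_moment_jets C (inC e) (inC b) n en bn V (fun k => (V k)^*%C)
  (fun j => inC (cexp xPi j)) k0 kS cC J1 J2 J3 J4 rs.
have eL : inC (\sum_(la : partn n) sqmod (jackV (- b) e V la) / jack_norm (e / b) la
     * \prod_(r <- rs) eig e b (pad la) r)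
   = \sum_(d < n.+1) jhams (inC e) (inC b) V (fun k => (V k)^*%C) rs [::] d * inC (cexp xPi (n - d)).
  rewrite -key rmorph_sum; apply: eq_bigr => la _; rewrite jV jVc nC mulC_conj.
  rewrite !rmorphM fmorphV rmorph_prod; congr (_ * _).
  by apply: eq_bigr => r _; rewrite eig_inC.
rewrite -[LHS]/(Re (inC _)) eL Re_sum /cauchyp; apply: eq_bigr => d _.
by rewrite Re_mul /= mulr0 subr0 /jh rmorphB rmorphM.
Qed.


Variables (A rho : R).
Hypotheses (A1 : 1 <= A) (rho0 : 0 < rho) (rho1 : rho < 1).
Hypothesis Vle : forall k, nrm (V k.+1) <= A * rho ^+ k.+1.

Lemma xPi_cvg : cvgn (series xPi).
Proof.
have eb0 : 0 < e * b by rewrite mulr_gt0.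
apply: (@geob_cvg _ rho); first by rewrite rho0.
have A0 : 0 <= A by exact: le_trans A1.
have K0 : 0 <= A * A / (e * b) by apply: divr_ge0; [exact: mulr_ge0|exact: ltW].
exists (A * A / (e * b)); split=> // -[|k]; first by rewrite -[xPi 0]/(0 : R) normr0 mulr1.
rewrite ger0_norm; last exact: xPi_ge0.
have sq : sqmod (V k.+1) = nrm (V k.+1) ^+ 2 by rewrite /nrm sqr_sqrtr // addr_ge0 ?sqr_ge0.
have s1 : sqmod (V k.+1) <= A * A * rho ^+ k.+1.
  rewrite sq; have r1 : rho ^+ k.+1 <= 1 by rewrite exprn_ile1 // ltW.
  have r0 : 0 <= rho ^+ k.+1 by rewrite exprn_ge0 // ltW.
  apply: (@le_trans _ _ ((A * rho ^+ k.+1) ^+ 2)).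
    by rewrite lerXn2r ?nnegrE ?nrm_ge0 // (le_trans (nrm_ge0 _) (Vle k)).
  rewrite expr2 mulrACA; apply: ler_wpM2l; first exact: mulr_ge0.
  by rewrite ler_piMr.
rewrite /xPi /= mulrNN [leRHS]mulrAC ler_pdivrMr; last by rewrite mulr_gt0.
rewrite mulrA divfK; last by rewrite gt_eqF.
apply: le_trans s1 _; apply: ler_peMr; last by rewrite ler1n.
apply: mulr_ge0; first exact: mulr_ge0.
by rewrite exprn_ge0 // ltW.
Qed.

Lemma PiV_series : series (cexp xPi) @ \oo --> PiV (- b) e V.
Proof.
rewrite /PiV sum1_series; apply: cvg_cexp => //; first exact: xPi_ge0.
exact: xPi_cvg.
Qed.

(** Summed over all sizes [n], the Cauchy product yields the sum of the jets times [PiV], and the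
    normalization of the measure cancels [PiV]. *)
Lemma moment_series t rs : 0 < t < 1 ->
  geob t (fun d => Re (jh V (inC (e - b)) (inC (e * b)) rs [::] d)) ->
  series (fun n => \sum_(la : partn n) jack_prob (- b) e V la * \prod_(r <- rs) eig e b (pad la) r)
    @ \oo --> limn (series (fun d => Re (jh V (inC (e - b)) (inC (e * b)) rs [::] d))).
Proof.
move=> t01 g; have P0 : PiV (- b) e V != 0 by rewrite gt_eqF // expR_gt0.
have -> : (fun n => \sum_(la : partn n) jack_prob (- b) e V la * \prod_(r <- rs) eig e b (pad la) r)
  = (fun n => 0 + (PiV (- b) e V)^-1 *
    cauchyp (fun d => Re (jh V (inC (e - b)) (inC (e * b)) rs [::] d)) (cexp xPi) n).
  apply/funext => n; rewrite add0r -moment_degree mulr_sumr; apply: eq_bigr => la _.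
  by rewrite /jack_prob opprK invfM mulrCA !mulrA.
have c1 := cauchy_product_half t01 g (cexp_ge0 xPi_ge0) PiV_series.
have c0 : series (fun=> 0 : R) @ \oo --> 0.
  have -> : series (fun=> 0 : R) = (fun=> 0); last exact: cvg_cst.
  by apply/funext => n; rewrite series_ord big1.
have := series_lin (c := (PiV (- b) e V)^-1) c0 c1.
by rewrite [X in _ --> X -> _]add0r [X in _ --> X -> _]mulrC mulfK.
Qed.

End FixedParameters.

(** * Convergence of the joint moments *)

Section JointMoments.
Variables (R : realType) (V : nat -> R[i]) (A rho b2 : R).
Hypotheses (A1 : 1 <= A) (rho0 : 0 < rho) (rho1 : rho < 1) (b20 : 0 < b2).
Hypothesis Vle : forall k, nrm (V k.+1) <= A * rho ^+ k.+1.

Definition jfun := R -> forall n, partn n -> R.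
Implicit Types (X Y : jfun).

Definition wsum X rs e n : R := \sum_(la : partn n) jack_prob (- (b2 * e)) e V la *
  (X e n la * \prod_(r <- rs) eig e (b2 * e) (pad la) r).

(* [X] has the classical limit [phi], jointly with all products of Hamiltonians. *)
Definition classical_limit X (phi : R) := forall rs, exists2 E : R -> R,
  (forall e, 0 < e <= 1 -> series (wsum X rs e) @ \oo --> E e) &
  E e @[e --> 0^'+] --> phi * \prod_(r <- rs) cO V r.

Lemma climit1 : classical_limit (fun _ _ _ => 1) 1.
Proof.
move=> rs.
pose J e d := complex.Re (jh V (e * (1 - b2))%:C%C (e * (e * b2))%:C%C rs [::] d).
have [g [K K0 hK]] := @jets_lim R V A rho A1 rho0 rho1 Vle
   (fun M j => avg (fun y => vN V M.+1 y ^+ j)) (fun M j => whb_tpoly V M j) (1 - b2) b2 rs.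
exists (fun e => limn (series (J e))) => [e e01|].
  have /andP[e0 _] := e01.
  have be0 : 0 < b2 * e by rewrite mulr_gt0.
  have := @moment_series R e (b2 * e) e0 be0 V A rho A1 rho0 rho1 Vle _ rs (sqrt_lt1 rho0 rho1).
  have -> : e - b2 * e = e * (1 - b2) by ring.
  have -> : e * (b2 * e) = e * (e * b2) by ring.
  move=> /(_ (g e e01)); rewrite -/(J e).
  have -> // : (fun n => \sum_(la : partn n) jack_prob (- (b2 * e)) e V la
      * \prod_(r <- rs) eig e (b2 * e) (pad la) r) = wsum (fun _ _ _ => 1) rs e.
  by apply/funext => n; apply: eq_bigr => la _; rewrite mul1r.
rewrite mul1r; set P := \prod_(r <- rs) _.
have c0 : limn (series (J e)) - P @[e --> 0^'+] --> 0.
  apply: (@squeeze_norm0 _ _ _ _ _ (fun e => e * K)).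
    near=> e; apply: hK; apply/andP; split; first by near: e; exact: nbhs_right_gt.
    by near: e; apply: nbhs_right_le.
  rewrite -[X in _ --> X](mul0r K); apply: cvgMl; apply: cvg_at_right_filter; exact: cvg_id.
have -> : (fun e => limn (series (J e))) = (fun e => (limn (series (J e)) - P) + P).
  by apply/funext => e; rewrite subrK.
by rewrite -[X in _ --> X]add0r; apply: cvgD => //; exact: cvg_cst.
Unshelve. all: by end_near. Qed.

(** The quantification over all lists [rs] in [classical_limit] lets a new factor be absorbed as one
    more Hamiltonian. *)
Lemma climit_eig X phi r : classical_limit X phi ->
  classical_limit (fun e n la => X e n la * eig e (b2 * e) (pad la) r) (phi * cO V r).
Proof.
move=> h rs; have [E h1 h2] := h (r :: rs); exists E; last by rewrite big_cons mulrA in h2.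
move=> e e01; have -> // : wsum (fun e n la => X e n la * eig e (b2 * e) (pad la) r) rs e
  = wsum X (r :: rs) e; last exact: h1.
by apply/funext => n; apply: eq_bigr => la _; rewrite big_cons !mulrA.
Qed.

Lemma climit_lin X Y phi psi c : classical_limit X phi -> classical_limit Y psi ->
  classical_limit (fun e n la => X e n la + c * Y e n la) (phi + c * psi).
Proof.
move=> hX hY rs; have [E h1 h2] := hX rs; have [E' h1' h2'] := hY rs.
exists (fun e => E e + c * E' e) => [e e01|].
  have -> : wsum (fun e n la => X e n la + c * Y e n la) rs e
    = (fun n => wsum X rs e n + c * wsum Y rs e n); last exact: series_lin (h1 e e01) (h1' e e01).
  apply/funext => n; rewrite /wsum mulr_sumr -big_split; apply: eq_bigr => la _ /=.
  by ring.
by rewrite mulrDl -mulrA; apply: cvgD => //; apply: cvgMr.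
Qed.

Lemma climit0 : classical_limit (fun _ _ _ => 0) 0.
Proof.
move=> rs; exists (fun=> 0) => [e e01|]; last by rewrite mul0r; exact: cvg_cst.
have -> : series (wsum (fun _ _ _ => 0) rs e) = (fun=> 0); last exact: cvg_cst.
apply/funext => n; rewrite series_ord big1 // => k _; rewrite /wsum big1 // => la _.
by rewrite mul0r mulr0.
Qed.

Lemma eq_climit X Y phi : (forall e n la, 0 < e -> X e n la = Y e n la) ->
  classical_limit X phi -> classical_limit Y phi.
Proof.
move=> XY h rs; have [E h1 h2] := h rs; exists E => // e e01.
have -> : wsum Y rs e = wsum X rs e; last exact: h1.
by apply/funext => n; apply: eq_bigr => la _; rewrite XY //; case/andP: e01.
Qed.

Lemma climitZ X phi c : classical_limit X phi ->
  classical_limit (fun e n la => c * X e n la) (c * phi).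
Proof.
move=> h; have := climit_lin c climit0 h; rewrite add0r.
by apply: eq_climit => e n la _; rewrite add0r.
Qed.

Lemma climit_sum m (X : nat -> jfun) (phi : nat -> R) :
  (forall j, (j < m)%N -> classical_limit (X j) (phi j)) ->
  classical_limit (fun e n la => \sum_(j < m) X j e n la) (\sum_(j < m) phi j).
Proof.
elim: m => [|m IH] h.
  by rewrite big_ord0; apply: eq_climit climit0 => e n la _; rewrite big_ord0.
rewrite big_ord_recr /= -[phi m]mul1r.
apply: eq_climit (climit_lin 1 (IH (fun j jm => h j (ltnW jm))) (h m (leqnn _))) => e n la _.
by rewrite big_ord_recr mul1r.
Qed.

Lemma climit_eigser X phi l : classical_limit X phi ->
  classical_limit (fun e n la => X e n la * eigser e (b2 * e) (pad la) 0 l) (phi * ceta V l).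
Proof.
move=> h; case: l => [|[|r]].
- by rewrite [ceta _ _]/= mulr1; apply: eq_climit h => e n la _; rewrite /= mulr1.
- by rewrite [ceta _ _]/= mulr0; apply: eq_climit climit0 => e n la _; rewrite /= !mulr0.
rewrite [ceta _ _]/= mulrN -mulN1r; apply: eq_climit (climitZ (-1) (climit_eig r h)) => e n la _.
by rewrite eigser0S mulN1r mulrN.
Qed.

Local Notation beta := (fun j => avg (fun y => symbol V y ^+ j)).

Let newton_top (F : comNzRingType) (Q p : nat -> F) m : Q 0%N = 1 -> newton Q p ->
  p m.+1 = - 1 * (m.+1%:R * Q m.+1 + \sum_(j < m) p j.+1 * Q (m - j)%N).
Proof.
move=> Q0 /(_ m.+1); rewrite /nresid big_ord_recr /= subnn Q0 mulr1 addrA => /eqP.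
by rewrite addrC addr_eq0 => /eqP ->; rewrite mulN1r.
Qed.

(** Newton's identities express [chpow] polynomially through [eigser], and the averages of powers of
    the symbol through [ceta] in the same way. The factor [X] is carried along so that products can
    be treated one factor at a time. *)
Lemma climit_chpow l X phi : classical_limit X phi ->
  classical_limit (fun e n la => X e n la * chpow e (b2 * e) (pad la) l) (phi * beta l).
Proof.
have [N] := ubnP l; elim: N l X phi => // N IH [|m] X phi lN h.
  have -> : beta 0%N = 1 by exact: avg_cst.
  rewrite mulr1; apply: eq_climit h => e n la _.
  by rewrite /chpow expr0 big1 ?addr0 ?mulr1 // => i _; rewrite subrr.
rewrite (newton_top m erefl (newton_symbol A1 rho0 rho1 Vle)) mulrCA mulrDr mulr_sumr.
rewrite [X in -1 * (X + _)]mulrCA -[X in -1 * (_ + X)]mul1r.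
have IH' j : (j < m)%N -> classical_limit (fun e n la =>
    (X e n la * chpow e (b2 * e) (pad la) j.+1) * eigser e (b2 * e) (pad la) 0 (m - j))
    (phi * (beta j.+1 * ceta V (m - j))).
  move=> jm; rewrite mulrA; apply: climit_eigser; apply: IH => //.
  by rewrite ltnS in lN; exact: leq_ltn_trans jm lN.
apply: eq_climit (climitZ (-1) (climit_lin 1 (climitZ m.+1%:R (climit_eigser m.+1 h))
   (climit_sum (X := fun j e n la => (X e n la * chpow e (b2 * e) (pad la) j.+1)
      * eigser e (b2 * e) (pad la) 0 (m - j)) IH'))) => e n la e0.
rewrite (newton_top m erefl (newton_eigser e (b2 * e) (pad_sorted la))) [RHS]mulrCA.
congr (_ * _); rewrite [X in _ + X = _]mul1r [RHS]mulrDr mulr_sumr; congr (_ + _).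
  by rewrite mulrCA.
by apply: eq_bigr => j _; rewrite mulrA.
Qed.

Lemma climit_prod s : classical_limit (fun e n la => \prod_(l <- s) chpow e (b2 * e) (pad la) l)
  (\prod_(l <- s) beta l).
Proof.
elim: s => [|l s IH].
  by rewrite big_nil; apply: eq_climit climit1 => e n la _; rewrite big_nil.
rewrite big_cons mulrC; apply: eq_climit (climit_chpow l IH) => e n la _.
by rewrite big_cons mulrC.
Qed.

Lemma jack_moment_cvg s :
  jack_moment (- (b2 * e)) e V s @[e --> 0^'+] --> \prod_(l <- s) beta l.
Proof.
have [E h1 h2] := climit_prod s [::]; rewrite big_nil mulr1 in h2.
apply: cvg_trans h2; apply: near_eq_cvg; near=> e.
have e0 : 0 < e by near: e; exact: nbhs_right_gt.
have e1 : e <= 1 by near: e; apply: nbhs_right_le.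
have be0 : 0 < b2 * e by rewrite mulr_gt0.
have := h1 e; rewrite e0 e1 => /(_ isT) c; rewrite -(cvg_lim _ c) //.
rewrite /jack_moment; congr (limn _); apply/funext => N; rewrite /series /=.
apply: eq_bigr => n _; apply: eq_bigr => la _; rewrite big_nil mulr1; congr (_ * _).
by apply: eq_bigr => l _; rewrite ch_profile.
Unshelve. all: by end_near. Qed.

End JointMoments.

(** A term of a convergent nonnegative series is at most its sum; [rho] is the inverse of the radius
    [r], and the added 1 secures [1 <= A]. *)
Lemma analytic_bound (R : realType) (V : nat -> R[i]) :
  (exists r : R, 1 < r /\
     cvgn (fun N => \sum_(1 <= k < N) Num.sqrt (sqmod (V k)) * r ^+ k)) ->
  exists A rho : R, [/\ 1 <= A, 0 < rho, rho < 1 &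
     forall k, nrm (V k.+1) <= A * rho ^+ k.+1].
Proof.
move=> [r [r1]]; rewrite sum1_series => c; set u := drop0 _ in c.
have r0 : 0 < r by exact: lt_trans r1.
have u0 k : 0 <= u k.
  by case: k => [|k] //=; rewrite mulr_ge0 ?sqrtr_ge0 // exprn_ge0 // ltW.
have mono : {homo series u : m n / (m <= n)%N >-> m <= n}.
  by apply/nondecreasing_seqP => n; rewrite seriesSr lerDl.
have S0 : 0 <= limn (series u).
  apply: limr_ge => //; near=> n; rewrite series_ord; exact: sumr_ge0.
exists (1 + limn (series u)), r^-1; split.
- by rewrite lerDl.
- by rewrite invr_gt0.
- by rewrite invf_lt1.
move=> k; rewrite exprVn ler_pdivlMr ?exprn_gt0 //.
rewrite -[leLHS]/(u k.+1).
apply: (@le_trans _ _ (series u k.+2)).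
  by rewrite seriesSr lerDr series_ord; apply: sumr_ge0.
apply: le_trans (nondecreasing_cvgn_le mono c _) _.
by rewrite lerDr.
Unshelve. all: by end_near. Qed.

Theorem theorem5p1 (R : realType) (V : nat -> R[i])
  (Vanalytic : exists r : R, 1 < r /\
     cvgn (fun N => \sum_(1 <= k < N) Num.sqrt (sqmod (V k)) * r ^+ k)) :
  exists f : R -> R,
    [/\ continuous_profile f,
        (exists M : R, forall c, M <= `|c| -> f c = `|c|),
        (forall c : R, derivable f c 1 ->
           @lebesgue_measure R [set th : R | 0 <= th < 2 * pi /\ symbol V th < c]
           = (pi * (1 + derive1 f c))%:E) &
        forall (b2 : R), 0 < b2 ->
        forall s : seq nat, (0 < size s)%N ->
          (fun e1 : R => jack_moment (- (b2 * e1)) e1 V s) x @[x --> 0^'+]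
            --> \prod_(l <- s) ch l f].
Proof.
have [A [rho [A1 rho0 rho1 Vle]]] := analytic_bound Vanalytic.
have bv := bmeas_symbol A1 rho0 rho1 Vle.
have vB := symbol_le A1 rho0 rho1 Vle.
(* The symbol has no constant Fourier coefficient; here this is Newton's identity of order one,
   where [ceta] vanishes. *)
have v0 : avg (symbol V) = 0.
  have := newton_symbol A1 rho0 rho1 Vle 1; rewrite /nresid big_ord1 /= mulr0 add0r mulr1.
  by under eq_fun do rewrite expr1.
exists (lshape (symbol V)); split.
- exact: lshape_profile bv vB v0.
- by exists (symbound A rho) => c; exact: lshape_out.
- by move=> c; exact: lshape_derive.
move=> b2 b20 s _; have -> : \prod_(l <- s) ch l (lshape (symbol V))
    = \prod_(l <- s) avg (fun y => symbol V y ^+ l).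
  by apply: eq_bigr => l _; exact: (ch_lshape bv vB v0).
exact: (jack_moment_cvg A1 rho0 rho1 b20 Vle).
Qed.
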